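(* Let $1\le k\le l$ and $d\ge1$ be natural numbers and let $\Omega\colon S^{d-1}\to G(l,k)$ be a smooth map. Then the set of $\mathbb{C}^l$-valued Schwartz functions belonging to $W_1^\Omega$ is dense in $W_1^\Omega$ (in the $L_1$ norm), and (identifying a function with the corresponding absolutely continuous charge) it is $*$-weak dense in $\mathrm{BV}^\Omega$, in the $*$-weak topology inherited from $\boldsymbol{\mathrm{M}}(\mathbb{R}^d,\mathbb{C}^l)$.
   Context: $G(l,k)$ is the complex Grassmannian of $k$-dimensional complex linear subspaces of $\mathbb{C}^l$; $S^{d-1}$ is the unit sphere of $\mathbb{R}^d$. $\boldsymbol{\mathrm{M}}(\mathbb{R}^d,\mathbb{C}^l)$ is the space of $\mathbb{C}^l$-valued $\sigma$-additive Borel set functions (charges) of finite total variation, regarded as the dual of $C_0(\mathbb{R}^d,\mathbb{C}^l)$, the space of continuous functions tending to zero at infinity. The Fourier transforms are $\hat f(\xi)=\int_{\mathbb{R}^d} f(x)e^{-2\pi i\langle\xi,x\rangle}dx$ and $\hat\mu(\xi)=\int_{\mathbb{R}^d} e^{-2\pi i\langle\xi,x\rangle}d\mu(x)$. $W_1^\Omega=\{f\in L_1(\mathbb{R}^d,\mathbb{C}^l):\ \hat f(\xi)\in\Omega(\xi/|\xi|)\ \text{for all }\xi\in\mathbb{R}^d\setminus\{0\}\}$, with the $L_1$ norm. $\mathrm{BV}^\Omega=\{\mu\in\boldsymbol{\mathrm{M}}(\mathbb{R}^d,\mathbb{C}^l):\ \hat\mu(\xi)\in\Omega(\xi/|\xi|)\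 \text{for all }\xi\in\mathbb{R}^d\setminus\{0\}\}$. *)

(* Defs.v *)
From HB Require Import structures.
From mathcomp Require Import all_boot all_order all_algebra.
From mathcomp Require Import all_classical all_reals all_analysis.
From mathcomp Require Import measurable_realfun complex.

Set Implicit Arguments.
Unset Strict Implicit.
Unset Printing Implicit Defensive.

Import Order.TTheory GRing.Theory Num.Theory.
Import numFieldNormedType.Exports.
Import ComplexField.

Local Open Scope classical_set_scope.
Local Open Scope ring_scope.
Local Open Scope complex_scope.

Notation borel R d := (g_sigma_algebraType (@open 'rV[R]_d)).

Section lebesgue_rV.
Variable R : realType.

Lemma measurable_fun_borel d (T : measurableType d) n (f : T -> borel R n) :
  (forall U : set 'rV[R]_n, open U -> measurable (f @^-1` U)) ->
  measurable_fun setT f.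
Proof.
move=> h; apply: (@measurability _ _ T (borel R n) _ _ (@open 'rV[R]_n)) => //.
by move=> _ [A oA <-]; rewrite setTI; exact: h.
Qed.

Lemma measurable_coord_borel n (j : 'I_n) :
  measurable_fun [set: borel R n]
    ((fun v : 'rV[R]_n => v 0 j) : borel R n -> measurableTypeR R).
Proof.
apply: (measurability _ (RGenOpens.measurableE R)) => _ [_ [a [b ->]] <-].
rewrite setTI; apply: sub_sigma_algebra.
have /continuousP := @coord_continuous R 1 n 0 j; apply.
exact: interval_open.
Qed.

Lemma open_bigcup_rat_ball n (U : set 'rV[R]_n) : open U ->
  U = \bigcup_(q in [set q : 'rV[rat]_n * nat |
         ball (map_mx ratr q.1 : 'rV[R]_n) q.2.+1%:R^-1 `<=` U])
        ball (map_mx ratr q.1 : 'rV[R]_n) q.2.+1%:R^-1.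
Proof.
rewrite openE => oU; apply/seteqP; split=> [x Ux|x [q /= qU]]; last exact: qU.
have /nbhs_ballP[e /= e0 xeU] := oU _ Ux.
have e20 : 0 < e / 2 by rewrite divr_gt0.
have [k _ /(_ k (leqnn k)) /= ke] := near_infty_natSinv_lt (PosNum e20).
have k0 : 0 < k.+1%:R^-1 :> R by rewrite invr_gt0.
have qP j : exists q : rat, ball (x 0 j) k.+1%:R^-1 (ratr q : R).
  have ne : ball (x 0 j) k.+1%:R^-1 !=set0 by exists (x 0 j); exact: ballxx.
  have [y [xy [q _ qy]]] := dense_rat ne (@ball_open _ _ _ _).
  by exists q; rewrite qy.
pose q : 'rV[rat]_n := \row_j sval (cid (qP j)).
have xq : ball (map_mx ratr q : 'rV[R]_n) k.+1%:R^-1 x.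
  apply: ball_sym; split=> // i j; rewrite ord1 !mxE.
  by case: cid.
exists (q, k) => //= y qy; apply: xeU.
rewrite (splitr e).
by apply: ball_triangle; [exact/ball_sym/(le_ball (ltW ke) xq)
                         |exact: (le_ball (ltW ke) qy)].
Qed.

Lemma measurable_coordP d (T : measurableType d) n (f : T -> borel R n) :
  (forall j, measurable_fun setT
     ((fun t => (f t : 'rV[R]_n) 0 j) : T -> measurableTypeR R)) ->
  measurable_fun setT f.
Proof.
move=> mf; apply: measurable_fun_borel => U /open_bigcup_rat_ball ->.
rewrite preimage_bigcup bigcup_mkcond.
apply: countable_bigcupT_measurable => // -[q k]; case: ifPn => // _ /=.
rewrite (_ : _ @^-1` _ = \big[setI/setT]_(j < n)
    ((fun t => (f t : 'rV[R]_n) 0 j) @^-1`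
       (ball (ratr (q 0 j) : R) k.+1%:R^-1))).
  apply: bigsetI_measurable => j _; rewrite -[X in measurable X]setTI.
  by apply: mf => //; apply: open_measurable; exact: ball_open.
rewrite -bigcap_seq; apply/seteqP; split=> t /=.
  by move=> [_ h] j _; have := h 0 j; rewrite mxE.
move=> h; split=> [|i j]; first by rewrite invr_gt0.
by rewrite ord1 mxE; apply: h; rewrite /= mem_index_enum.
Qed.

Definition rV_cons n (p : measurableTypeR R * borel R n) : borel R n.+1 :=
  \row_i oapp (fun j => (p.2 : 'rV[R]_n) 0 j) p.1 (unlift 0 i).

Definition rV_uncons n (v : borel R n.+1) : measurableTypeR R * borel R n :=
  ((v : 'rV[R]_n.+1) 0 0, \row_j (v : 'rV[R]_n.+1) 0 (lift 0 j)).

Lemma rV_consK n : cancel (@rV_cons n) (@rV_uncons n).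
Proof.
move=> [x v]; congr (_, _); first by rewrite mxE unlift_none.
by apply/rowP => j; rewrite !mxE liftK.
Qed.

Lemma measurable_rV_cons n : measurable_fun setT (@rV_cons n).
Proof.
apply: measurable_coordP => i; rewrite /rV_cons.
rewrite (_ : (fun _ => _) = (fun p : measurableTypeR R * borel R n =>
  oapp (fun j => (p.2 : 'rV[R]_n) 0 j) p.1 (unlift 0 i))); last first.
  by apply/funext => p; rewrite mxE.
case: (unliftP 0 i) => [j _|_] /=; last exact: measurable_fst.
exact: (measurableT_comp (measurable_coord_borel j) measurable_snd).
Qed.

Lemma measurable_rV_uncons n : measurable_fun setT (@rV_uncons n).
Proof.
apply: measurable_fun_pair; first exact: measurable_coord_borel.
apply: measurable_coordP => j.
rewrite (_ : (fun _ => _) = (fun v : 'rV[R]_n.+1 => v 0 (lift 0 j))).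
  exact: measurable_coord_borel.
by apply/funext => v; rewrite mxE.
Qed.

Section step.
Variables (n : nat) (mu : {sigma_finite_measure set (borel R n) -> \bar R}).

Definition lebesgue_step : set (borel R n.+1) -> \bar R :=
  pushforward (@lebesgue_measure R \x mu)%E (@rV_cons n).

Let mpre A : measurable A -> measurable (@rV_cons n @^-1` A).
Proof.
by move=> mA; rewrite -[X in measurable X]setTI; exact: measurable_rV_cons.
Qed.

Let step0 : lebesgue_step set0 = 0%E.
Proof. by rewrite /lebesgue_step /pushforward preimage_set0 measure0. Qed.

Let step_ge0 A : (0 <= lebesgue_step A)%E.
Proof. by rewrite /lebesgue_step /pushforward; exact: measure_ge0. Qed.

Let step_sigma_additive : semi_sigma_additive lebesgue_step.
Proof.
move=> F mF tF mUF; rewrite /lebesgue_step /pushforward preimage_bigcup.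
apply: measure_semi_sigma_additive.
- by move=> k; exact: mpre.
- apply/trivIsetP => /= i j _ _ ij; rewrite -preimage_setI.
  by move/trivIsetP : tF => /(_ _ _ _ _ ij) ->//; rewrite preimage_set0.
- by rewrite -preimage_bigcup; exact: mpre.
Qed.

HB.instance Definition _ := isMeasure.Build _ _ _ lebesgue_step
  step0 step_ge0 step_sigma_additive.

Let step_sigma_finite : sigma_finite setT lebesgue_step.
Proof.
have /sigma_finiteP[F [TF ndF Foo]] := sigma_finiteT (@lebesgue_measure R).
have /sigma_finiteP[G [TG ndG Goo]] := sigma_finiteT mu.
exists (fun k => @rV_uncons n @^-1` (F k `*` G k)).
  rewrite -preimage_bigcup (_ : \bigcup_k _ = setT) ?preimage_setT//.
  apply/seteqP; split=> // -[x v] _.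
  have [i _ Fx] : (\bigcup_k F k) x by rewrite -TF.
  have [j _ Gv] : (\bigcup_k G k) v by rewrite -TG.
  exists (maxn i j) => //; split => /=.
    by move: x Fx; exact/subsetPset/ndF/leq_maxl.
  by move: v Gv; exact/subsetPset/ndG/leq_maxr.
move=> k; have [mF Fk] := Foo k; have [mG Gk] := Goo k; split.
  rewrite -[X in measurable X]setTI; apply: measurable_rV_uncons => //.
  exact: measurableX.
rewrite /lebesgue_step /pushforward -comp_preimage.
rewrite (_ : @rV_uncons n \o @rV_cons n = id); last first.
  by apply/funext => p; exact: rV_consK.
rewrite preimage_id.
by rewrite product_measure1E// lte_mul_pinfty// ge0_fin_numE.
Qed.

HB.instance Definition _ := Measure_isSigmaFinite.Build _ _ _ lebesgue_step
  step_sigma_finite.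

End step.

Fixpoint lebesgue_rV d : {sigma_finite_measure set (borel R d) -> \bar R} :=
  match d with
  | 0 => @dirac _ (borel R 0) (0 : 'rV[R]_0) R
  | n.+1 => lebesgue_step (lebesgue_rV n)
  end.

Lemma lebesgue_rV_box d (A : 'I_d -> set R) : (forall j, measurable (A j)) ->
  lebesgue_rV d [set v | forall j, A j ((v : 'rV[R]_d) 0 j)] =
  (\prod_j lebesgue_measure (A j))%E.
Proof.
elim: d A => [|n IH] A mA.
  rewrite big_ord0 /= diracE mem_set//; by case.
have mB : measurable [set v : borel R n | forall j, A (lift 0 j) (v 0 j)].
  rewrite (_ : mkset _ = \big[setI/setT]_(j < n)
      ((fun v : 'rV[R]_n => v 0 j) @^-1` (A (lift 0 j)))).
    apply: bigsetI_measurable => j _; rewrite -[X in measurable X]setTI.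
    by apply: (measurable_coord_borel j) => //; exact: mA.
  rewrite -bigcap_seq; apply/seteqP; split=> v /= h j; first by move=> _.
  by apply: h; rewrite /= mem_index_enum.
rewrite big_ord_recl -IH// -product_measure1E//; last exact: mA.
rewrite /= /lebesgue_step /pushforward; congr (_ _).
apply/seteqP; split=> -[x v] /=.
  move=> h; split; first by have := h 0; rewrite mxE unlift_none.
  by move=> j; have := h (lift 0 j); rewrite mxE liftK.
move=> [Ax Av] j; rewrite mxE.
by case: (unliftP 0 j) => [i ->|->] /=.
Qed.

End lebesgue_rV.

Section euclidean.
Variables (R : realType) (d : nat).
Implicit Types x y : 'rV[R]_d.

Definition dotr x y : R := \sum_i x 0 i * y 0 i.

(* the library norm on 'rV[R]_d is the sup norm *)
Definition enorm x : R := Num.sqrt (dotr x x).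

Lemma enorm_eq0 x : (enorm x == 0) = (x == 0).
Proof.
have sq_ge0 i : true -> 0 <= x 0 i * x 0 i by rewrite -expr2 sqr_ge0.
rewrite sqrtr_eq0 le_eqVlt ltNge sumr_ge0// orbF psumr_eq0//.
apply/idP/eqP => [/allP x0|->].
  apply/rowP => i; have /= := x0 i (mem_index_enum i).
  by rewrite mulf_eq0 orbb mxE => /eqP.
by apply/allP => i _ /=; rewrite mxE mul0r.
Qed.

Lemma enormZ a x : enorm (a *: x) = `|a| * enorm x.
Proof.
rewrite /enorm -sqrtr_sqr -sqrtrM ?sqr_ge0//; congr Num.sqrt.
by rewrite /dotr mulr_sumr; apply: eq_bigr => i _; rewrite !mxE expr2 mulrACA.
Qed.

Definition sphere := {x : 'rV[R]_d | enorm x == 1}.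

Lemma normalize_subproof x : x != 0 -> enorm ((enorm x)^-1 *: x) == 1.
Proof.
by move=> x0; rewrite enormZ ger0_norm ?invr_ge0 ?sqrtr_ge0// mulVf// enorm_eq0.
Qed.

Definition normalize x (x0 : x != 0) : sphere :=
  exist _ ((enorm x)^-1 *: x) (normalize_subproof x0).

Definition partial (i : 'I_d) (f : 'rV[R]_d -> R) : 'rV[R]_d -> R :=
  fun x => 'D_(delta_mx 0 i) f x.

Definition partials (s : seq 'I_d) (f : 'rV[R]_d -> R) : 'rV[R]_d -> R :=
  foldr partial f s.

(* meant for U open; 'D_v and the iterated partials are total functions, hence
   the explicit existence requirement at every order *)
Definition smooth_on (U : set 'rV[R]_d) (f : 'rV[R]_d -> R) :=
  forall (s : seq 'I_d) x, U x ->
    {for x, continuous (partials s f)} /\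
    forall i, derivable (partials s f) x (delta_mx 0 i).

Definition csmooth_on (U : set 'rV[R]_d) (f : 'rV[R]_d -> R[i]) :=
  smooth_on U (fun x => complex.Re (f x)) /\
  smooth_on U (fun x => complex.Im (f x)).

Definition rschwartz (f : 'rV[R]_d -> R) :=
  smooth_on setT f /\
  forall (a : 'I_d -> nat) (b : seq 'I_d), exists M : R, forall x,
    `|(\prod_i x 0 i ^+ a i) * partials b f x| <= M.

End euclidean.

Section grassmannian.
Variables (R : realType) (l k : nat).

Definition grassmannian := {V : {vspace 'rV[R[i]]_l} | \dim V == k}.

(* Affine chart of the Grassmannian attached to the k coordinates I: on the open
   set of those V that project isomorphically onto these coordinates, V is the
   row space of a unique k x l matrix A whose I-columns form the identity, and
   the other columns of A are the coordinates of V. *)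
Definition chart_coord (I : 'I_k -> 'I_l) (V : grassmannian)
    (A : 'M[R[i]]_(k, l)) :=
  colsub I A = 1%:M /\ forall v : 'rV[R[i]]_l, (v \in sval V) = (v <= A)%MS.

(* smoothness on the embedded submanifold S^{d-1} is local smooth extendability *)
Definition smooth_map d (Om : sphere R d -> grassmannian) :=
  forall z0 : sphere R d, exists (I : 'I_k -> 'I_l) (U : set 'rV[R]_d)
      (A : 'rV[R]_d -> 'M[R[i]]_(k, l)),
    [/\ open U, U (sval z0),
        forall i j, csmooth_on U (fun x => A x i j) &
        forall z : sphere R d, U (sval z) -> chart_coord I (Om z) (A (sval z))].

End grassmannian.

Section function_spaces.
Variables (R : realType) (d l : nat).
Implicit Types (f g : 'rV[R]_d -> 'rV[R[i]]_l) (xi : 'rV[R]_d).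

Definition cvnorm (v : 'rV[R[i]]_l) : R :=
  Num.sqrt (\sum_j Normc.normc (v 0 j) ^+ 2).

Definition schwartz : set ('rV[R]_d -> 'rV[R[i]]_l) :=
  [set f | forall j, rschwartz (fun x => complex.Re (f x 0 j)) /\
                     rschwartz (fun x => complex.Im (f x 0 j))].

Definition integrable_rV : set ('rV[R]_d -> 'rV[R[i]]_l) :=
  [set f | forall j,
    (lebesgue_rV R d).-integrable setT
      (fun x : borel R d => (complex.Re (f x 0 j))%:E) /\
    (lebesgue_rV R d).-integrable setT
      (fun x : borel R d => (complex.Im (f x 0 j))%:E)].

Definition cintegral (A : set (borel R d)) (h : 'rV[R]_d -> R[i]) : R[i] :=
  (\int[lebesgue_rV R d]_(x in A) complex.Re (h x))%R +i*
  (\int[lebesgue_rV R d]_(x in A) complex.Im (h x))%R.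

(* exp (- 2 pi i <xi, x>) *)
Definition fourier_char xi (x : 'rV[R]_d) : R[i] :=
  let t := - (2 * pi * dotr xi x) in cos t +i* sin t.

Definition fourier f xi : 'rV[R[i]]_l :=
  \row_j cintegral setT (fun x => f x 0 j * fourier_char xi x).

Definition W1 k (Om : sphere R d -> grassmannian R l k) :
    set ('rV[R]_d -> 'rV[R[i]]_l) :=
  [set f | integrable_rV f /\
           forall xi (xi0 : xi != 0), fourier f xi \in sval (Om (normalize xi0))].

Definition L1_dense_in (S B : set ('rV[R]_d -> 'rV[R[i]]_l)) :=
  S `<=` B /\
  forall f, B f -> forall e : R, 0 < e -> exists2 g, S g &
    (\int[lebesgue_rV R d]_x (cvnorm (f x - g x)%R)%:E < e%:E)%E.

End function_spaces.

Section vector_charges.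
Variables (R : realType) (d l : nat).

(* A C^l-valued charge, given by the real and imaginary parts of its components.
   Library charges are finite-valued, hence of finite total variation. *)
Record vcharge := VCharge {
  re_charge : 'I_l -> {charge set (borel R d) -> \bar R} ;
  im_charge : 'I_l -> {charge set (borel R d) -> \bar R} }.

HB.instance Definition _ := gen_eqMixin vcharge.
HB.instance Definition _ := gen_choiceMixin vcharge.

Definition vcharge_fun (mu : vcharge) (A : set (borel R d)) : 'rV[R[i]]_l :=
  \row_j (fine (re_charge mu j A) +i* fine (im_charge mu j A)).

(* integral against a real charge, through its Jordan decomposition; the chosen
   Hahn decomposition is irrelevant *)
Definition charge_integral (nu : {charge set (borel R d) -> \bar R})
    (h : 'rV[R]_d -> R) : R :=
  let nuPN := svalP (cid (svalP (cid (Hahn_decomposition nu)))) in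
  (\int[jordan_pos nuPN]_x h x - \int[jordan_neg nuPN]_x h x)%R.

Definition charge_cintegral (nu : {charge set (borel R d) -> \bar R})
    (h : 'rV[R]_d -> R[i]) : R[i] :=
  charge_integral nu (fun x => complex.Re (h x)) +i*
  charge_integral nu (fun x => complex.Im (h x)).

Definition vcharge_integral (mu : vcharge) (j : 'I_l)
    (h : 'rV[R]_d -> R[i]) : R[i] :=
  charge_cintegral (re_charge mu j) h +
  (0 +i* 1) * charge_cintegral (im_charge mu j) h.

Definition vcharge_fourier (mu : vcharge) (xi : 'rV[R]_d) : 'rV[R[i]]_l :=
  \row_j vcharge_integral mu j (fourier_char xi).

Definition BV k (Om : sphere R d -> grassmannian R l k) : set vcharge :=
  [set mu | forall xi (xi0 : xi != 0),
              vcharge_fourier mu xi \in sval (Om (normalize xi0))].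

Definition has_density (mu : vcharge) (f : 'rV[R]_d -> 'rV[R[i]]_l) :=
  forall A : set (borel R d), measurable A ->
    vcharge_fun mu A = \row_j cintegral A (fun x => f x 0 j).

(* continuous functions R^d -> C^l tending to zero at infinity *)
Definition C0 := {phi : 'rV[R]_d -> 'rV[R[i]]_l |
  (forall j, continuous (fun x => phi x 0 j : R[i]^o)) /\
  forall e : R, 0 < e -> exists r : R, forall x,
    r < enorm x -> cvnorm (phi x) < e}.

Definition pairing (mu : vcharge) (phi : C0) : R[i] :=
  \sum_j vcharge_integral mu j (fun x => sval phi x 0 j).

(* the space of charges with the weak-* topology as the dual of C0 *)
Definition weak_star := initial_topology
  ((fun mu phi => pairing mu phi) : vcharge -> {ptws C0 -> R[i]^o}).

Definition weak_star_dense_in (S B : set vcharge) :=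
  S `<=` B /\ B `<=` closure (S : set weak_star).

End vector_charges.

(* Main.v *)
From HB Require Import structures.
From mathcomp Require Import all_boot all_order all_algebra finmap.
From mathcomp Require Import all_classical all_reals all_analysis.
From mathcomp Require Import measurable_realfun complex ring lra.
Require Import Defs.

Set Implicit Arguments.
Unset Strict Implicit.
Unset Printing Implicit Defensive.

Import Order.TTheory GRing.Theory Num.Theory.
Import numFieldNormedType.Exports.
Import ComplexField.

Local Open Scope classical_set_scope.
Local Open Scope ring_scope.
Local Open Scope complex_scope.

(** A multiplier m(xi), with values in the l x l matrices, that sends all of C^l into
   the fiber Omega(xi/|xi|) makes the transform of any integrable f take its values
   in the fibers; if moreover m(xi) is a scalar chi(xi) on the fiber, it acts on the
   elements of W_1 as the scalar multiplier chi. Such m exist. In a chart given by k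
   columns I, the fiber is the row space of a matrix A whose I-columns form the
   identity, so that v |-> v_I A projects C^l onto the fiber and depends smoothly on
   the base point. A partition of unity glues these projections over the compact
   sphere ([fiber_projection_sphere]); composed with xi |-> xi/|xi| and multiplied by
   a cutoff chi that vanishes near 0 and near infinity, they give a smooth compactly
   supported m ([multiplier_exists]).

   Let f be in W_1. If f has compact support then its transform is smooth, m f^ is
   a test function, and its inverse transform is a Schwartz function in W_1. In
   general f is truncated: for a fixed m this costs little in L^1, because the
   inverse transform of m is integrable. Take chi(xi) = theta(a xi) - theta(xi/a),
   where theta is a cutoff equal to 1 near 0. The scalar multiplier theta(a xi) is
   the convolution with a kernel K_a of integral 1 that concentrates at 0 as a
   tends to 0, so that f * K_a tends to f ([convol_kernel_near]), while
   f * K_(1/a) tends to 0 in L^1 provided that f has integral 0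
   ([convol_kernel_far]). Both rest on the continuity of translations in L^1. This
   is [mean_zero_density]. To reduce to integral 0, one notes that f^(0), a limit
   of f^(t z) as t -> 0, belongs to the closed subspace Omega(z) for every z on
   the sphere ([fourier0_fiber]); subtracting the Schwartz function f^(0) K_1,
   which is in W_1, removes the integral ([W1_density]).

   Let mu be in BV. The convolution mu * K_a is integrable with transform
   theta(a xi) mu^(xi), hence it is in W_1, and the first part approximates it in
   L^1 by Schwartz functions of W_1. Against a function phi of C_0 it integrates
   like phi * K_a against mu, up to a reflection of the kernel, which tends to the
   integral of phi by dominated convergence ([smoothing_cvg]). So a sequence of
   Schwartz functions of W_1 tends to mu in the weak-* topology.

   Fourier analysis is only needed for test functions. Transforms of test
   functions are Schwartz functions, because differentiation and multiplication by
   a coordinate exchange roles ([bandlimited_schwartz]), and they are integrable. The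
   inversion formula enters up to a constant, which only has to be nonzero
   ([FT_IFT], [inv_cst_neq0]). *)

(** * Functions of class C^n on open sets *)

Lemma cvg_sumr (R : realType) (T I : Type) (F : set_system T) {FF : Filter F}
    (r : seq I) (P : pred I) (f : I -> T -> R) (l : I -> R) :
  (forall i, P i -> f i x @[x --> F] --> l i) ->
  \sum_(i <- r | P i) f i x @[x --> F] --> \sum_(i <- r | P i) l i.
Proof. by move=> fl; apply: cvg_big => //; exact: add_continuous. Qed.

Section smooth_calculus.
Variables (R : realType) (d : nat).
Implicit Types (f g : 'rV[R]_d -> R) (U : set 'rV[R]_d).

(** By recursion on the order, so that the closure properties of smooth functions
   are proved by induction on n; [smooth_onP] relates this to [smooth_on]. *)
Fixpoint Cn n U f : Prop :=
  (forall x, U x -> {for x, continuous f}) /\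
  match n with
  | 0 => True
  | m.+1 => forall i, (forall x, U x -> derivable f x (delta_mx 0 i)) /\
                      Cn m U (partial i f)
  end.

Lemma Cn_continuous n U f x : Cn n U f -> U x -> {for x, continuous f}.
Proof. by case: n => [|n] [+ _]; apply. Qed.

Lemma CnW n U f : Cn n.+1 U f -> Cn n U f.
Proof.
elim: n f => [|n IH] f; first by move=> [].
move=> [cf df]; split=> // i; have [di Di] := df i; split=> //.
exact: IH.
Qed.

Lemma Cn_subset n U V f : V `<=` U -> Cn n U f -> Cn n V f.
Proof.
move=> VU; elim: n f => [|n IH] f /=.
  by move=> [cf _]; split=> // x /VU; exact: cf.
move=> [cf df]; split=> [x /VU|i]; first exact: cf.
have [di Di] := df i; split=> [x /VU|]; [exact: di|exact: IH].
Qed.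

Lemma Cn_local n U f :
  (forall x, U x -> exists2 V, V x & Cn n V f) -> Cn n U f.
Proof.
elim: n f => [|n IH] f /= h.
  by split=> // x /h[V Vx [+ _]]; apply.
split=> [x /h[V Vx [+ _]]|i]; first by apply.
split=> [x /h[V Vx [_ /(_ i)[+ _]]]|]; first by apply.
by apply: IH => x /h[V Vx [_ /(_ i)[_]]]; exists V.
Qed.

Lemma near_open (P : 'rV[R]_d -> Prop) U x : open U -> U x ->
  (forall y, U y -> P y) -> \forall y \near x, P y.
Proof.
by move=> oU Ux UP; apply: filterS (open_nbhs_nbhs (conj oU Ux)).
Qed.

Lemma eq_Cn n U f g : open U -> (forall x, U x -> f x = g x) ->
  Cn n U f -> Cn n U g.
Proof.
move=> oU.
have cont h k x : U x -> (forall y, U y -> h y = k y) ->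
    {for x, continuous h} -> {for x, continuous (k : 'rV[R]_d -> R)}.
  move=> Ux hk; rewrite /prop_for /continuous_at -hk// => ch.
  have hk' : {near nbhs x, h =1 k} by exact: near_open Ux hk.
  exact: cvg_trans (near_eq_cvg hk') ch.
elim: n f g => [|n IH] f g fg; move=> [cf df].
  by split=> // x Ux; apply: cont fg (cf x Ux).
split=> [x Ux|i]; first exact: cont fg (cf x Ux).
have [di Di] := df i; split=> [x Ux|].
  by apply: (near_eq_derivable _ (di x Ux)); exact: near_open Ux fg.
apply: (IH (partial i f)) => // x Ux; rewrite /partial.
by apply: near_eq_derive; exact: near_open Ux fg.
Qed.

Lemma Cn_add n U f g : open U -> Cn n U f -> Cn n U g ->
  Cn n U (fun x => f x + g x).
Proof.
move=> oU; elim: n f g => [|n IH] f g [cf df] [cg dg].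
  by split=> // x Ux; apply: continuousD; [exact: cf|exact: cg].
split=> [x Ux|i]; first by apply: continuousD; [exact: cf|exact: cg].
have [dif Dif] := df i; have [dig Dig] := dg i; split=> [x Ux|].
  by apply: derivableD; [exact: dif|exact: dig].
apply: (eq_Cn oU _ (IH _ _ Dif Dig)) => x Ux.
by rewrite /partial -deriveD//; [exact: dif|exact: dig].
Qed.

Lemma Cn_mul n U f g : open U -> Cn n U f -> Cn n U g ->
  Cn n U (fun x => f x * g x).
Proof.
move=> oU; elim: n f g => [|n IH] f g Cf Cg.
  have [cf df] := Cf; have [cg dg] := Cg.
  by split=> // x Ux; apply: continuousM; [exact: cf|exact: cg].
have [cf df] := Cf; have [cg dg] := Cg.
split=> [x Ux|i]; first by apply: continuousM; [exact: cf|exact: cg].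
have [dif Dif] := df i; have [dig Dig] := dg i; split=> [x Ux|].
  by apply: derivableM; [exact: dif|exact: dig].
apply: (eq_Cn oU _ (Cn_add oU (IH _ _ (CnW Cf) Dig) (IH _ _ (CnW Cg) Dif))).
move=> x Ux.
rewrite /partial (@deriveM R^o _ f g)//; [exact: dif|exact: dig].
Qed.

Lemma Cn_cst n U (c : R) : open U -> Cn n U (fun=> c).
Proof.
move=> oU; elim: n c => [|n IH] c; first by split=> // x _; exact: cst_continuous.
split=> [x _|i]; first exact: cst_continuous.
split=> [x Ux|]; first exact: derivable_cst.
apply: (eq_Cn oU _ (IH 0)) => x Ux.
by rewrite /partial derive_cst.
Qed.

Lemma Cn_sum (I : Type) (r : seq I) (P : pred I) n U
    (F : I -> 'rV[R]_d -> R) : open U ->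
  (forall i, P i -> Cn n U (F i)) -> Cn n U (fun x => \sum_(i <- r | P i) F i x).
Proof.
move=> oU CF; elim: r => [|i r IH].
  by apply: (eq_Cn oU _ (Cn_cst n 0 oU)) => x _; rewrite big_nil.
case Pi: (P i).
  by apply: (eq_Cn oU _ (Cn_add oU (CF i Pi) IH)) => x _; rewrite big_cons Pi.
by apply: (eq_Cn oU _ IH) => x _; rewrite big_cons Pi.
Qed.

Lemma Cn_opp n U f : open U -> Cn n U f -> Cn n U (fun x => - f x).
Proof.
move=> oU Cf; apply: (eq_Cn oU _ (Cn_mul oU (Cn_cst n (-1) oU) Cf)) => x _.
by rewrite mulN1r.
Qed.

Lemma Cn_coord n U j : open U -> Cn n U (fun x => x 0 j).
Proof.
move=> oU; case: n => [|n].
  by split=> // x Ux; exact: coord_continuous.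
split=> [x Ux|i]; first exact: coord_continuous.
have dj x : is_derive x (delta_mx 0 i) (fun x : 'rV[R]_d => x 0 j : R^o)
    ((delta_mx 0 i : 'rV[R]_d) 0 j).
  have did : derivable (@id 'rV[R]_d) x (delta_mx 0 i) by exact: derivable_id.
  split; first exact: (proj1 (derivable_mxP _ _ _) did 0 j).
  have := derive_mx did; rewrite derive_id => /matrixP/(_ 0 j).
  by rewrite [X in _ = X]mxE => ->.
split=> [x Ux|]; first by have [] := dj x.
apply: (eq_Cn oU _ (Cn_cst n ((delta_mx 0 i : 'rV[R]_d) 0 j) oU)) => x Ux.
by rewrite /partial; have [_ ->] := dj x.
Qed.

Lemma is_derive_line f (y v : 'rV[R]_d) (t : R) : derivable f (y + t *: v) v ->
  is_derive t 1 (fun s : R => f (y + s *: v)) ('D_v f (y + t *: v)).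
Proof.
move=> df; have E : (fun h => h^-1 *: (f (y + (h *: 1 + t) *: v) - f (y + t *: v)))
    = (fun h : R => h^-1 *: (f (h *: v + (y + t *: v)) - f (y + t *: v))).
  apply/funext => h; congr (_ *: (f _ - _)).
  by rewrite scalerDl -scalerA scale1r addrCA.
by split; rewrite /derivable /derive/= E.
Qed.

Lemma mx_norm_ltP (x : 'rV[R]_d) (e : R) : 0 < e ->
  reflect (forall j, `|x 0 j| < e) (`|x| < e).
Proof.
move=> e0; apply: (iffP idP) => [xe j|xe].
  apply: le_lt_trans xe; rewrite [leRHS]/Num.Def.normr/= mx_normrE.
  exact: (le_bigmax _ (fun ij => `|x ij.1 ij.2|) (0, j)).
rewrite [ltLHS]/Num.Def.normr/= mx_normrE; apply: bigmax_lt => //= -[i j] _ /=.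
by rewrite ord1.
Qed.

Lemma coord_le_norm (x : 'rV[R]_d) j : `|x 0 j| <= `|x|.
Proof.
rewrite [leRHS]/Num.Def.normr/= mx_normrE.
exact: (le_bigmax _ (fun ij => `|x ij.1 ij.2|) (0, j)).
Qed.

Section linear_approximation.
Variables (U : set 'rV[R]_d) (f : 'rV[R]_d -> R) (a : 'rV[R]_d).
Variables (e r : R).
Hypotheses (e0 : 0 < e) (r0 : 0 < r).
Hypothesis df : forall j y, `|y - a| < r -> derivable f y (delta_mx 0 j).
Hypothesis dfe : forall j y, `|y - a| < r ->
  `|partial j f y - partial j f a| <= e.

Let increment0 j y s : 0 <= s -> `|y - a| < r ->
  `|y + s *: delta_mx 0 j - a| < r ->
  `|f (y + s *: delta_mx 0 j) - f y - s * partial j f a| <= e * `|s|.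
Proof.
move=> s0 ya ysa.
have inb t : t \in `[0, s] -> `|y + t *: delta_mx 0 j - a| < r.
  rewrite in_itv/= => /andP[t0 ts]; apply/mx_norm_ltP => // i.
  have /(mx_norm_ltP _ r0)/(_ i) := ya; have /(mx_norm_ltP _ r0)/(_ i) := ysa.
  rewrite !mxE ?eqxx/=; case: (i == j); rewrite ?mulr1 ?mulr0 ?addr0//=.
  by rewrite !ltr_norml => /andP[? ?] /andP[? ?]; apply/andP; split; lra.
have isd t : t \in `[0, s] ->
    is_derive t 1 (fun t : R => f (y + t *: delta_mx 0 j))
                  (partial j f (y + t *: delta_mx 0 j)).
  by move=> ts; apply: is_derive_line; apply: df; exact: inb.
pose g := fun t : R => f (y + t *: delta_mx 0 j).
pose dg := fun t : R => partial j f (y + t *: delta_mx 0 j).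
have isg t : t \in `]0, s[%R -> is_derive t (1 : R) g (dg t).
  by move=> /andP[t0 ts]; apply: isd; rewrite in_itv/=; apply/andP; split; exact: ltW.
have cg : {within `[0, s], continuous g}.
  apply: derivable_within_continuous => t ts.
  by have [] := isd t ts.
have MV := @MVT_segment R g dg 0 s s0 isg cg.
move: MV => [c cs].
rewrite /g /dg scale0r addr0 subr0 => ->.
rewrite [s * _]mulrC -mulrBl normrM ler_wpM2r// dfe//; exact: inb.
Qed.

Let increment j y s : `|y - a| < r ->
  `|y + s *: delta_mx 0 j - a| < r ->
  `|f (y + s *: delta_mx 0 j) - f y - s * partial j f a| <= e * `|s|.
Proof.
move=> ya ysa; have [s0|/ltW s0] := leP 0 s; first exact: increment0.
have := @increment0 j (y + s *: delta_mx 0 j) (- s).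
rewrite scaleNr addrK oppr_ge0 s0 normrN => /(_ isT ysa ya).
by apply: le_trans; rewrite -normrN le_eqVlt; apply/orP; left; apply/eqP;
  congr (`|_|); ring.
Qed.

(** The increment along h is split into increments along the coordinate axes, and
   the mean value theorem applies to each of them. A bound e on the variation of
   the partial derivatives, rather than their continuity, makes this usable also
   where they are only known to be bounded ([continuous_trig]). *)
Lemma linear_approximation h : `|h| < r ->
  `|f (a + h) - f a - \sum_j h 0 j * partial j f a| <= e * \sum_j `|h 0 j|.
Proof.
move=> hr.
(* p n keeps the first n coordinates of h *)
pose p n : 'rV[R]_d := \row_j (if (j < n)%N then h 0 j else 0).
have pr n : `|a + p n - a| < r.
  rewrite addrAC subrr add0r; apply/mx_norm_ltP => // j; rewrite mxE.
  by case: ifP => _; [exact: (mx_norm_ltP _ _ hr)|rewrite normr0].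
have pS (j : 'I_d) : a + p j.+1 = a + p j + h 0 j *: delta_mx 0 j.
  rewrite -addrA; congr (_ + _); apply/rowP => i; rewrite !mxE ?eqxx/= ltnS.
  rewrite leq_eqVlt -(inj_eq val_inj)/=; case: (ltngtP i j) => //= ij.
  - by rewrite mulr0 addr0.
  - by rewrite mulr0 addr0.
  - by rewrite mulr1 add0r; congr (h 0 _); exact: val_inj.
have -> : f (a + h) - f a = \sum_(j < d) (f (a + p j.+1) - f (a + p j)).
  rewrite -(big_mkord xpredT (fun j => f (a + p j.+1) - f (a + p j))).
  rewrite telescope_sumr//; congr (f (_ + _) - f _).
    by apply/rowP => j; rewrite mxE ltn_ord.
  rewrite [X in _ + X](_ : _ = 0) ?addr0//.
  by apply/rowP => j; rewrite !mxE ltn0.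
rewrite -sumrB mulr_sumr; apply: le_trans (ler_norm_sum _ _ _) _.
apply: ler_sum => j _; rewrite pS; apply: increment; first exact: pr.
by rewrite -pS; exact: pr.
Qed.

End linear_approximation.

(** Continuous partial derivatives vary by at most e near a, so that f is totally
   differentiable at a by [linear_approximation]. *)
Lemma C1_approximation U f a e : open U -> Cn 1 U f -> U a -> 0 < e ->
  \forall h \near (0 : 'rV[R]_d), `|f (a + h) - f a - \sum_j h 0 j * partial j f a|
                     <= e * \sum_j `|h 0 j|.
Proof.
move=> oU [cf df] Ua e0.
have [r0 /= r00 r0U] : exists2 r, 0 < r & forall y, `|y - a| < r -> U y.
  have /nbhs_ballP[r /= r00 rU] := open_nbhs_nbhs (conj oU Ua).
  exists r => // y ya; apply: rU.
  by rewrite -ball_normE/= -normrN opprB.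
have nj j : \forall y \near a, `|partial j f y - partial j f a| <= e.
  have [_ [+ _]] := df j.
  by move=> /(_ a Ua)/cvgrPdist_le/(_ e e0); under eq_near do rewrite distrC.
have nall : \forall y \near a, forall j, `|partial j f y - partial j f a| <= e.
  exact: (filter_forall (nbhs_filter a) nj).
have [r1 /= r10 r1U] := (nbhs_ballP _ _).1 nall.
apply/nbhs_ballP; exists (Num.min r0 r1) => /=; first by rewrite lt_min r00.
move=> h; rewrite -ball_normE/= sub0r normrN => hr.
have m0 : 0 < Num.min r0 r1 by rewrite lt_min r00.
apply: (linear_approximation m0 _ _ hr).
- by move=> j y; rewrite lt_min => /andP[/r0U + _]; have [+ _] := df j; apply.
- move=> j y; rewrite lt_min => /andP[_ yr]; apply: r1U.
  by rewrite -ball_normE/= -normrN opprB.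
Qed.

(** Only the derivative of u in the direction v enters: its difference quotients
   stay bounded, which absorbs the error in the total differentiability of f. *)
Lemma is_derive_chain U f (u : 'rV[R]_d -> 'rV[R]_d) (x v : 'rV[R]_d) :
  open U -> Cn 1 U f -> U (u x) -> derivable u x v ->
  is_derive x v (fun y => f (u y))
    (\sum_j ('D_v u x) 0 j * partial j f (u x)).
Proof.
move=> oU Cf Uux du.
pose q (t : R) := t^-1 *: (u (t *: v + x) - u x).
have qc : q t @[t --> 0^'] --> 'D_v u x by exact: du.
have uc : (u (t *: v + x) - u x) @[t --> 0^'] --> (0 : 'rV[R]_d).
  have : t *: q t @[t --> 0^'] --> (0 : R) *: 'D_v u x.
    by apply: cvgZ => //; apply: cvg_within_filter; exact: cvg_id.
  rewrite scale0r; apply: cvg_trans; apply: near_eq_cvg; near=> t.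
  by rewrite /q scalerA mulfV ?scale1r//; near: t; exact: nbhs_dnbhs_neq.
suff H : (fun t : R => t^-1 *: (f (u (t *: v + x)) - f (u x))) t @[t --> 0^'] -->
     (\sum_j ('D_v u x) 0 j * partial j f (u x) : R).
  split; first by apply/cvg_ex; eexists; exact: H.
  exact/cvg_lim.
have qj j : (q t) 0 j @[t --> 0^'] --> ('D_v u x) 0 j.
  exact: (cvg_comp q (fun v : 'rV[R]_d => v 0 j) qc (@coord_continuous R 1 d 0 j _)).
have sc : (\sum_j (q t) 0 j * partial j f (u x)) @[t --> 0^'] -->
     (\sum_j ('D_v u x) 0 j * partial j f (u x) : R).
  by apply: cvg_sumr => j _; apply: cvgMl; exact: qj.
have nc : (\sum_j `|(q t) 0 j|) @[t --> 0^'] --> (\sum_j `|('D_v u x) 0 j| : R).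
  by apply: cvg_sumr => j _; apply: cvg_norm; exact: qj.
set M : R := \sum_j `|('D_v u x) 0 j| + 1.
have M0 : 0 < M by rewrite ltr_wpDl// sumr_ge0.
have Mc : \forall t \near 0^', \sum_j `|(q t) 0 j| <= M.
  by apply: (cvgr_le _ nc); rewrite ltrDl.
apply/cvgrPdist_le => e e0.
have e2 : 0 < e / 2 by rewrite divr_gt0.
have eM : 0 < e / 2 / M by rewrite divr_gt0.
near=> t.
have t0 : t != 0 by near: t; exact: nbhs_dnbhs_neq.
rewrite -(subrKA (\sum_j (q t) 0 j * partial j f (u x))) (splitr e).
apply: le_trans (ler_normD _ _) _; apply: lerD.
  by near: t; move/cvgrPdist_le : sc; exact.
have -> : \sum_j (q t) 0 j * partial j f (u x) -
    t^-1 *: (f (u (t *: v + x)) - f (u x)) =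
    - (t^-1 * (f (u x + (u (t *: v + x) - u x)) - f (u x) -
      \sum_j (u (t *: v + x) - u x) 0 j * partial j f (u x))).
  rewrite [u x + _]addrC subrK mulrBr opprB mulr_sumr; congr (_ - _).
  by apply: eq_bigr => j _; rewrite /q mxE mulrA.
rewrite normrN normrM.
apply: (@le_trans _ _ (`|t^-1| * (e / 2 / M * \sum_j `|(u (t *: v + x) - u x) 0 j|))).
  rewrite ler_wpM2l//; near: t.
  exact: uc _ (C1_approximation oU Cf Uux eM).
rewrite mulrCA -[leRHS](divfK (lt0r_neq0 M0)) ler_wpM2l ?(ltW eM)//.
apply: (@le_trans _ _ (\sum_j `|(q t) 0 j|)); last by near: t.
rewrite mulr_sumr; apply: ler_sum => j _; rewrite /q.
by rewrite -normrM [X in _ <= `|X|]mxE.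
Unshelve. all: by end_near. Qed.

End smooth_calculus.

Section smooth_composition.
Variables (R : realType) (d : nat).
Implicit Types (f g : 'rV[R]_d -> R) (U : set 'rV[R]_d).

Lemma smooth_on_partial U f i : smooth_on U f -> smooth_on U (partial i f).
Proof.
move=> sf s x Ux; have := sf (rcons s i) x Ux.
by rewrite /partials foldr_rcons.
Qed.

Lemma smooth_onP U f : smooth_on U f <-> forall n, Cn n U f.
Proof.
split=> [sf n|Cf s x Ux].
  elim: n f sf => [|n IH] f sf.
    by split=> // x Ux; have [] := sf [::] x Ux.
  split=> [x Ux|i]; first by have [] := sf [::] x Ux.
  split=> [x Ux|]; first by have [_] := sf [::] x Ux.
  by apply: IH; exact: smooth_on_partial.
have [n ns] : exists n, n = size s by exists (size s).
elim: n s f Cf ns => [|n IH] s f Cf ns.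
  move: ns => /esym/size0nil -> /=; split; first exact: Cn_continuous (Cf 0) Ux.
  by have [_ df] := Cf 1 => i; have [+ _] := df i; exact.
case/lastP: s ns => // s i; rewrite size_rcons => -[ns].
rewrite /partials foldr_rcons; apply: IH => // m.
by have [_ /(_ i)[]] := Cf m.+1.
Qed.

Lemma is_derive_comp1 f (phi : R -> R) (x v : 'rV[R]_d) (a : R) :
  derivable f x v -> is_derive (f x) 1 phi a ->
  is_derive x v (fun y => phi (f y)) (a * 'D_v f x).
Proof.
move=> df dphi.
have E h : f (h *: v + x) = f (x + h *: v) by rewrite addrC.
have d1 : is_derive (0 : R) 1 (fun h : R => f (x + h *: v)) ('D_v f x).
  have := @is_derive_line R d f x v 0; by rewrite scale0r addr0 => /(_ df).
have d2 : is_derive (0 : R) 1 (phi \o (fun h : R => f (x + h *: v)))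
    (a * 'D_v f x).
  by apply: is_derive1_comp => /=; rewrite scale0r addr0.
have Q : (fun h : R => h^-1 *: (phi (f (h *: v + x)) - phi (f x))) =
    (fun h : R => h^-1 *: ((phi \o (fun h : R => f (x + h *: v))) (h *: 1 + 0)
       - (phi \o (fun h : R => f (x + h *: v))) 0)).
  apply/funext => h /=; rewrite scale0r addr0 E.
  by rewrite addr0 [_ *: 1]mulr1.
have [d3 d4] := d2.
by split; rewrite /derivable /derive/= Q.
Qed.

(** A family of functions of one variable that is stable under differentiation
   acts by composition on functions of class C^n: each differentiation of
   [phi \o f] only costs a factor, a derivative of [f]. *)
Lemma Cn_comp1 (D : set R) (P : set (R -> R)) n U f phi :
  (forall psi, P psi -> exists2 psi', P psi' &
     forall t, D t -> is_derive t 1 psi (psi' t)) ->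
  open U -> (forall x, U x -> D (f x)) -> P phi -> Cn n U f ->
  Cn n U (fun x => phi (f x)).
Proof.
move=> Pstable oU UD.
have cont psi : P psi -> (forall x, U x -> {for x, continuous f}) ->
    forall x, U x -> {for x, continuous (fun x => psi (f x))}.
  move=> /Pstable[psi' _ dpsi] cf x Ux.
  apply: (@continuous_comp _ _ _ f psi); first exact: cf.
  have [dx _] := dpsi _ (UD x Ux).
  exact/differentiable_continuous/derivable1_diffP.
elim: n phi => [|n IH] phi Pphi Cf.
  by split=> //; apply: cont => // x Ux; exact: Cn_continuous Cf Ux.
have [psi' Ppsi' dphi] := Pstable _ Pphi.
split; first by apply: cont => // x Ux; exact: Cn_continuous Cf Ux.
move=> i; have [_ /(_ i)[df Df]] := Cf.
have dc x : U x -> is_derive x (delta_mx 0 i) (fun x => phi (f x))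
    (psi' (f x) * partial i f x).
  by move=> Ux; apply: is_derive_comp1; [exact: df|exact/dphi/UD].
split=> [x Ux|]; first by have [] := dc x Ux.
apply: (eq_Cn oU _ (Cn_mul oU (IH _ Ppsi' (CnW Cf)) Df)) => x Ux.
by have [_ <-] := dc x Ux.
Qed.

Lemma is_derive1_monomial (r : R -> R) (t dr c : R) k : is_derive t 1 r dr ->
  is_derive t 1 (fun s => c * r s ^+ k) (c * (k%:R * r t ^+ k.-1 * dr)).
Proof.
move=> dr1; have := is_deriveZ c (is_deriveX k dr1).
rewrite (_ : c \*: _ = fun s => c * r s ^+ k)//.
by apply/funext => s; rewrite /= fctE.
Qed.

(** The multiples of the powers of r form a family that is stable under
   differentiation as soon as r' is a multiple of a positive power of r. This
   covers 1/t and 1/sqrt t. *)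
Lemma Cn_autonomous (D : set R) (r : R -> R) (b : R) m n U f :
  (forall t, D t -> is_derive t 1 r (b * r t ^+ m.+1)) ->
  open U -> (forall x, U x -> D (f x)) -> Cn n U f ->
  Cn n U (fun x => r (f x)).
Proof.
move=> dr oU UD.
pose P := [set phi : R -> R | exists c k, phi = fun t => c * r t ^+ k].
apply: (@Cn_comp1 D P) => //; last first.
  by exists 1, 1%N; apply/funext => t; rewrite mul1r expr1.
move=> _ [c [k ->]]; exists (fun t => (c * k%:R * b) * r t ^+ (k + m)).
  by exists (c * k%:R * b), (k + m)%N.
move=> t Dt; apply: is_derive_eq (is_derive1_monomial c k (dr t Dt)) _.
case: k => [|k]; first by rewrite !(mul0r, mulr0).
by rewrite /= addSn -addnS exprD; ring.
Qed.

Lemma Cn_inv n U f : open U -> (forall x, U x -> f x != 0) -> Cn n U f ->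
  Cn n U (fun x => (f x)^-1).
Proof.
move=> oU f0; apply: (@Cn_autonomous [set t | t != 0] GRing.inv (-1) 1) => // t t0.
apply: is_derive_eq (is_deriveV (f := id) t0 (is_derive_id _ _)) _.
by rewrite [_ *: _]mulr1 mulN1r exprVn.
Qed.

Lemma Cn_rsqrt n U f : open U -> (forall x, U x -> 0 < f x) -> Cn n U f ->
  Cn n U (fun x => (Num.sqrt (f x))^-1).
Proof.
move=> oU f0.
apply: (@Cn_autonomous [set t | 0 < t] (fun t => (Num.sqrt t)^-1) (- 2^-1) 2) => //.
move=> t t0; have st0 : Num.sqrt t != 0 by rewrite gt_eqF ?sqrtr_gt0.
apply: is_derive_eq (is_deriveV st0 (is_derive1_sqrt t0)) _.
by rewrite [_ *: _]mulrC invfM exprVn -exprVn !exprVn; field.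
Qed.

End smooth_composition.

(** * A smooth bump function *)

Section flat_exponential.
Variable R : realType.
Implicit Types (p : {poly R}) (t : R).

(** With p ranging over all polynomials, the functions p(1/t) exp(-1/t), extended
   by 0, form a family that is stable under differentiation and contains
   exp(-1/t). *)
Definition flat_exp p t : R := if 0 < t then p.[t^-1] * expR (- t^-1) else 0.

Lemma expn_expRN (s : R) k : 0 <= s -> s ^+ k * expR (- s) <= k`!%:R.
Proof.
move=> s0; rewrite expRN ler_pdivrMr ?expR_gt0//.
case: k => [|k]; first by rewrite expr0 mul1r -expR0 ler_expR.
rewrite mulrC -ler_pdivrMr ?ltr0n ?fact_gt0//.
by apply: le_trans (expR_ge1Dxn k s0); rewrite lerDr.
Qed.

(** A quadratic bound forces the derivative at 0 to exist and to vanish. *)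
Lemma flat_exp_bound p :
  exists2 C : R, 0 <= C & forall t, `|flat_exp p t| <= C * t ^+ 2.
Proof.
exists (\sum_(i < size p) `|p`_i| * (i + 2)`!%:R).
  by apply: sumr_ge0 => i _; rewrite mulr_ge0.
move=> t; rewrite /flat_exp; case: ifPn => [t0|_]; last first.
  rewrite normr0 mulr_ge0 ?sqr_ge0//.
  by apply: sumr_ge0 => i _; rewrite mulr_ge0.
rewrite horner_coef mulr_suml mulr_suml; apply: le_trans (ler_norm_sum _ _ _) _.
apply: ler_sum => i _; rewrite -!mulrA normrM ler_wpM2l//.
rewrite ger0_norm ?mulr_ge0 ?exprn_ge0 ?invr_ge0 ?expR_ge0 ?(ltW t0)//.
rewrite -ler_pdivrMr ?exprn_gt0// -exprVn mulrAC -exprD.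
by apply: expn_expRN; rewrite invr_ge0 ltW.
Qed.

(** For t > 0, (p(1/t) exp(-1/t))' = t^-2 (p(1/t) - p'(1/t)) exp(-1/t). *)
Lemma is_derive_flat_exp p t :
  is_derive t 1 (flat_exp p) (flat_exp ('X^2 * (p - p^`())) t).
Proof.
have [t0|t0|->] := ltgtP t 0.
- have nt : \forall s \near t, cst 0 s = flat_exp p s.
    near=> s; rewrite /flat_exp ltNge (_ : s <= 0)//= ltW//.
    by near: s; exact: lt_nbhsl.
  rewrite {2}/flat_exp ltNge (ltW t0)/=.
  exact: near_eq_is_derive nt (is_derive_cst _ _ _).
- have tn0 : t != 0 by rewrite gt_eqF.
  have dV := is_deriveV (f := id) tn0 (is_derive_id t (1 : R)).
  have dp : is_derive t (1 : R) (horner p \o GRing.inv)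
      (p^`().[t^-1] * (- t ^- 2 *: 1)).
    have dh : is_derive t^-1 (1 : R) (horner p) p^`().[t^-1].
      split; first exact: derivable_horner.
      by rewrite -derive1E -derivE.
    exact: is_derive1_comp dh dV.
  have de : is_derive t (1 : R) (expR \o (fun s => - s^-1))
      (expR (- t^-1) * - (- t ^- 2 *: 1)).
    exact: is_derive1_comp (is_deriveN dV).
  have nt : \forall s \near t,
      ((horner p \o GRing.inv) * (expR \o (fun s => - s^-1))) s = flat_exp p s.
    near=> s; rewrite /flat_exp ifT//.
    by near: s; exact: lt_nbhsr.
  apply: near_eq_is_derive nt _.
  apply: is_derive_eq (is_deriveM dp de) _.
  rewrite /flat_exp t0 !hornerE /= /GRing.scale/= -exprVn; ring.
- have [C C0 bC] := flat_exp_bound p.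
  have f0 q : flat_exp q 0 = 0 by rewrite /flat_exp ltxx.
  rewrite f0.
  have H : (fun h : R => h^-1 *: (flat_exp p (h *: 1 + 0) - flat_exp p 0)) h
      @[h --> 0^'] --> (0 : R).
    apply/cvgr0Pnorm_le => e e0.
    near=> h.
    have h0 : h != 0 by near: h; exact: nbhs_dnbhs_neq.
    rewrite f0 subr0 addr0 [_ *: 1]mulr1 normrM normfV.
    rewrite ler_pdivrMl ?normr_gt0//; apply: le_trans (bC h) _.
    rewrite -real_normK ?num_real// expr2 mulrCA ler_wpM2l//.
    have C1 : 0 < C + 1 by rewrite ltr_wpDl.
    apply: (@le_trans _ _ ((C + 1) * `|h|)); first by rewrite ler_wpM2r ?lerDl.
    rewrite -ler_pdivlMl//; near: h; apply: dnbhs0_le.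
    by rewrite mulr_gt0 ?invr_gt0 ?ltr_wpDl.
  by split; [apply/cvg_ex; eexists; exact: H|exact/cvg_lim].
Unshelve. all: by end_near. Qed.

Definition bump (t : R) : R := flat_exp 1 t.

Lemma bump_gt0 t : 0 < t -> 0 < bump t.
Proof. by move=> t0; rewrite /bump /flat_exp t0 hornerC mul1r expR_gt0. Qed.

Lemma bump_le0 t : t <= 0 -> bump t = 0.
Proof. by move=> t0; rewrite /bump /flat_exp ltNge t0. Qed.

Lemma bump_ge0 t : 0 <= bump t.
Proof. by have [/bump_le0->//|/bump_gt0/ltW] := leP t 0. Qed.

End flat_exponential.

Section smooth_functions.
Variables (R : realType) (d : nat).
Implicit Types (f g : 'rV[R]_d -> R) (U : set 'rV[R]_d).

Lemma Cn_bump n U f : open U -> Cn n U f -> Cn n U (fun x => bump (f x)).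
Proof.
move=> oU; pose P := [set phi : R -> R | exists p, phi = flat_exp p].
apply: (@Cn_comp1 _ _ setT P) => //; last by exists 1.
move=> _ [p ->]; exists (flat_exp ('X^2 * (p - p^`()))).
  by exists ('X^2 * (p - p^`())).
by move=> t _; exact: is_derive_flat_exp.
Qed.

Lemma cvg_row (T : Type) (F : set_system T) {FF : Filter F}
    (u : T -> 'rV[R]_d) (l : 'rV[R]_d) :
  (forall j, u t 0 j @[t --> F] --> l 0 j) -> u t @[t --> F] --> l.
Proof.
move=> ul; apply/cvgrPdist_lt => e e0.
have nj j : \forall t \near F, `|l 0 j - u t 0 j| < e.
  by move/cvgrPdist_lt : (ul j); exact.
apply: filterS (filter_forall _ nj) => t ut; apply/mx_norm_ltP => // j.
by rewrite !mxE.
Qed.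

Lemma continuous_row (u : 'rV[R]_d -> 'rV[R]_d) x :
  (forall j, {for x, continuous (fun x => u x 0 j)}) -> {for x, continuous u}.
Proof. by move=> uc; apply: (cvg_row (FF := nbhs_filter x)). Qed.

(** By the chain rule the partial derivatives of f o u are sums of products of
   partial derivatives of the components of u with partial derivatives of f
   composed with u, to which the induction hypothesis applies. *)
Lemma Cn_comp n (U V : set 'rV[R]_d) f (u : 'rV[R]_d -> 'rV[R]_d) :
  open U -> open V -> (forall x, V x -> U (u x)) ->
  (forall j, Cn n V (fun x => u x 0 j)) -> Cn n U f ->
  Cn n V (fun x => f (u x)).
Proof.
move=> oU oV VU; elim: n f => [|n IH] f Cu Cf.
  split=> // x Vx; apply: (@continuous_comp _ _ _ u f).
    by apply: continuous_row => j; exact: Cn_continuous (Cu j) Vx.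
  by apply: Cn_continuous Cf _; exact: VU.
have du x i : V x -> derivable u x (delta_mx 0 i).
  move=> Vx; apply/derivable_mxP => k j; rewrite ord1.
  by have [_ /(_ i)[+ _]] := Cu j; exact.
have C1f : Cn 1 U f.
  have [cf df] := Cf; split=> // i; have [di Di] := df i; split=> //.
  by split=> // x Ux; exact: Cn_continuous Di Ux.
have dc x i : V x -> is_derive x (delta_mx 0 i) (fun x => f (u x))
    (\sum_j partial i (fun x => u x 0 j) x * partial j f (u x)).
  move=> Vx; apply: is_derive_eq (is_derive_chain oU C1f (VU x Vx) (du x i Vx)) _.
  by apply: eq_bigr => j _; rewrite derive_mx ?mxE//; exact: du.
split=> [x Vx|i].
  apply: (@continuous_comp _ _ _ u f).
    by apply: continuous_row => j; exact: Cn_continuous (Cu j) Vx.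
  by apply: Cn_continuous Cf _; exact: VU.
split=> [x Vx|]; first by have [] := dc x i Vx.
apply: (eq_Cn oV (f := fun x => \sum_j
    partial i (fun x => u x 0 j) x * partial j f (u x))).
  by move=> x Vx; have [_ <-] := dc x i Vx.
apply: Cn_sum => // j _; apply: Cn_mul => //.
  by have [_ /(_ i)[]] := Cu j.
apply: IH => [k|]; first exact/CnW/Cu.
by have [_ /(_ j)[]] := Cf.
Qed.

End smooth_functions.

(** * Affine changes of variables for Lebesgue measure *)

Section lebesgue_affine.
Variables (R : realType) (d : nat).
Local Notation leb := (lebesgue_rV R d).

Definition open_box (a b : 'I_d -> R) : set (borel R d) :=
  [set v | forall j, `]a j, b j[%classic ((v : 'rV[R]_d) 0 j)].

Definition open_boxes : set (set (borel R d)) :=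
  [set A | exists a b, A = open_box a b].

Lemma ball_box (x : 'rV[R]_d) (e : R) : 0 < e ->
  ball x e = open_box (fun j => x 0 j - e) (fun j => x 0 j + e).
Proof.
move=> e0; rewrite -ball_normE; apply/seteqP; split=> y /=.
  move=> /(mx_norm_ltP _ e0) xy j; have := xy j; rewrite !mxE/= in_itv/=.
  by rewrite ltr_norml => /andP[? ?]; apply/andP; split; lra.
move=> xy; apply/(mx_norm_ltP _ e0) => j; have := xy j; rewrite !mxE/= in_itv/=.
by rewrite ltr_norml => /andP[? ?]; apply/andP; split; lra.
Qed.

Lemma measurable_open_box a b : measurable (open_box a b).
Proof.
rewrite (_ : open_box a b = \big[setI/setT]_(j < d)
    ((fun v : borel R d => (v : 'rV[R]_d) 0 j : measurableTypeR R) @^-1` `]a j, b j[%classic)).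
  apply: bigsetI_measurable => j _; rewrite -[X in measurable X]setTI.
  by apply: (measurable_coord_borel j).
rewrite -bigcap_seq; apply/seteqP; split=> v /= h j; first by move=> _; exact: h.
by apply: h; rewrite /= mem_index_enum.
Qed.

(** Rational balls of the sup norm are open boxes, and every open set is a
   countable union of them. *)
Lemma measurable_borel_boxes : @measurable _ (borel R d) = <<s open_boxes >>.
Proof.
apply/seteqP; split; last first.
  apply: smallest_sub; first exact: sigma_algebra_measurable.
  by move=> _ [a [b ->]]; exact: measurable_open_box.
apply: smallest_sub; first exact: smallest_sigma_algebra.
move=> U /open_bigcup_rat_ball ->; rewrite bigcup_mkcond.
apply: (@countable_bigcupT_measurable _ (g_sigma_algebraType open_boxes)) => // -[q k].
case: ifPn => // _; apply: sub_sigma_algebra.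
rewrite ball_box ?invr_gt0//=.
by eexists; eexists.
Qed.

Lemma lebesgue_preimage_affine (a h u v : R) : a != 0 ->
  (@lebesgue_measure R [set t | `]u, v[%classic (a * t + h)%R] =
   (`|a|^-1)%:E * (Num.max 0 (v - u))%:E)%E.
Proof.
move=> a0.
have H s t : (lebesgue_measure `]s, t[%classic = (Num.max 0 (t - s))%:E :> \bar R)%E.
  rewrite lebesgue_measure_itv/= lte_fin; case: ifPn => st.
    by rewrite -EFinD max_r// subr_ge0 ltW.
  by rewrite max_l// subr_le0 leNgt.
have aV0 : 0 < `|a|^-1 by rewrite invr_gt0 normr_gt0.
have [aneg|apos|/eqP] := ltgtP a 0; last by rewrite (negbTE a0).
  rewrite (_ : [set t | _ (a * t + h)%R] = `](v - h) / a, (u - h) / a[%classic); last first.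
    apply/seteqP; split=> t /=; rewrite !in_itv/= ltr_ndivrMr// ltr_ndivlMr//;
    rewrite mulrC => /andP[? ?]; apply/andP; split; lra.
  rewrite H -EFinM; congr EFin.
  rewrite maxr_pMr ?ltW// mulr0; congr (Num.max _ _).
  by rewrite ltr0_norm// invrN mulNr; field.
rewrite (_ : [set t | _ (a * t + h)%R] = `](u - h) / a, (v - h) / a[%classic); last first.
  apply/seteqP; split=> t /=; rewrite !in_itv/= ltr_pdivrMr// ltr_pdivlMr//;
  rewrite mulrC => /andP[? ?]; apply/andP; split; lra.
rewrite H -EFinM; congr EFin.
rewrite maxr_pMr ?ltW// mulr0; congr (Num.max _ _).
by rewrite gtr0_norm//; field.
Qed.

Definition affine (a : R) (h : 'rV[R]_d) (x : borel R d) : borel R d :=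
  a *: (x : 'rV[R]_d) + h.

Lemma measurable_continuous_rV n (f : 'rV[R]_d -> 'rV[R]_n) : continuous f ->
  measurable_fun setT (f : borel R d -> borel R n).
Proof.
move=> cf; apply: measurable_fun_borel => U oU; apply: sub_sigma_algebra.
by move/continuousP : cf; exact.
Qed.

Lemma measurable_affine a h : measurable_fun setT (affine a h).
Proof.
apply: (@measurable_continuous_rV _ (fun x => a *: x + h)) => x.
by apply: continuousD; [exact: scaler_continuous|exact: cst_continuous].
Qed.

HB.instance Definition _ a h :=
  isMeasurableFun.Build _ _ _ _ (affine a h) (@measurable_affine a h).

Lemma lebesgue_affine_box (c : R) (h : 'rV[R]_d) a b : c != 0 ->
  leb (affine c h @^-1` open_box a b) =
  ((`|c|^-1 ^+ d)%:E * (\prod_j Num.max 0 (b j - a j))%:E)%E.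
Proof.
move=> c0; pose A j := [set t : R | `]a j, b j[%classic (c * t + h 0 j)].
rewrite (_ : _ @^-1` _ = [set v : borel R d | forall j, A j ((v : 'rV[R]_d) 0 j)]).
  rewrite (lebesgue_rV_box (A := A)); last first.
    move=> j; rewrite -[X in measurable X]setTI.
    have mf : measurable_fun setT (fun t : R => c * t + h 0 j).
      by apply: measurable_funD => //; exact: measurable_funM.
    by apply: mf => //; exact: measurable_itv.
  rewrite -EFinM (_ : `|c|^-1 ^+ d = \prod_(j < d) `|c|^-1); last first.
    by rewrite prodr_const card_ord.
  rewrite -big_split/= (big_morph EFin EFinM erefl); apply: eq_bigr => j _.
  by rewrite lebesgue_preimage_affine.
by apply/seteqP; split=> v /= vab j; have := vab j; rewrite /A/= !mxE.
Qed.

Lemma lebesgue_open_box a b :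
  leb (open_box a b) = (\prod_j Num.max 0 (b j - a j))%:E.
Proof.
have := @lebesgue_affine_box 1 0 a b (oner_neq0 _).
rewrite normr1 invr1 expr1n mul1e => <-; congr (leb _).
by rewrite /affine; apply/seteqP; split=> v /=; rewrite scale1r addr0.
Qed.

Lemma setI_open_boxes : setI_closed open_boxes.
Proof.
move=> _ _ [a [b ->]] [a' [b' ->]].
exists (fun j => Num.max (a j) (a' j)), (fun j => Num.min (b j) (b' j)).
apply/seteqP; split=> v /=.
  move=> [h h'] j; have := h j; have := h' j; rewrite /= !in_itv/=.
  by rewrite gt_max lt_min => /andP[-> ->] /andP[-> ->].
move=> h; split=> j; have := h j; rewrite /= !in_itv/= gt_max lt_min;
  by move=> /andP[/andP[? ?] /andP[? ?]]; apply/andP.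
Qed.

Lemma bigcup_open_box :
  \bigcup_n open_box (fun=> - n%:R) (fun=> n%:R) = setT.
Proof.
apply/seteqP; split=> // v _.
have [n vn] : exists n : nat, `|(v : 'rV[R]_d)| < n%:R.
  by exists (Num.truncn `|(v : 'rV[R]_d)|).+1; exact: truncnS_gt.
exists n => // j; rewrite /= in_itv/= -ltr_norml.
exact: le_lt_trans (coord_le_norm _ _) vn.
Qed.

(** Both sides are measures in A that agree on open boxes, where the computation is
   made one coordinate at a time; the boxes are stable under intersection and
   generate the Borel sets, so the measures agree. *)
Lemma pushforward_affine (a : R) (h : 'rV[R]_d) (A : set (borel R d)) :
  a != 0 -> measurable A ->
  leb (affine a h @^-1` A) = ((`|a|^-1 ^+ d)%:E * leb A)%E.
Proof.
move=> a0 mA.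
have aV0 : 0 <= `|a|^-1 ^+ d by rewrite exprn_ge0 ?invr_ge0.
pose m1 : {measure set (borel R d) -> \bar R} := pushforward leb (affine a h).
pose m2 : {measure set (borel R d) -> \bar R} := mscale (NngNum aV0) leb.
apply: (@measure_unique _ R (borel R d) open_boxes
  (fun n => open_box (fun=> - n%:R) (fun=> n%:R)) _ _ _ _
  (m1 (measurable_affine a h)) m2 _ _ A) => //.
- exact: measurable_borel_boxes.
- exact: setI_open_boxes.
- by move=> i; eexists; eexists.
- exact: bigcup_open_box.
- move=> _ [u [v ->]]; rewrite /m1 /m2 /= /pushforward /mscale/=.
  by rewrite lebesgue_affine_box// lebesgue_open_box.
- by move=> n; rewrite /m1 /= /pushforward lebesgue_affine_box// -EFinM ltry.
Qed.

Lemma ge0_integral_affine (a : R) (h : 'rV[R]_d) (g : borel R d -> \bar R) :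
  a != 0 -> measurable_fun setT g -> (forall x, 0 <= g x)%E ->
  (\int[leb]_x g (affine a h x) = (`|a|^-1 ^+ d)%:E * \int[leb]_x g x)%E.
Proof.
move=> a0 mg g0.
have aV0 : 0 <= `|a|^-1 ^+ d by rewrite exprn_ge0 ?invr_ge0.
have mA : measurable_fun setT (affine a h) by exact: measurable_affine.
rewrite -[LHS](@ge0_integral_pushforward _ _ _ _ _ _ mA leb setT g)//.
rewrite -(@ge0_integral_mscale _ _ _ leb setT measurableT (NngNum aV0) g)//.
by apply: eq_measure_integral => A mA' _; exact: pushforward_affine.
Qed.

Lemma integrable_affine (a : R) (h : 'rV[R]_d) (g : borel R d -> \bar R) :
  a != 0 -> leb.-integrable setT g ->
  leb.-integrable setT (fun x => g (affine a h x)).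
Proof.
move=> a0 /integrableP[mg ig]; apply/integrableP; split.
  exact: measurableT_comp mg (measurable_affine _ _).
rewrite (ge0_integral_affine h (g := fun x => `|g x|%E))//; last first.
  exact: measurableT_comp.
by rewrite lte_mul_pinfty// lee_fin exprn_ge0 ?invr_ge0.
Qed.

Lemma integral_affine (a : R) (h : 'rV[R]_d) (g : borel R d -> \bar R) :
  a != 0 -> leb.-integrable setT g ->
  (\int[leb]_x g (affine a h x) = (`|a|^-1 ^+ d)%:E * \int[leb]_x g x)%E.
Proof.
move=> a0 ig; have mg := measurable_int _ ig.
rewrite [in LHS]integralE [in RHS]integralE muleBr//; last first.
  by rewrite fin_num_adde_defr// (integrable_pos_fin_num _ ig).
rewrite -(ge0_integral_affine h (g := g^\+%E))//; last exact: measurable_funepos.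
rewrite -(ge0_integral_affine h (g := g^\-%E))//; last exact: measurable_funeneg.
by congr (_ - _)%E; apply: eq_integral => x _;
  rewrite ?(funepos_comp g (affine a h)) ?(funeneg_comp g (affine a h)).
Qed.

Lemma measurable_continuous (f : 'rV[R]_d -> R) : continuous f ->
  measurable_fun [set: borel R d] (f : borel R d -> R).
Proof.
move=> cf; apply: (measurability _ (RGenOpens.measurableE R)).
move=> _ [_ [a [b ->]] <-]; rewrite setTI; apply: sub_sigma_algebra.
by move/continuousP : cf; apply; exact: interval_open.
Qed.

Lemma measurable_open (U : set 'rV[R]_d) : open U -> measurable (U : set (borel R d)).
Proof. exact: sub_sigma_algebra. Qed.

Definition cube (r : R) : set (borel R d) := open_box (fun=> - r) (fun=> r).

Lemma cubeP r (x : 'rV[R]_d) : 0 < r -> cube r x <-> `|x| < r.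
Proof.
move=> r0; split=> [h|/(mx_norm_ltP _ r0) h j].
  by apply/mx_norm_ltP => // j; have := h j; rewrite /= in_itv/= ltr_norml.
by rewrite /= in_itv/= -ltr_norml.
Qed.

Lemma measurable_cube r : measurable (cube r).
Proof. exact: measurable_open_box. Qed.

Lemma lebesgue_cube_lty r : (leb (cube r) < +oo)%E.
Proof. by rewrite lebesgue_open_box ltry. Qed.

Lemma lebesgue_open_gt0 (U : set 'rV[R]_d) : open U -> U !=set0 ->
  (0 < leb U)%E.
Proof.
move=> oU [x Ux]; have /nbhs_ballP[e /= e0] := open_nbhs_nbhs (conj oU Ux).
rewrite ball_box// => bU.
apply: (@lt_le_trans _ _ (leb (open_box (fun j => x 0 j - e) (fun j => x 0 j + e)))).
  rewrite lebesgue_open_box lte_fin; apply: prodr_gt0 => j _.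
  by rewrite lt_max; apply/orP; right; lra.
by apply: le_measure; rewrite ?inE//; [exact: measurable_open_box|exact: measurable_open].
Qed.

Lemma integrable_bounded_support (f : borel R d -> R) (N C : R) :
  measurable_fun setT f -> (forall x : 'rV[R]_d, `|f x| <= C) ->
  (forall x : 'rV[R]_d, N < `|x| -> f x = 0) ->
  leb.-integrable setT (fun x => (f x)%:E).
Proof.
move=> mf fC f0; pose r := `|N| + 1.
have r0 : 0 < r by rewrite ltr_wpDl.
have C0 : 0 <= C by apply: le_trans (fC 0).
apply: (@le_integrable _ _ _ _ _ _ _ (fun x => (C * \1_(cube r) x)%:E)) => //.
- exact/measurable_EFinP.
- move=> x _ /=; rewrite lee_fin [leRHS]ger0_norm ?mulr_ge0//.
  have [xr|xr] := ltP `|x : 'rV[R]_d| r.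
    by rewrite indicE mem_set ?mulr1//; apply/cubeP.
  rewrite f0 ?normr0 ?mulr_ge0//.
  by apply: lt_le_trans xr; rewrite /r ltr_pwDr// ler_norm.
- under eq_fun do rewrite EFinM; apply: integrableZl => //.
  apply/integrableP; split.
    by apply/measurable_EFinP; apply: measurable_indic; exact: measurable_cube.
  under eq_integral do rewrite gee0_abs ?lee_fin//.
  by rewrite integral_indic ?setIT//; [exact: lebesgue_cube_lty|exact: measurable_cube].
Qed.

End lebesgue_affine.

(** * Trigonometric transforms *)

Lemma integrable_measurable (R : realType) d (T : measurableType d)
    (mu : {measure set T -> \bar R}) (f : T -> R) :
  mu.-integrable setT (fun x => (f x)%:E) -> measurable_fun setT f.
Proof. by move=> /measurable_int /measurable_EFinP. Qed.

Section trigonometric_transform.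
Variables (R : realType) (d : nat).
Local Notation leb := (lebesgue_rV R d).
Implicit Types (a b : 'rV[R]_d -> R) (xi : 'rV[R]_d).

(** Differentiation under the integral sign along the line x + t v, with a
   dominating function for |t| < 1. *)
Lemma is_derive_integral (F dF : 'rV[R]_d -> borel R d -> R) (x v : 'rV[R]_d)
    (G : borel R d -> R) :
  (forall y, leb.-integrable setT (fun z => (F y z)%:E)) ->
  (forall y z, is_derive y v (F ^~ z) (dF y z)) ->
  (forall z, 0 <= G z) -> leb.-integrable setT (fun z => (G z)%:E) ->
  (forall (t : R) z, `|t| < 1 -> `|dF (x + t *: v) z| <= G z) ->
  is_derive x v (fun y => \int[leb]_z F y z)%R (\int[leb]_z dF x z)%R.
Proof.
move=> iF dFv G0 iG dFG.
pose f (t : R) z := F (x + t *: v) z.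
have df (t : R) z : is_derive t (1 : R) (f ^~ z) (dF (x + t *: v) z).
  have [dd dE] := dFv (x + t *: v) z.
  by apply: is_derive_eq (is_derive_line dd) _.
have d1 t z : partial1of2 f t z = dF (x + t *: v) z.
  by rewrite partial1of2E; have [_ ->] := df t z.
have I0 : `]-1, 1[%classic (0 : R) by rewrite /= in_itv/= ltrN10 ltr01.
have := @cvg_differentiation_under_integral R _ (borel R d) leb f setT measurableT
  0 (-1) 1 I0 _ _ G G0 iG _.
have -> : (fun h : R => h^-1 *: (\int[leb]_z f (h + 0)%R z - \int[leb]_z f 0 z)%R) =
  (fun h : R => h^-1 *: (\int[leb]_z F (h *: v + x)%R z - \int[leb]_z F x z)%R).
  by apply/funext => h; rewrite /f addr0 scale0r addr0 [x + _]addrC.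
have -> : (\int[leb]_y partial1of2 f 0 y = \int[leb]_y dF x y)%R.
  by apply: eq_Rintegral => z _; rewrite d1 scale0r addr0.
move=> H; have {}H := H _ _ _.
suff L : (fun h : R => h^-1 *: (\int[leb]_z F (h *: v + x) z - \int[leb]_z F x z)%R) h
    @[h --> 0^'] --> (\int[leb]_y dF x y)%R.
  by split; [apply/cvg_ex; eexists; exact: L|exact/cvg_lim].
apply: H.
- by move=> t _; exact: iF.
- by move=> t z _ _; have [] := df t z.
- move=> t z; rewrite /= in_itv/= -ltr_norml => t1 _.
  by rewrite d1; exact: dFG.
Qed.

Definition compactly_supported a := exists N : R, forall x, N < `|x| -> a x = 0.

Definition compact_integrable a :=
  leb.-integrable setT (fun x : borel R d => (a x)%:E) /\ compactly_supported a.

Definition test a := smooth_on setT a /\ compactly_supported a.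

(** Real and imaginary parts of Fourier transforms have this form. Working with
   it keeps the study of derivatives within real-valued functions. *)
Definition trig a b xi : R := (\int[leb]_x
  (a x * cos (2 * pi * dotr xi x) + b x * sin (2 * pi * dotr xi x)))%R.

Lemma dotrD xi eta x : dotr (xi + eta) x = dotr xi x + dotr eta x :> R.
Proof. by rewrite /dotr -big_split/=; apply: eq_bigr => i _; rewrite mxE mulrDl. Qed.

Lemma dotrZ t xi x : dotr (t *: xi) x = t * dotr xi x :> R.
Proof. by rewrite /dotr mulr_sumr; apply: eq_bigr => i _; rewrite mxE mulrA. Qed.

Lemma dotrC xi x : dotr xi x = dotr x xi :> R.
Proof. by apply: eq_bigr => i _; rewrite mulrC. Qed.

Lemma dotr_delta j (x : 'rV[R]_d) : dotr (delta_mx 0 j) x = x 0 j :> R.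
Proof.
rewrite /dotr (bigD1 j)//= big1 => [|i ij]; last by rewrite mxE (negbTE ij) mul0r.
by rewrite mxE !eqxx mul1r addr0.
Qed.

Lemma continuous_cstM (c : R) a : continuous a -> continuous (fun x => c * a x).
Proof. by move=> ca x; apply: continuousM; [exact: cst_continuous|exact: ca]. Qed.

Lemma dotr_continuous xi : continuous (dotr xi).
Proof.
move=> x; rewrite /dotr; apply: (cvg_sumr (FF := nbhs_filter x)) => j _.
apply: cvgMr; exact: coord_continuous.
Qed.

Lemma is_derive_dotr x xi v : is_derive xi v (fun xi => dotr xi x) (dotr v x).
Proof.
have E : (fun h : R => h^-1 *: (dotr (h *: v + xi) x - dotr xi x)) h @[h --> 0^']
    --> dotr v x.
  apply: cvg_near_cst; near=> h; rewrite dotrD dotrZ addrK [_ *: _]mulrA mulVf ?mul1r//.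
  by near: h; exact: nbhs_dnbhs_neq.
by split; [apply/cvg_ex; eexists; exact: E|exact/cvg_lim].
Unshelve. all: by end_near. Qed.

Lemma norm_trig_le (u v s : R) : `|u * cos s + v * sin s| <= `|u| + `|v|.
Proof.
apply: le_trans (ler_normD _ _) _; apply: lerD; rewrite normrM ler_piMr//.
  exact: cos_max.
exact: sin_max.
Qed.

Lemma continuous_trig_dotr xi :
  continuous (fun x : 'rV[R]_d => cos (2 * pi * dotr xi x)) /\
  continuous (fun x : 'rV[R]_d => sin (2 * pi * dotr xi x)).
Proof.
have c : continuous (fun x : 'rV[R]_d => 2 * pi * dotr xi x).
  by apply: continuous_cstM; exact: dotr_continuous.
split=> x.
  exact: (continuous_comp (c x) (@continuous_cos R _)).
exact: (continuous_comp (c x) (@continuous_sin R _)).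
Qed.

Lemma measurable_trig xi : measurable_fun [set: borel R d]
    (fun x : borel R d => cos (2 * pi * dotr xi x)) /\
  measurable_fun [set: borel R d] (fun x : borel R d => sin (2 * pi * dotr xi x)).
Proof.
have [? ?] := continuous_trig_dotr xi.
by split; exact: measurable_continuous.
Qed.

Lemma integrable_trig a b xi :
  leb.-integrable setT (fun x : borel R d => (a x)%:E) ->
  leb.-integrable setT (fun x : borel R d => (b x)%:E) ->
  leb.-integrable setT (fun x : borel R d =>
    (a x * cos (2 * pi * dotr xi x) + b x * sin (2 * pi * dotr xi x))%:E).
Proof.
move=> ia ib; have [mc ms] := measurable_trig xi.
apply: (@le_integrable _ _ _ _ _ measurableT _ (fun x : borel R d => `|(a x)%:E| + `|(b x)%:E|)%E).
- apply/measurable_EFinP; apply: measurable_funD; apply: measurable_funM => //.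
    exact: integrable_measurable ia.
  exact: integrable_measurable ib.
- move=> x _; rewrite /= lee_fin [leRHS]ger0_norm ?addr_ge0//.
  exact: norm_trig_le.
- by apply: integrableD => //; exact: integrable_abse.
Qed.

Lemma continuous_bounded_ball (u : 'rV[R]_d -> R) (N : R) : continuous u ->
  exists2 C, 0 <= C & forall x, `|x| <= N -> `|u x| <= C.
Proof.
move=> cu; pose K := [set x : 'rV[R]_d | `|x| <= N].
have cK : compact K.
  apply: bounded_closed_compact; last first.
    rewrite (_ : K = (fun x => `|x|) @^-1` [set t | t <= N])//.
    by apply: preimage_closed => [x _|]; [exact: norm_continuous|exact: closed_le].
  by exists N; split=> [|M NM x /= xN]; [exact: num_real|exact/(le_trans xN)/ltW].
have /compact_bounded[M [_ MK]] : compact (u @` K).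
  by apply: continuous_compact => //; exact: continuous_subspaceT.
exists (`|M| + 1) => [|x xN]; first by rewrite addr_ge0.
apply: MK; last by exists x.
by rewrite ltr_pwDr// ler_norm.
Qed.

Lemma compactly_supported_mul (u : 'rV[R]_d -> R) a :
  compactly_supported a -> compactly_supported (fun x => u x * a x).
Proof. by move=> [N a0]; exists N => x /a0 ->; rewrite mulr0. Qed.

Lemma compactly_supported_add a b : compactly_supported a ->
  compactly_supported b -> compactly_supported (fun x => a x + b x).
Proof.
move=> [N a0] [M b0]; exists (Num.max N M) => x; rewrite gt_max => /andP[Nx Mx].
by rewrite a0// b0// addr0.
Qed.

Lemma compact_integrable_mul (u : 'rV[R]_d -> R) a : continuous u ->
  compact_integrable a -> compact_integrable (fun x => u x * a x).
Proof.
move=> cu [ia [N a0]]; split; last by apply: compactly_supported_mul; exists N.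
have [C C0 uC] := continuous_bounded_ball N cu.
apply: (@le_integrable _ _ _ _ _ measurableT _ (fun x : borel R d => C%:E * (a x)%:E)%E).
- apply/measurable_EFinP; apply: measurable_funM; first exact: measurable_continuous.
  exact: integrable_measurable ia.
- move=> x _; rewrite /= lee_fin !normrM (ger0_norm C0).
  have [xN|xN] := leP `|x : 'rV[R]_d| N; first by rewrite ler_wpM2r// uC.
  by rewrite a0// normr0 !mulr0.
- exact: integrableZl.
Qed.

Lemma continuous_coordM j (c : R) : continuous (fun x : 'rV[R]_d => c * x 0 j).
Proof. by apply: continuous_cstM => x; exact: coord_continuous. Qed.

(** The factor 2 pi x_j that a derivative of a transform brings into the integral. *)
Definition freq (j : 'I_d) a : 'rV[R]_d -> R := fun x => 2 * pi * x 0 j * a x.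

Lemma compact_integrable_freq j a : compact_integrable a ->
  compact_integrable (freq j a).
Proof. by apply: compact_integrable_mul; exact: continuous_coordM. Qed.

Lemma compact_integrable_opp a : compact_integrable a ->
  compact_integrable (fun x => - a x).
Proof.
move=> ca; rewrite (_ : (fun x => - a x) = (fun x => -1 * a x)); last first.
  by apply/funext => x; rewrite mulN1r.
by apply: compact_integrable_mul => // x; exact: cst_continuous.
Qed.

Lemma is_derive_trig a b xi j : compact_integrable a -> compact_integrable b ->
  is_derive xi (delta_mx 0 j) (trig a b)
    (trig (freq j b) (fun x => - freq j a x) xi).
Proof.
move=> ca cb.
have [fa _] := compact_integrable_freq j ca.
have [fb _] := compact_integrable_freq j cb.
pose G (x : borel R d) := `|freq j b x| + `|freq j a x|.
apply: (@is_derive_integral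
  (fun xi x => a x * cos (2 * pi * dotr xi x) + b x * sin (2 * pi * dotr xi x))
  (fun xi x => freq j b x * cos (2 * pi * dotr xi x) +
               - freq j a x * sin (2 * pi * dotr xi x)) _ _ G).
- by move=> y; apply: integrable_trig; [exact: ca.1|exact: cb.1].
- move=> y z.
  have dd : is_derive y (delta_mx 0 j) (fun xi => 2 * pi * dotr xi z)
      (2 * pi * z 0 j).
    have := is_deriveZ (2 * pi : R) (is_derive_dotr z y (delta_mx 0 j)).
    by rewrite dotr_delta; exact.
  have [d1 d2] := dd.
  have dc := is_derive_comp1 d1 (is_derive_cos _).
  have ds := is_derive_comp1 d1 (is_derive_sin _).
  apply: is_derive_eq (is_deriveD (is_deriveZ (a z) dc) (is_deriveZ (b z) ds)) _.
  by rewrite d2 /GRing.scale/= /freq; ring.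
- by move=> z; rewrite addr_ge0.
- rewrite /G; under eq_fun do rewrite EFinD.
  by apply: integrableD => //; exact: integrable_norm.
- move=> t z _; rewrite /G -[X in _ <= _ + X]normrN; exact: norm_trig_le.
Qed.

Definition L1norm a : R := (\int[leb]_x `|a x|)%R.

Lemma trig_bound a b xi :
  leb.-integrable setT (fun x : borel R d => (a x)%:E) ->
  leb.-integrable setT (fun x : borel R d => (b x)%:E) ->
  `|trig a b xi| <= L1norm a + L1norm b.
Proof.
move=> ia ib; have iab := integrable_trig xi ia ib.
apply: le_trans (le_normr_Rintegral measurableT iab) _.
rewrite /L1norm -RintegralD//; [|exact: integrable_norm..].
apply: le_Rintegral => //; first exact: integrable_norm.
  under [X in integrable _ _ X]eq_fun do rewrite EFinD.
  by apply: integrableD => //; exact: integrable_norm.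
by move=> x _; exact: norm_trig_le.
Qed.

(** The partial derivatives exist and are bounded, which gives a Lipschitz bound by
   [linear_approximation]. *)
Lemma continuous_trig a b : compact_integrable a -> compact_integrable b ->
  continuous (trig a b).
Proof.
move=> ca cb xi.
pose M j := L1norm (freq j b) + L1norm (fun x => - freq j a x).
have dj j y : derivable (trig a b) y (delta_mx 0 j).
  by have [] := is_derive_trig y j ca cb.
have pM j y : `|partial j (trig a b) y| <= M j.
  have [_] := is_derive_trig y j ca cb; rewrite /partial => ->.
  apply: trig_bound; first exact: (compact_integrable_freq j cb).1.
  exact: (compact_integrable_opp (compact_integrable_freq j ca)).1.
pose S := \sum_j M j.
have M0 j : 0 <= M j by apply: le_trans (pM j 0).
have MS j : M j <= S by rewrite /S (bigD1 j)//= lerDl sumr_ge0.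
have S0 : 0 <= S by rewrite sumr_ge0.
have A h : `|h| < 1 -> `|trig a b (xi + h) - trig a b xi| <= 3 * S * \sum_j `|h 0 j|.
  move=> h1.
  have := @linear_approximation R d (trig a b) xi (2 * S) 1 ltr01
    (fun j y _ => dj j y) _ h h1.
  move=> H; have {}H := H _.
  rewrite -(subrK (\sum_j h 0 j * partial j (trig a b) xi) (_ - _)).
  apply: le_trans (ler_normD _ _) _.
  rewrite (_ : 3 * S = 2 * S + S); last by ring.
  rewrite mulrDl; apply: lerD.
    apply: H => j y _; apply: le_trans (ler_normB _ _) _.
    by rewrite mulr_natl mulr2n lerD// (le_trans (pM j _)).
  apply: le_trans (ler_norm_sum _ _ _) _; rewrite mulr_sumr; apply: ler_sum => j _.
  by rewrite normrM mulrC ler_wpM2r// (le_trans (pM j _)).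
pose C := 3 * S * d%:R + 1.
have C0 : 0 < C by rewrite ltr_wpDl// !mulr_ge0.
suff H e : 0 < e -> \forall y \near xi, `|trig a b xi - trig a b y| <= e.
  exact/(cvgrPdist_le (FF := nbhs_filter xi)).
move=> e0; near=> y.
have yx : `|xi - y| < Num.min 1 (C^-1 * e).
  near: y; apply: cvgr_dist_lt => //; rewrite lt_min ltr01 mulr_gt0 ?invr_gt0//.
move: yx; rewrite lt_min distrC => /andP[yx1 yxe].
rewrite distrC -[X in trig a b X](subrKC xi); apply: le_trans (A _ yx1) _.
apply: (@le_trans _ _ (C * `|y - xi|)); last by rewrite -ler_pdivlMl// ltW.
apply: (@le_trans _ _ (3 * S * (\sum_(j < d) `|y - xi|))).
  by rewrite ler_wpM2l ?mulr_ge0//; apply: ler_sum => j _; exact: coord_le_norm.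
by rewrite sumr_const card_ord -[X in _ * X]mulr_natl mulrA ler_wpM2r// lerDl.
Unshelve. all: by end_near. Qed.

End trigonometric_transform.

(** * Transforms of test functions *)

Section schwartz_transform.
Variables (R : realType) (d : nat).
Local Notation leb := (lebesgue_rV R d).
Implicit Types (a b f g : 'rV[R]_d -> R) (xi : 'rV[R]_d).

Lemma partials_stable (P : set ('rV[R]_d -> R)) f (s : seq 'I_d) :
  (forall g i, P g -> P (partial i g)) -> P f -> P (partials s f).
Proof. by move=> Ps Pf; elim: s => //= i s IH; exact: Ps. Qed.

Lemma smooth_onT_stable (P : set ('rV[R]_d -> R)) f :
  (forall g, P g -> continuous g) ->
  (forall g i, P g -> (forall x, derivable g x (delta_mx 0 i)) /\ P (partial i g)) ->
  P f -> smooth_on setT f.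
Proof.
move=> Pc Pd Pf s x _.
have Ps : P (partials s f) by apply: partials_stable => // g i Pg; exact: (Pd g i Pg).2.
by split; [exact: Pc|move=> i; have [] := Pd _ i Ps].
Qed.

Lemma partial_trig a b j : compact_integrable a -> compact_integrable b ->
  partial j (trig a b) = trig (freq j b) (fun x => - freq j a x).
Proof.
by move=> ca cb; apply/funext => xi; have [_] := is_derive_trig xi j ca cb.
Qed.

(** The transforms of compactly supported integrable functions form a class of
   continuous functions that is stable under partial derivatives. *)
Lemma smooth_trig a b : compact_integrable a -> compact_integrable b ->
  smooth_on setT (trig a b).
Proof.
move=> ca cb; apply: (@smooth_onT_stable [set g | exists a b,
    [/\ compact_integrable a, compact_integrable b & g = trig a b]]).
- by move=> _ [a' [b' [ca' cb' ->]]]; exact: continuous_trig.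
- move=> _ j [a' [b' [ca' cb' ->]]]; split=> [x|].
    by have [] := is_derive_trig x j ca' cb'.
  rewrite partial_trig//; eexists; eexists; split; last by [].
    exact: compact_integrable_freq.
  exact/compact_integrable_opp/compact_integrable_freq.
- by exists a, b.
Qed.

Lemma smooth_continuous f : smooth_on setT f -> continuous f.
Proof. by move=> sf x; have [+ _] := sf [::] x I. Qed.

Lemma smooth_derivable f x j : smooth_on setT f -> derivable f x (delta_mx 0 j).
Proof. by move=> sf; have [_] := sf [::] x I; exact. Qed.

Lemma compact_support_bounded f : continuous f -> compactly_supported f ->
  exists2 C, 0 <= C & forall x, `|f x| <= C.
Proof.
move=> cf [N f0]; have [C C0 fC] := continuous_bounded_ball N cf.
exists C => // x; have [/fC//|/f0->] := leP `|x| N.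
by rewrite normr0.
Qed.

Lemma test_compact_integrable a : test a -> compact_integrable a.
Proof.
move=> [/smooth_continuous ca [N a0]]; split; last by exists N.
have [|C C0 aC] := compact_support_bounded ca; first by exists N.
by apply: (integrable_bounded_support (N := N) _ aC a0); exact: measurable_continuous.
Qed.

Lemma partial_supported a N j : (forall x, N < `|x| -> a x = 0) ->
  forall x, N < `|x| -> partial j a x = 0.
Proof.
move=> a0 x Nx; rewrite /partial (@near_eq_derive _ _ _ a (cst 0)).
  by rewrite derive_cst.
have oN : open [set y : 'rV[R]_d | N < `|y|].
  rewrite (_ : mkset _ = (fun y => `|y|) @^-1` [set t | N < t])//.
  by apply: open_comp => [y _|]; [exact: norm_continuous|exact: open_gt].
by apply: near_open oN Nx _ => y; exact: a0.
Qed.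

Lemma test_partial j a : test a -> test (partial j a).
Proof.
move=> [sa [N a0]]; split; first exact: smooth_on_partial.
by exists N; exact: partial_supported.
Qed.

Lemma test_mul (u : 'rV[R]_d -> R) a : smooth_on setT u -> test a ->
  test (fun x => u x * a x).
Proof.
move=> /smooth_onP su [/smooth_onP sa ca]; split.
  by apply/smooth_onP => n; apply: Cn_mul => //; exact: openT.
exact: compactly_supported_mul.
Qed.

Lemma test_add a b : test a -> test b -> test (fun x => a x + b x).
Proof.
move=> [/smooth_onP sa ca] [/smooth_onP sb cb]; split.
  by apply/smooth_onP => n; apply: Cn_add => //; exact: openT.
exact: compactly_supported_add.
Qed.

Lemma smooth_cst (c : R) : smooth_on setT (fun _ : 'rV[R]_d => c).
Proof. by apply/smooth_onP => n; apply: Cn_cst; exact: openT. Qed.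

Lemma test_scale (c : R) a : test a -> test (fun x => c * a x).
Proof. by apply: test_mul; exact: smooth_cst. Qed.

Lemma test_opp a : test a -> test (fun x => - a x).
Proof.
move=> ta; rewrite (_ : (fun x => - a x) = (fun x => -1 * a x)).
  exact: test_scale.
by apply/funext => x; rewrite mulN1r.
Qed.

Lemma test0 : test (fun _ : 'rV[R]_d => 0).
Proof. by split; [exact: smooth_cst|exists 0]. Qed.

Lemma smooth_coordM j (c : R) : smooth_on setT (fun x : 'rV[R]_d => c * x 0 j).
Proof.
apply/smooth_onP => n; apply: Cn_mul; try exact: openT.
  by apply: Cn_cst; exact: openT.
by apply: Cn_coord; exact: openT.
Qed.

Lemma test_freq j a : test a -> test (freq j a).
Proof. by apply: test_mul; exact: smooth_coordM. Qed.

(** The integral of y |-> g(z + y) in z does not depend on y, and its derivative in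
   y can be taken under the integral sign. *)
Lemma integral_partial0 g j : test g -> (\int[leb]_x partial j g x)%R = 0.
Proof.
move=> tg; have tdg := test_partial j tg.
have [ig [N g0]] := test_compact_integrable tg.
have [C C0 dgC] := compact_support_bounded (smooth_continuous tdg.1) tdg.2.
pose G (z : borel R d) : R := C * \1_(cube (`|N| + 2)) z.
have N2 : 0 < `|N| + 2 by rewrite ltr_wpDl.
have dgE (x : 'rV[R]_d) : partial j g x = partial j g (x + 0 : 'rV[R]_d) by rewrite addr0.
have H : is_derive (0 : 'rV[R]_d) (delta_mx 0 j) (fun y => \int[leb]_z g (z + y))%R
    (\int[leb]_x partial j g (x + 0 : 'rV[R]_d))%R.
  apply: (@is_derive_integral R d (fun y z => g (z + y))
      (fun y z => partial j g (z + y)) 0 (delta_mx 0 j) G).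
  - move=> y; have := integrable_affine y (oner_neq0 _) ig.
    by rewrite /affine; under eq_fun do rewrite scale1r.
  - move=> y z; have dg : derivable g (z + y) (delta_mx 0 j) by exact: smooth_derivable tg.1.
    have [d1 d2] := derivableP dg.
    have E : (fun h : R => h^-1 *: (g (z + (h *: delta_mx 0 j + y)) - g (z + y))) =
        (fun h : R => h^-1 *: (g (h *: delta_mx 0 j + (z + y)) - g (z + y))).
      by apply/funext => h; rewrite addrCA.
    by split; rewrite /derivable /derive/= E.
  - by move=> z; rewrite mulr_ge0.
  - apply: (integrable_bounded_support (N := `|N| + 2) (C := C)).
    + apply: measurable_funM => //; apply: measurable_indic; exact: measurable_cube.
    + by move=> z; rewrite ger0_norm ?mulr_ge0// ler_piMr// indicE; case: (_ \in _).
    + move=> z Nz; rewrite /G indicE memNset ?mulr0//.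
      by move/(cubeP _ N2); rewrite ltNge (ltW Nz).
  - move=> t z t1; rewrite add0r.
    have [zN|Nz] := ltP `|z : 'rV[R]_d| (`|N| + 2).
      rewrite /G indicE mem_set ?mulr1//; exact: (proj2 (cubeP _ N2)).
    rewrite (partial_supported j g0) ?normr0 ?mulr_ge0//.
    have t1' : `|t *: delta_mx 0 j : 'rV[R]_d| < 1.
      apply/mx_norm_ltP => // i; rewrite !mxE ?eqxx/=.
      by case: (i == j); rewrite ?mulr1 ?mulr0 ?normr0.
    have := lerB_normD (z : 'rV[R]_d) (t *: delta_mx 0 j).
    have := ler_norm N; move: t1' Nz.
    by set u := `|_ *: _|; set v := `|z : 'rV[R]_d|; set w := `|_ + _|; lra.
under eq_Rintegral do rewrite dgE.
have [_ <-] := H.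
rewrite (_ : (fun y => _) = cst (\int[leb]_z g z)%R); first by rewrite derive_cst.
apply/funext => y; rewrite /Rintegral.
have := integral_affine y (oner_neq0 _) ig.
rewrite /affine normr1 invr1 expr1n mul1e => <-; congr fine.
by apply: eq_integral => z _; rewrite scale1r.
Qed.

Lemma smooth_trig_dotr xi (c s : R) : smooth_on setT
  (fun x => c * cos (2 * pi * dotr xi x) + s * sin (2 * pi * dotr xi x)).
Proof.
apply/smooth_onP => n.
pose P := [set phi : R -> R | exists c s, phi = fun t => c * cos t + s * sin t].
have oT := @openT 'rV[R]_d.
apply: (@Cn_comp1 R d setT P n setT (fun x => 2 * pi * dotr xi x)
    (fun t => c * cos t + s * sin t)) => //.
- move=> _ [c' [s' ->]]; exists (fun t => s' * cos t + - c' * sin t).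
    by exists s', (- c').
  move=> t _.
  apply: is_derive_eq (is_deriveD (is_deriveZ c' (is_derive_cos t))
                                  (is_deriveZ s' (is_derive_sin t))) _.
  by rewrite /GRing.scale/=; ring.
- by exists c, s.
- apply: Cn_mul => //; first exact: Cn_cst.
  by apply: Cn_sum => // i _; apply: Cn_mul => //; [exact: Cn_cst|exact: Cn_coord].
Qed.

(** Integration by parts: the integral of the j-th partial derivative of
   a sin - b cos vanishes. *)
Lemma trig_freq a b j : test a -> test b ->
  freq j (trig a b) = trig (partial j b) (fun x => - partial j a x).
Proof.
move=> ta tb; apply/funext => xi.
pose C x := cos (2 * pi * dotr xi x); pose S x := sin (2 * pi * dotr xi x).
have sC : smooth_on setT C.
  have := smooth_trig_dotr xi 1 0; congr (smooth_on _ _); apply/funext => x.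
  by rewrite mul1r mul0r addr0.
have sS : smooth_on setT S.
  have := smooth_trig_dotr xi 0 1; congr (smooth_on _ _); apply/funext => x.
  by rewrite mul1r mul0r add0r.
have dd x : is_derive x (delta_mx 0 j) (fun x => 2 * pi * dotr xi x)
    (2 * pi * xi 0 j).
  have := is_deriveZ (2 * pi : R) (is_derive_dotr xi x (delta_mx 0 j)).
  rewrite dotr_delta; under [X in is_derive _ _ X]eq_fun do rewrite dotrC.
  exact.
have dC x : is_derive x (delta_mx 0 j) C (- (2 * pi * xi 0 j * S x)).
  have [d1 d2] := dd x.
  apply: is_derive_eq (is_derive_comp1 d1 (is_derive_cos _)) _.
  by rewrite d2 /S; ring.
have dS x : is_derive x (delta_mx 0 j) S (2 * pi * xi 0 j * C x).
  have [d1 d2] := dd x.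
  apply: is_derive_eq (is_derive_comp1 d1 (is_derive_sin _)) _.
  by rewrite d2 /C; ring.
pose g x := S x * a x + - (C x * b x).
have tg : test g by apply: test_add; [|apply: test_opp]; exact: test_mul.
have dg x : partial j g x = 2 * pi * xi 0 j * (a x * C x + b x * S x) -
    (partial j b x * C x + - partial j a x * S x).
  have da := derivableP (smooth_derivable (x := x) (j := j) ta.1).
  have db := derivableP (smooth_derivable (x := x) (j := j) tb.1).
  have [_ gE] : is_derive x (delta_mx 0 j) g _ :=
    is_deriveD (is_deriveM (dS x) da) (is_deriveN (is_deriveM (dC x) db)).
  by rewrite {1}/partial gE /GRing.scale/= /partial; ring.
have ia := (test_compact_integrable ta).1; have ib := (test_compact_integrable tb).1.
have ida := (test_compact_integrable (test_opp (test_partial j ta))).1.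
have idb := (test_compact_integrable (test_partial j tb)).1.
have iab := integrable_trig xi ia ib; have idab := integrable_trig xi idb ida.
have := integral_partial0 j tg; under eq_Rintegral do rewrite dg.
rewrite RintegralB//; last first.
  exact: (integrableZl measurableT (2 * pi * xi 0 j) iab).
rewrite RintegralZl// => /eqP; rewrite subr_eq0 => /eqP.
exact.
Qed.

(** The transforms of test functions. This class is stable under sums, scalings,
   partial derivatives and multiplication by coordinates, and every Schwartz
   function constructed below belongs to it. *)
Definition bandlimited : set ('rV[R]_d -> R) :=
  [set g | exists a b, [/\ test a, test b & g = trig a b]].

Lemma bandlimited_partial j g : bandlimited g -> bandlimited (partial j g).
Proof.
move=> [a [b [ta tb ->]]]; rewrite partial_trig; try exact: test_compact_integrable.
eexists; eexists; split; last by []; first exact: test_freq.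
exact/test_opp/test_freq.
Qed.

Lemma bandlimited_freq j g : bandlimited g -> bandlimited (freq j g).
Proof.
move=> [a [b [ta tb ->]]]; rewrite trig_freq//.
eexists; eexists; split; last by []; first exact: test_partial.
exact/test_opp/test_partial.
Qed.

Lemma trigD a b a' b' : test a -> test b -> test a' -> test b' ->
  (fun xi => trig a b xi + trig a' b' xi) =
  trig (fun x => a x + a' x) (fun x => b x + b' x).
Proof.
move=> /test_compact_integrable[ia _] /test_compact_integrable[ib _].
move=> /test_compact_integrable[ia' _] /test_compact_integrable[ib' _].
apply/funext => xi; rewrite /trig -RintegralD//; try exact: integrable_trig.
by apply: eq_Rintegral => x _; ring.
Qed.

Lemma bandlimited_add g h : bandlimited g -> bandlimited h ->
  bandlimited (fun x => g x + h x).
Proof.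
move=> [a [b [ta tb ->]]] [a' [b' [ta' tb' ->]]]; rewrite trigD//.
by eexists; eexists; split; last by []; exact: test_add.
Qed.

Lemma trigZ (c : R) a b : test a -> test b ->
  (fun xi => c * trig a b xi) = trig (fun x => c * a x) (fun x => c * b x).
Proof.
move=> /test_compact_integrable[ia _] /test_compact_integrable[ib _].
apply/funext => xi; rewrite /trig -RintegralZl//; last exact: integrable_trig.
by apply: eq_Rintegral => x _; ring.
Qed.

Lemma bandlimited_scale (c : R) g : bandlimited g -> bandlimited (fun x => c * g x).
Proof.
move=> [a [b [ta tb ->]]]; rewrite trigZ//.
by eexists; eexists; split; last by []; exact: test_scale.
Qed.

Lemma bandlimited_coord j g : bandlimited g -> bandlimited (fun x => x 0 j * g x).
Proof.
move=> /(bandlimited_freq j)/(bandlimited_scale (2 * pi)^-1); congr (bandlimited _).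
have p0 : 2 * pi != 0 :> R by rewrite gt_eqF ?mulr_gt0 ?pi_gt0.
by apply/funext => x; rewrite /freq -[_ * x 0 j * _]mulrA mulKf.
Qed.

Lemma bandlimited_monomial (a : 'I_d -> nat) g : bandlimited g ->
  bandlimited (fun x => (\prod_i x 0 i ^+ a i) * g x).
Proof.
move=> tg; elim: (index_enum _) => [|i r IH].
  by move: tg; congr bandlimited; apply/funext => x; rewrite big_nil mul1r.
under eq_fun do rewrite big_cons -mulrA.
elim: (a i) => [|n IHn]; first by under eq_fun do rewrite expr0 mul1r.
by under eq_fun do rewrite exprS -mulrA; exact: bandlimited_coord.
Qed.

Lemma bandlimited_bounded g : bandlimited g -> exists M, forall x, `|g x| <= M.
Proof.
move=> [a [b [ta tb ->]]]; exists (L1norm a + L1norm b) => x.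
by apply: trig_bound; [exact: (test_compact_integrable ta).1|
                       exact: (test_compact_integrable tb).1].
Qed.

Lemma bandlimited_smooth g : bandlimited g -> smooth_on setT g.
Proof.
by move=> [a [b [ta tb ->]]]; apply: smooth_trig; exact: test_compact_integrable.
Qed.

(** By [bandlimited_partial] and [bandlimited_monomial] every expression to be bounded
   is again the transform of test functions, and transforms are bounded. *)
Lemma bandlimited_schwartz g : bandlimited g -> rschwartz g.
Proof.
move=> tg; split; first exact: bandlimited_smooth.
move=> a b; apply: bandlimited_bounded; apply: bandlimited_monomial.
by apply: partials_stable => // h i; exact: bandlimited_partial.
Qed.

End schwartz_transform.

(** * Integrability of the transforms *)

Section inverse_square_weight.
Variable R : realType.

Lemma integrable_oneDsqrV :
  (@lebesgue_measure R).-integrable setT (fun x => (oneDsqr x)^-1%:E).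
Proof.
have mw : measurable_fun setT (fun x : R => (oneDsqr x)^-1).
  by apply: continuous_measurable_fun; exact: continuous_oneDsqrV.
have w0 (x : R) : 0 <= (oneDsqr x)^-1 by rewrite invr_ge0 (le_trans _ (oneDsqr_ge1 x)).
apply/integrableP; split; first exact/measurable_EFinP.
under eq_integral do rewrite gee0_abs ?lee_fin//.
rewrite ge0_symfun_integralT//.
  rewrite (_ : mkset _ = `[0, +oo[%classic); last first.
    by apply/seteqP; split=> x /=; rewrite in_itv/= andbT.
  by rewrite integral0y_oneDsqr -EFinM ltry.
- exact: continuous_oneDsqrV.
- by move=> x /=; rewrite /oneDsqr sqrrN.
Qed.

(** An integrable majorant of every transform of test functions, chosen as a product
   so that Fubini reduces its integrability to dimension one. *)
Definition weight d (x : 'rV[R]_d) : R := \prod_j (oneDsqr (x 0 j))^-1.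

Lemma weight_gt0 d (x : 'rV[R]_d) : 0 < weight x.
Proof.
by apply: prodr_gt0 => j _; rewrite invr_gt0 (lt_le_trans _ (oneDsqr_ge1 _)).
Qed.

Lemma measurable_weight d : measurable_fun [set: borel R d] (@weight d).
Proof.
apply: measurable_prod => j _.
apply: (@measurableT_comp _ _ _ _ _ _ (fun t : R => (oneDsqr t)^-1)).
  by apply: continuous_measurable_fun; exact: continuous_oneDsqrV.
exact: measurable_coord_borel.
Qed.

Lemma weight_cons n (p : measurableTypeR R * borel R n) :
  weight (rV_cons p : 'rV[R]_n.+1) = (oneDsqr p.1)^-1 * weight (p.2 : 'rV[R]_n).
Proof.
rewrite /weight big_ord_recl; congr (_ * _); first by rewrite mxE unlift_none.
by apply: eq_bigr => j _; rewrite mxE liftK.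
Qed.

Lemma integrable_weight d :
  (lebesgue_rV R d).-integrable setT (fun x : borel R d => (weight x)%:E).
Proof.
apply/integrableP; split; first by apply/measurable_EFinP; exact: measurable_weight.
under eq_integral do rewrite gee0_abs ?lee_fin ?(ltW (weight_gt0 _))//.
elim: d => [|n IH].
  rewrite integral_dirac//; last by apply/measurable_EFinP; exact: measurable_weight.
  by rewrite /weight big_ord0 diracT mul1e ltry.
have mc := @measurable_rV_cons R n.
have mw := @measurable_weight n.+1.
have w1 : measurable_fun setT (fun x : R => (oneDsqr x)^-1).
  by apply: continuous_measurable_fun; exact: continuous_oneDsqrV.
have w0 (x : R) : 0 <= (oneDsqr x)^-1 by rewrite invr_ge0 (le_trans _ (oneDsqr_ge1 x)).
rewrite [X in (X < _)%E](@ge0_integral_pushforward _ _ _ _ _ _ mc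
  (@lebesgue_measure R \x lebesgue_rV R n)%E setT (fun x => (weight x)%:E))//=;
  last 2 first.
- exact/measurable_EFinP.
- by move=> x _; rewrite lee_fin ltW// weight_gt0.
rewrite fubini_tonelli1; last 2 first.
- apply/measurable_EFinP.
  exact: (measurableT_comp mw mc).
- by move=> x; rewrite lee_fin ltW// weight_gt0.
rewrite /fubini_F/=.
have E x : (\int[lebesgue_rV R n]_y (weight (rV_cons (x, y) : 'rV[R]_n.+1))%:E =
    ((oneDsqr x)^-1)%:E * \int[lebesgue_rV R n]_y (weight y)%:E)%E.
  rewrite -ge0_integralZl//.
  - by apply: eq_integral => y _; rewrite weight_cons EFinM.
  - by apply/measurable_EFinP; exact: measurable_weight.
  - by move=> y _; rewrite lee_fin ltW// weight_gt0.
under eq_integral => x _ do rewrite E.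
rewrite ge0_integralZr//.
- rewrite lte_mul_pinfty//.
    by apply: integral_ge0 => y _; rewrite lee_fin.
  by have /(integrable_fin_num measurableT) := integrable_oneDsqrV.
- exact/measurable_EFinP.
- by apply: integral_ge0 => y _; rewrite lee_fin ltW// weight_gt0.
Qed.

End inverse_square_weight.

Section bandlimited_integrable.
Variables (R : realType) (d : nat).
Local Notation leb := (lebesgue_rV R d).

(** The product of g with the polynomial 1 / weight is again a transform of test
   functions, hence bounded. *)
Lemma bandlimited_weight (g : 'rV[R]_d -> R) : bandlimited g ->
  exists M, forall x, `|g x| <= M * weight x.
Proof.
move=> tg.
have tw (r : seq 'I_d) : bandlimited (fun x => (\prod_(j <- r) oneDsqr (x 0 j)) * g x).
  elim: r => [|i r IH].
    by move: tg; congr bandlimited; apply/funext => x; rewrite big_nil mul1r.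
  rewrite (_ : (fun x : 'rV[R]_d => _) = (fun x => (\prod_(j <- r) oneDsqr (x 0 j)) * g x +
     x 0 i * (x 0 i * ((\prod_(j <- r) oneDsqr (x 0 j)) * g x)))).
    by apply: bandlimited_add => //; do 2 apply: bandlimited_coord.
  apply/funext => x; rewrite big_cons.
  by rewrite {1}/oneDsqr; ring.
have [M gM] := bandlimited_bounded (tw (index_enum 'I_d)).
exists M => x; rewrite /weight prodfV ler_pdivlMr; last first.
  by apply: prodr_gt0 => j _; rewrite (lt_le_trans _ (oneDsqr_ge1 _)).
rewrite mulrC -[X in X * _]ger0_norm -?normrM//.
by apply: prodr_ge0 => j _; rewrite (le_trans _ (oneDsqr_ge1 _)).
Qed.

Lemma bandlimited_integrable (g : 'rV[R]_d -> R) : bandlimited g ->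
  leb.-integrable setT (fun x : borel R d => (g x)%:E).
Proof.
move=> tg; have [M gM] := bandlimited_weight tg.
apply: (@le_integrable _ _ _ _ _ measurableT _ (fun x : borel R d => M%:E * (weight x)%:E)%E).
- apply/measurable_EFinP; apply: measurable_continuous.
  exact/smooth_continuous/bandlimited_smooth.
- move=> x _ /=; rewrite lee_fin; apply: le_trans (gM x) _; exact: ler_norm.
- by apply: integrableZl => //; exact: integrable_weight.
Qed.

End bandlimited_integrable.

(** * Integration of complex-valued functions *)

Section complex_one_norm.
Variable R : realType.
Implicit Types z w : R[i].

(** The l^1 norm of R^2. Unlike for the modulus, the triangle inequality for
   integrals is the real one applied twice; this norm is still submultiplicative. *)
Definition n1 z : R := `|complex.Re z| + `|complex.Im z|.

Lemma n1_ge0 z : 0 <= n1 z. Proof. exact: addr_ge0. Qed.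

Lemma n1_0 : n1 0 = 0. Proof. by rewrite /n1 /= normr0 addr0. Qed.

Lemma n1N z : n1 (- z) = n1 z. Proof. by case: z => a b; rewrite /n1/= !normrN. Qed.

Lemma n1D z w : n1 (z + w) <= n1 z + n1 w.
Proof.
case: z w => [a b] [c e]; rewrite /n1/=.
by rewrite addrACA lerD// ler_normD.
Qed.

Lemma n1C z w : n1 (z - w) = n1 (w - z).
Proof. by rewrite -n1N opprB. Qed.

Lemma n1M z w : n1 (z * w) <= n1 z * n1 w.
Proof.
case: z w => [a b] [c e]; rewrite /n1/=.
apply: le_trans (lerD (ler_normB _ _) (ler_normD _ _)) _.
by rewrite !normrM le_eqVlt; apply/orP; left; apply/eqP; ring.
Qed.

Lemma n1_sum (I : Type) (r : seq I) (P : pred I) (f : I -> R[i]) :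
  n1 (\sum_(i <- r | P i) f i) <= \sum_(i <- r | P i) n1 (f i).
Proof.
elim/big_ind2 : _ => [|x y z w xy zw|//]; first by rewrite n1_0.
by apply: le_trans (n1D _ _) _; exact: lerD.
Qed.

Lemma norm_Re_le z : `|complex.Re z| <= n1 z. Proof. by rewrite lerDl. Qed.
Lemma norm_Im_le z : `|complex.Im z| <= n1 z. Proof. by rewrite lerDr. Qed.

Lemma n1_real (c : R) : n1 c%:C = `|c|.
Proof. by rewrite /n1/= normr0 addr0. Qed.

Lemma ReD z w : complex.Re (z + w) = complex.Re z + complex.Re w.
Proof. by case: z w => [a b] [c e]. Qed.
Lemma ImD z w : complex.Im (z + w) = complex.Im z + complex.Im w.
Proof. by case: z w => [a b] [c e]. Qed.
Lemma ReN z : complex.Re (- z) = - complex.Re z. Proof. by case: z. Qed.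
Lemma ImN z : complex.Im (- z) = - complex.Im z. Proof. by case: z. Qed.
Lemma ReM z w : complex.Re (z * w) =
  complex.Re z * complex.Re w - complex.Im z * complex.Im w.
Proof. by case: z w => [a b] [c e]. Qed.
Lemma ImM z w : complex.Im (z * w) =
  complex.Re z * complex.Im w + complex.Im z * complex.Re w.
Proof. by case: z w => [a b] [c e]. Qed.

Lemma complex_ext z w : complex.Re z = complex.Re w ->
  complex.Im z = complex.Im w -> z = w.
Proof. by case: z w => [a b] [c e]/= -> ->. Qed.

(** exp (i t). *)
Definition cis (t : R) : R[i] := cos t +i* sin t.

Lemma cis0 : cis 0 = 1. Proof. by rewrite /cis cos0 sin0. Qed.

Lemma cisD s t : cis (s + t) = cis s * cis t.
Proof.
by apply: complex_ext; rewrite ?ReM ?ImM/= ?cosD ?sinD//; ring.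
Qed.

Lemma n1_cis t : n1 (cis t) <= 2.
Proof. by rewrite /n1/= -[2]/(1 + 1) lerD// ?cos_max ?sin_max. Qed.

End complex_one_norm.

Section complex_integral.
Context d (T : measurableType d) (R : realType) (mu : {measure set T -> \bar R}).
Implicit Types (f g : T -> R[i]).

Definition cmeasurable f := measurable_fun setT (fun x => complex.Re (f x)) /\
                            measurable_fun setT (fun x => complex.Im (f x)).

Definition cintegrable f :=
  mu.-integrable setT (fun x => (complex.Re (f x))%:E) /\
  mu.-integrable setT (fun x => (complex.Im (f x))%:E).

Definition cint f : R[i] :=
  (\int[mu]_x complex.Re (f x))%R +i* (\int[mu]_x complex.Im (f x))%R.

Lemma eq_cint f g : f =1 g -> cint f = cint g.
Proof. by move=> /funext ->. Qed.

Lemma cintegrable_meas f : cintegrable f -> cmeasurable f.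
Proof.
by move=> [rf jf]; split; [exact: integrable_measurable rf|
                           exact: integrable_measurable jf].
Qed.

Lemma measurable_n1 f : cmeasurable f -> measurable_fun setT (fun x => n1 (f x)).
Proof. by move=> [mr mi]; apply: measurable_funD; exact: measurableT_comp. Qed.

Lemma cmeasurable_add f g : cmeasurable f -> cmeasurable g ->
  cmeasurable (fun x => f x + g x).
Proof.
move=> [mr mi] [mr' mi']; split.
  by under eq_fun do rewrite ReD; exact: measurable_funD.
by under eq_fun do rewrite ImD; exact: measurable_funD.
Qed.

Lemma cmeasurable_opp f : cmeasurable f -> cmeasurable (fun x => - f x).
Proof.
move=> [mr mi]; split.
  by under eq_fun do rewrite ReN; exact: measurable_funN.
by under eq_fun do rewrite ImN; exact: measurable_funN.
Qed.

Lemma cmeasurable_mul f g : cmeasurable f -> cmeasurable g ->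
  cmeasurable (fun x => f x * g x).
Proof.
move=> [mr mi] [mr' mi']; split.
  under eq_fun do rewrite ReM.
  by apply: measurable_funB; exact: measurable_funM.
under eq_fun do rewrite ImM.
by apply: measurable_funD; exact: measurable_funM.
Qed.

Lemma cmeasurable_cst (c : R[i]) : cmeasurable (fun=> c).
Proof. by split; exact: measurable_cst. Qed.

Lemma cintegrable_n1 f : cintegrable f -> mu.-integrable setT (fun x => (n1 (f x))%:E).
Proof.
move=> [rf jf]; rewrite /n1; under eq_fun do rewrite EFinD.
by apply: integrableD => //; exact: integrable_norm.
Qed.

Lemma le_cintegrable f (g : T -> R) : cmeasurable f ->
  (forall x, n1 (f x) <= g x) -> mu.-integrable setT (fun x => (g x)%:E) ->
  cintegrable f.
Proof.
move=> [mr mi] fg ig; split; apply: le_integrable ig => //.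
- exact/measurable_EFinP.
- by move=> x _ /=; rewrite lee_fin (le_trans (norm_Re_le _))// (le_trans (fg x))// ler_norm.
- exact/measurable_EFinP.
- by move=> x _ /=; rewrite lee_fin (le_trans (norm_Im_le _))// (le_trans (fg x))// ler_norm.
Qed.

Lemma cintegrable_mul (u : T -> R[i]) f (C : R) : cmeasurable u ->
  (forall x, n1 (u x) <= C) -> cintegrable f -> cintegrable (fun x => u x * f x).
Proof.
move=> mu' uC cf; apply: (@le_cintegrable _ (fun x => C * n1 (f x))).
- by apply: cmeasurable_mul => //; exact: cintegrable_meas.
- by move=> x; apply: le_trans (n1M _ _) _; rewrite ler_wpM2r// n1_ge0.
- by under eq_fun do rewrite EFinM; apply: integrableZl => //; exact: cintegrable_n1.
Qed.

Lemma cintegrable_add f g : cintegrable f -> cintegrable g ->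
  cintegrable (fun x => f x + g x).
Proof.
move=> [rf jf] [rg jg]; split.
  by under eq_fun do rewrite ReD EFinD; exact: integrableD.
by under eq_fun do rewrite ImD EFinD; exact: integrableD.
Qed.

Lemma cintegrableZ (c : R[i]) f : cintegrable f -> cintegrable (fun x => c * f x).
Proof.
by apply: cintegrable_mul => //; exact: cmeasurable_cst.
Qed.

Lemma cintegrable_opp f : cintegrable f -> cintegrable (fun x => - f x).
Proof. by move=> /(cintegrableZ (-1)); under eq_fun do rewrite mulN1r. Qed.

Lemma cintegrable_sub f g : cintegrable f -> cintegrable g ->
  cintegrable (fun x => f x - g x).
Proof. by move=> cf cg; apply: cintegrable_add => //; exact: cintegrable_opp. Qed.

Lemma cintegrable0 : cintegrable (fun=> 0).
Proof. by split; exact: integrable0. Qed.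

Lemma cintegrable_sum (I : Type) (r : seq I) (F : I -> T -> R[i]) :
  (forall i, cintegrable (F i)) -> cintegrable (fun x => \sum_(i <- r) F i x).
Proof.
move=> cF; elim: r => [|i r IH].
  by under eq_fun do rewrite big_nil; exact: cintegrable0.
by under eq_fun do rewrite big_cons; exact: cintegrable_add.
Qed.

Lemma cintD f g : cintegrable f -> cintegrable g ->
  cint (fun x => f x + g x) = cint f + cint g.
Proof.
move=> [rf jf] [rg jg]; apply: complex_ext; rewrite ?ReD ?ImD/= -RintegralD//;
  by apply: eq_Rintegral => x _; rewrite ?ReD ?ImD.
Qed.

Lemma cintZ (c : R[i]) f : cintegrable f -> cint (fun x => c * f x) = c * cint f.
Proof.
move=> [rf jf]; apply: complex_ext; rewrite ?ReM ?ImM/= -!RintegralZl//.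
  rewrite -RintegralB//; first by apply: eq_Rintegral => x _; rewrite ReM.
    exact: (integrableZl measurableT _ rf).
  exact: (integrableZl measurableT _ jf).
rewrite -RintegralD//; first by apply: eq_Rintegral => x _; rewrite ImM.
  exact: (integrableZl measurableT _ jf).
exact: (integrableZl measurableT _ rf).
Qed.

Lemma cintN f : cintegrable f -> cint (fun x => - f x) = - cint f.
Proof.
move=> cf; rewrite -mulN1r -cintZ//; apply: eq_cint => x; by rewrite mulN1r.
Qed.

Lemma cintB f g : cintegrable f -> cintegrable g ->
  cint (fun x => f x - g x) = cint f - cint g.
Proof. by move=> cf cg; rewrite cintD ?cintN//; exact: cintegrable_opp. Qed.

Lemma cint_sum (I : Type) (r : seq I) (F : I -> T -> R[i]) :
  (forall i, cintegrable (F i)) ->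
  cint (fun x => \sum_(i <- r) F i x) = \sum_(i <- r) cint (F i).
Proof.
move=> cF; elim: r => [|i r IH].
  rewrite big_nil (@eq_cint _ (fun=> 0)); last by move=> x; rewrite big_nil.
  by apply: complex_ext => /=; rewrite Rintegral_cst// mul0r.
rewrite big_cons -IH -cintD//; last exact: cintegrable_sum.
by apply: eq_cint => x; rewrite big_cons.
Qed.

Lemma n1_cint_le f : cintegrable f -> n1 (cint f) <= (\int[mu]_x n1 (f x))%R.
Proof.
move=> [rf jf]; rewrite /n1/= RintegralD//; [|exact: integrable_norm..].
by apply: lerD; exact: le_normr_Rintegral.
Qed.

Lemma dominated_cvgR (f_ : nat -> T -> R) (f g : T -> R) :
  (forall n, measurable_fun setT (f_ n)) ->
  (forall x, f_ n x @[n --> \oo] --> f x) ->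
  mu.-integrable setT (fun x => (g x)%:E) -> (forall n x, `|f_ n x| <= g x) ->
  (\int[mu]_x f_ n x)%R @[n --> \oo] --> (\int[mu]_x f x)%R.
Proof.
move=> mf fl ig fg.
have mfl : measurable_fun setT f.
  by apply: (measurable_fun_cvg (h := f_)) => // x _; exact: fl.
have fl' : forall x, setT x -> (f_ n x)%:E @[n --> \oo] --> (f x)%:E.
  by move=> x _; apply: cvg_EFin; [exact: nearW|exact: fl].
have fg' : forall x n, setT x -> (`|(f_ n x)%:E| <= (g x)%:E)%E.
  by move=> x n _; rewrite /= lee_fin fg.
have mf' n : measurable_fun setT (fun x => (f_ n x)%:E) by exact/measurable_EFinP.
have mfl' : measurable_fun setT (fun x => (f x)%:E) by exact/measurable_EFinP.
have [i0 _ H] := @dominated_convergence _ _ _ mu setT measurableT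
  (fun n x => (f_ n x)%:E) (fun x => (f x)%:E) (fun x => (g x)%:E)
  mf' mfl' (aeW _ fl') ig (aeW _ fg').
apply: fine_cvg; rewrite fineK//; exact: integrable_fin_num.
Qed.

End complex_integral.

Section complex_convergence.
Variable R : realType.
Implicit Types (u v : nat -> R[i]) (l m : R[i]).

Definition ccvg u l := n1 (u n - l) @[n --> \oo] --> (0 : R).

Lemma ccvgP u l : ccvg u l <->
  (complex.Re (u n) @[n --> \oo] --> complex.Re l) /\
  (complex.Im (u n) @[n --> \oo] --> complex.Im l).
Proof.
split=> [ul|[ur ui]].
  split; apply/cvgrPdist_le => e e0;
    move/cvgrPdist_le : ul => /(_ e e0); apply: filterS => n;
    rewrite sub0r normrN (ger0_norm (n1_ge0 _)); apply: le_trans;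
    rewrite n1C.
    by apply: le_trans (norm_Re_le _); rewrite ReD ReN.
  by apply: le_trans (norm_Im_le _); rewrite ImD ImN.
rewrite /ccvg /n1 -[0 : R]addr0; under eq_fun do rewrite ReD ImD ReN ImN.
by apply: cvgD; apply/norm_cvg0P; apply/subr_cvg0.
Qed.

Lemma ccvg_unique u l m : ccvg u l -> ccvg u m -> l = m.
Proof.
move=> /ccvgP[ur ui] /ccvgP[vr vi]; apply: complex_ext.
  by apply: (cvg_unique _ ur vr).
by apply: (cvg_unique _ ui vi).
Qed.

Lemma ccvg_cst l : ccvg (fun=> l) l.
Proof. by apply/ccvgP; split; exact: cvg_cst. Qed.

Lemma ccvgD u v l m : ccvg u l -> ccvg v m -> ccvg (fun n => u n + v n) (l + m).
Proof.
move=> /ccvgP[ur ui] /ccvgP[vr vi]; apply/ccvgP; rewrite ReD ImD; split.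
  by under eq_fun do rewrite ReD; exact: cvgD.
by under eq_fun do rewrite ImD; exact: cvgD.
Qed.

Lemma ccvgM u v l m : ccvg u l -> ccvg v m -> ccvg (fun n => u n * v n) (l * m).
Proof.
move=> /ccvgP[ur ui] /ccvgP[vr vi]; apply/ccvgP; rewrite ReM ImM; split.
  by under eq_fun do rewrite ReM; apply: cvgB; exact: cvgM.
by under eq_fun do rewrite ImM; apply: cvgD; exact: cvgM.
Qed.

Lemma ccvg_le u l (b : nat -> R) : (forall n, n1 (u n - l) <= b n) ->
  b n @[n --> \oo] --> (0 : R) -> ccvg u l.
Proof.
move=> ub b0; apply: (squeeze_cvgr _ (cvg_cst 0) b0).
by apply: nearW => n; rewrite n1_ge0 ub.
Qed.

End complex_convergence.

Section complex_dominated_fubini.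

Lemma cint_dominated d (T : measurableType d) (R : realType)
    (mu : {measure set T -> \bar R}) (f_ : nat -> T -> R[i]) (f : T -> R[i])
    (g : T -> R) :
  (forall n, cmeasurable (f_ n)) -> (forall x, ccvg (f_ ^~ x) (f x)) ->
  mu.-integrable setT (fun x => (g x)%:E) -> (forall n x, n1 (f_ n x) <= g x) ->
  ccvg (fun n => cint mu (f_ n)) (cint mu f).
Proof.
move=> mf fl ig fg; apply/ccvgP; split=> /=; apply: (dominated_cvgR _ _ ig).
- by move=> n; exact: (mf n).1.
- by move=> x; have /ccvgP[] := fl x.
- by move=> n x; apply: le_trans (norm_Re_le _) _.
- by move=> n; exact: (mf n).2.
- by move=> x; have /ccvgP[] := fl x.
- by move=> n x; apply: le_trans (norm_Im_le _) _.
Qed.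

Context d1 d2 (T1 : measurableType d1) (T2 : measurableType d2) (R : realType).
Variable m1 : {sigma_finite_measure set T1 -> \bar R}.
Variable m2 : {sigma_finite_measure set T2 -> \bar R}.

Lemma Rintegral_Fubini (f : T1 * T2 -> R) :
  (m1 \x m2)%E.-integrable setT (fun z => (f z)%:E) ->
  (forall x, m2.-integrable setT (fun y => (f (x, y))%:E)) ->
  (forall y, m1.-integrable setT (fun x => (f (x, y))%:E)) ->
  (\int[m1]_x (\int[m2]_y f (x, y)))%R = (\int[m2]_y (\int[m1]_x f (x, y)))%R.
Proof.
move=> im i2 i1; rewrite /Rintegral; congr fine.
transitivity (\int[m1]_x \int[m2]_y (f (x, y))%:E)%E.
  by apply: eq_integral => x _; rewrite fineK//; exact: integrable_fin_num.
rewrite (Fubini im); apply: eq_integral => y _; rewrite fineK//.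
exact: integrable_fin_num.
Qed.

Lemma integrable_Rintegral2 (f : T1 * T2 -> R) :
  (m1 \x m2)%E.-integrable setT (fun z => (f z)%:E) ->
  (forall x, m2.-integrable setT (fun y => (f (x, y))%:E)) ->
  m1.-integrable setT (fun x => (\int[m2]_y f (x, y))%:E).
Proof.
move=> im i2; have := integrable_fubini_F im; apply: eq_integrable => // x _.
by rewrite /fubini_F /Rintegral fineK//; exact: integrable_fin_num.
Qed.

Lemma cint_Fubini (f : T1 * T2 -> R[i]) :
  cintegrable (m1 \x m2)%E f ->
  (forall x, cintegrable m2 (fun y => f (x, y))) ->
  (forall y, cintegrable m1 (fun x => f (x, y))) ->
  cint m1 (fun x => cint m2 (fun y => f (x, y))) =
  cint m2 (fun y => cint m1 (fun x => f (x, y))).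
Proof.
move=> [ir ii] i2 i1; apply: complex_ext => /=.
  apply: (Rintegral_Fubini ir) => [x|y]; [exact: (i2 x).1|exact: (i1 y).1].
apply: (Rintegral_Fubini ii) => [x|y]; [exact: (i2 x).2|exact: (i1 y).2].
Qed.

Lemma cintegrable_cint2 (f : T1 * T2 -> R[i]) :
  cintegrable (m1 \x m2)%E f ->
  (forall x, cintegrable m2 (fun y => f (x, y))) ->
  cintegrable m1 (fun x => cint m2 (fun y => f (x, y))).
Proof.
move=> [ir ii] i2; split.
  by apply: (integrable_Rintegral2 ir) => x; exact: (i2 x).1.
by apply: (integrable_Rintegral2 ii) => x; exact: (i2 x).2.
Qed.

Lemma integrable_prodM (a : T1 -> R) (b : T2 -> R) :
  m1.-integrable setT (fun x => (a x)%:E) ->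
  m2.-integrable setT (fun y => (b y)%:E) ->
  (m1 \x m2)%E.-integrable setT (fun z => (a z.1 * b z.2)%:E).
Proof.
move=> ia ib.
have ma := integrable_measurable ia; have mb := integrable_measurable ib.
apply/integrable12ltyP.
  apply/measurable_EFinP; apply: measurable_funM.
    exact: measurableT_comp ma measurable_fst.
  exact: measurableT_comp mb measurable_snd.
under eq_integral => x _.
  under eq_integral => y _ do rewrite /= normrM EFinM.
  rewrite ge0_integralZl//; last by apply/measurable_EFinP; exact: measurableT_comp.
  over.
rewrite ge0_integralZr//.
- have /integrableP[_ ?] := ia; have /integrableP[_ ?] := ib.
  rewrite lte_mul_pinfty//; first exact: integral_ge0.
  have /integrable_fin_num := integrable_abse ia; exact.
- by apply/measurable_EFinP; exact: measurableT_comp.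
- by apply: integral_ge0.
Qed.

End complex_dominated_fubini.

(** * Continuity of translations in the mean *)

Section translation_continuity.
Variables (R : realType) (d : nat).
Local Notation leb := (lebesgue_rV R d).
Implicit Types (f g : 'rV[R]_d -> R) (h : 'rV[R]_d).

Definition rintegrable f := leb.-integrable setT (fun x : borel R d => (f x)%:E).

Definition modulus f h : R := (\int[leb]_x `|f (x + h)%R - f x|)%R.

Lemma rintegrable_shift f h : rintegrable f -> rintegrable (fun x => f (x + h)).
Proof.
move=> fi; have := integrable_affine h (oner_neq0 _) fi.
by rewrite /affine; under eq_fun do rewrite scale1r.
Qed.

Lemma integral_shift f h : rintegrable f ->
  (\int[leb]_x f (x + h)%R = \int[leb]_x f x)%R.
Proof.
move=> fi; rewrite /Rintegral; have := integral_affine h (oner_neq0 _) fi.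
rewrite /affine normr1 invr1 expr1n mul1e => <-; congr fine.
by apply: eq_integral => z _; rewrite scale1r.
Qed.

Lemma rintegrable_sub f g : rintegrable f -> rintegrable g ->
  rintegrable (fun x => f x - g x).
Proof.
move=> fi gi; rewrite /rintegrable; under eq_fun do rewrite EFinB.
exact: integrableB.
Qed.

Lemma rintegrable_add f g : rintegrable f -> rintegrable g ->
  rintegrable (fun x => f x + g x).
Proof.
move=> fi gi; rewrite /rintegrable; under eq_fun do rewrite EFinD.
exact: integrableD.
Qed.

Lemma rintegrable_norm f : rintegrable f -> rintegrable (fun x => `|f x|).
Proof. exact: integrable_norm. Qed.

Lemma rintegrableZ (c : R) f : rintegrable f -> rintegrable (fun x => c * f x).
Proof. by move=> fi; rewrite /rintegrable; under eq_fun do rewrite EFinM; exact: integrableZl. Qed.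

Lemma rintegrable_modulus f h : rintegrable f ->
  rintegrable (fun x => `|f (x + h) - f x|).
Proof.
by move=> fi; apply: rintegrable_norm; apply: rintegrable_sub => //; exact: rintegrable_shift.
Qed.

Lemma L1norm_shift f h : rintegrable f -> L1norm (fun x => f (x + h)) = L1norm f.
Proof. by move=> fi; exact: (integral_shift h (rintegrable_norm fi)). Qed.

Lemma L1normD f g : rintegrable f -> rintegrable g ->
  L1norm (fun x => f x + g x) <= L1norm f + L1norm g.
Proof.
move=> fi gi; have nf := rintegrable_norm fi; have ng := rintegrable_norm gi.
rewrite /L1norm -RintegralD//; apply: le_Rintegral => //.
- by apply: rintegrable_norm; exact: rintegrable_add.
- exact: (rintegrable_add nf ng).
- by move=> x _; exact: ler_normD.
Qed.

Lemma modulus_ge0 f h : 0 <= modulus f h.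
Proof. by apply: Rintegral_ge0 => x _. Qed.

Lemma L1normN f : L1norm (fun x => - f x) = L1norm f.
Proof. by apply: eq_Rintegral => x _; rewrite normrN. Qed.

Lemma modulus_le f h : rintegrable f -> modulus f h <= 2 * L1norm f.
Proof.
move=> fi; have fh := rintegrable_shift h fi.
have := L1normD fh (rintegrableZ (-1) fi); rewrite L1norm_shift//.
rewrite mulr_natl mulr2n (_ : L1norm (fun x => -1 * f x) = L1norm f); last first.
  by rewrite -L1normN; apply: eq_Rintegral => x _; rewrite mulN1r opprK.
by apply: le_trans; rewrite le_eqVlt; apply/orP; left; apply/eqP;
  apply: eq_Rintegral => x _; rewrite mulN1r.
Qed.

Lemma modulusD f g h : rintegrable f -> rintegrable g ->
  modulus (fun x => f x + g x) h <= modulus f h + modulus g h.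
Proof.
move=> fi gi; have fh := rintegrable_shift h fi; have gh := rintegrable_shift h gi.
have := L1normD (rintegrable_sub fh fi) (rintegrable_sub gh gi).
apply: le_trans; rewrite le_eqVlt; apply/orP; left; apply/eqP.
by apply: eq_Rintegral => x _; congr (`|_|); ring.
Qed.

Lemma modulusZ (c : R) f h : rintegrable f ->
  modulus (fun x => c * f x) h = `|c| * modulus f h.
Proof.
move=> fi; rewrite /modulus -RintegralZl//; last exact: rintegrable_modulus.
by apply: eq_Rintegral => x _; rewrite -mulrBr normrM.
Qed.

(** Stated for sequences, as dominated convergence is; a property of f that is stable
   under linear combinations and under L^1 limits. *)
Definition shift_continuous f := rintegrable f /\
  forall hn : nat -> 'rV[R]_d, hn n @[n --> \oo] --> (0 : 'rV[R]_d) ->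
    modulus f (hn n) @[n --> \oo] --> (0 : R).

Lemma shift_continuous_add f g : shift_continuous f -> shift_continuous g ->
  shift_continuous (fun x => f x + g x).
Proof.
move=> [fi fc] [gi gc]; split=> [|hn h0]; first exact: rintegrable_add.
have H : (modulus f (hn n) + modulus g (hn n)) @[n --> \oo] --> (0 : R).
  by rewrite -[0 : R]addr0; apply: cvgD; [exact: fc|exact: gc].
apply: (squeeze_cvgr _ (cvg_cst 0) H); apply: nearW => n.
by rewrite modulus_ge0 modulusD.
Qed.

Lemma shift_continuousZ (c : R) f : shift_continuous f ->
  shift_continuous (fun x => c * f x).
Proof.
move=> [fi fc]; split=> [|hn h0]; first exact: rintegrableZ.
under eq_fun do rewrite modulusZ//.
by rewrite -[0 : R](mulr0 `|c|); apply: cvgMr; exact: fc.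
Qed.

Lemma shift_continuous0 : shift_continuous (fun=> 0).
Proof.
split=> [|hn _]; first exact: integrable0.
rewrite (_ : (fun n => _) = cst 0); first exact: cvg_cst.
apply/funext => n; rewrite /modulus; under eq_Rintegral do rewrite subrr normr0.
by rewrite Rintegral_cst// mul0r.
Qed.

Lemma shift_continuous_sum (I : Type) (r : seq I) (F : I -> 'rV[R]_d -> R) :
  (forall i, shift_continuous (F i)) ->
  shift_continuous (fun x => \sum_(i <- r) F i x).
Proof.
move=> cF; elim: r => [|i r IH].
  by under eq_fun do rewrite big_nil; exact: shift_continuous0.
by under eq_fun do rewrite big_cons; exact: shift_continuous_add.
Qed.

(** Translations are isometries of L^1, so the modulus of f differs from that of g
   by at most twice the distance of f and g. *)
Lemma shift_continuous_closed f : rintegrable f ->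
  (forall e, 0 < e -> exists2 g, shift_continuous g & L1norm (fun x => f x - g x) <= e) ->
  shift_continuous f.
Proof.
move=> fi fg; split=> // hn h0; apply/cvgr0Pnorm_le => e e0.
have e4 : 0 < e / 4 by rewrite divr_gt0.
have [g [gi gc] fge] := fg _ e4.
have e2 : 0 < e / 2 by rewrite divr_gt0.
have /cvgr0Pnorm_le/(_ _ e2) := gc _ h0; apply: filterS => n.
rewrite !ger0_norm ?modulus_ge0// => ge.
have := @modulusD (fun x => f x - g x) g (hn n) (rintegrable_sub fi gi) gi.
have := modulus_le (hn n) (rintegrable_sub fi gi).
have -> : (fun x => f x - g x + g x) = f by apply/funext => x; rewrite subrK.
by lra.
Qed.

Lemma cvg_shift_continuous f (fn : nat -> 'rV[R]_d -> R) g : rintegrable g ->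
  (forall n, shift_continuous (fn n)) -> rintegrable f ->
  (forall n x, `|f x - fn n x| <= g x) -> (forall x, fn n x @[n --> \oo] --> f x) ->
  shift_continuous f.
Proof.
move=> gi fc fi fg fl; apply: shift_continuous_closed => // e e0.
have : (\int[leb]_x `|f x - fn n x|)%R @[n --> \oo] --> (\int[leb]_x (cst 0 x : R))%R.
  apply: (@dominated_cvgR _ _ _ leb (fun n x => `|f x - fn n x|) (cst 0) g) => //.
  - move=> n; apply: integrable_measurable.
    by apply: rintegrable_norm; apply: rintegrable_sub => //; exact: (fc n).1.
  - move=> x; apply/norm_cvg0P; rewrite /cst -[0 : R](subrr (f x)).
    by apply: cvgB; [exact: cvg_cst|exact: fl].
  - by move=> n x; rewrite normr_id.
rewrite Rintegral_cst// mul0r => /cvgr0Pnorm_le/(_ e e0)[N _ /(_ N (leqnn N))].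
rewrite ger0_norm; last by apply: Rintegral_ge0.
by move=> H; exists (fn N).
Qed.

Lemma rintegrable_indic (A : set (borel R d)) : measurable A -> (leb A < +oo)%E ->
  rintegrable (\1_A : borel R d -> R).
Proof.
move=> mA Aoo; apply/integrableP; split; first exact/measurable_EFinP.
under eq_integral do rewrite gee0_abs ?lee_fin//.
by rewrite integral_indic ?setIT.
Qed.

(** For an open set, the indicator at x + h tends to 1 at each point x of the set, so
   that int 1_U(x) 1_U(x + h) tends to the measure of U by dominated convergence;
   the modulus is twice the difference of the two. *)
Lemma shift_continuous_open (U : set 'rV[R]_d) : open U -> (leb U < +oo)%E ->
  shift_continuous (\1_U : 'rV[R]_d -> R).
Proof.
move=> oU Uoo; have mU := measurable_open oU.
have iU := rintegrable_indic mU Uoo; split=> // hn h0.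
pose m n := (\int[leb]_x (\1_U x * \1_U (x + hn n)%R : R))%R.
have mi n : rintegrable (fun x => \1_U x * \1_U (x + hn n)).
  apply: (@le_integrable _ _ _ _ _ measurableT _ (fun x : borel R d => (\1_U x)%:E)) => //.
  - apply/measurable_EFinP/measurable_funM; first exact: integrable_measurable iU.
    exact: integrable_measurable (rintegrable_shift (hn n) iU).
  - by move=> x _ /=; rewrite lee_fin normrM ler_piMr// ger0_norm// indicE; case: (_ \in _).
have E n : modulus (\1_U : 'rV[R]_d -> R) (hn n) = 2 * (\int[leb]_x (\1_U x : R))%R - 2 * m n.
  rewrite mulr_natl mulr2n -{1}(integral_shift (hn n) iU) -RintegralD//; last first.
    exact: rintegrable_shift.
  rewrite /m -(RintegralZl 2 measurableT (mi n)) -RintegralB//; last first.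
  - exact: (rintegrableZ 2 (mi n)).
  - exact: (rintegrable_add (rintegrable_shift (hn n) iU) iU).
  apply: eq_Rintegral => x _; rewrite !indicE.
  case: (_ \in _); case: (_ \in _); rewrite /= ?subrr ?normr0 ?subr0 ?sub0r ?normrN ?normr1; ring.
have ml : m n @[n --> \oo] --> (\int[leb]_x (\1_U x : R))%R.
  apply: (@dominated_cvgR _ _ _ leb (fun n x => \1_U x * \1_U (x + hn n)) (\1_U) (\1_U)) => //.
  - by move=> n; exact: integrable_measurable (mi n).
  - move=> x; rewrite !indicE.
    have [xU|xU] := boolP (x \in U); last first.
      by rewrite /=; under eq_fun do rewrite mul0r; exact: cvg_cst.
    have xh : x + hn n @[n --> \oo] --> (x : 'rV[R]_d).
      by rewrite -[X in _ --> X]addr0; apply: cvgD => //; exact: cvg_cst.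
    move: xU; rewrite inE => xU.
    have nU : \forall n \near \oo, U (x + hn n).
      exact: xh _ (open_nbhs_nbhs (conj oU xU)).
    by apply: cvg_near_cst; apply: filterS nU => n xU'; rewrite indicE mul1r mem_set.
  - by move=> n x; rewrite normrM !ger0_norm// ler_piMr// indicE; case: (_ \in _).
under eq_fun do rewrite E.
rewrite -[0 : R](subrr (2 * (\int[leb]_x (\1_U x : R))%R)).
by apply: cvgB; [exact: cvg_cst|apply: cvgMr].
Qed.

Lemma open_cube (r : R) : open (cube r : set 'rV[R]_d).
Proof.
rewrite /cube; have [r0|r0] := ltP 0 r.
  have := @ball_box R d 0 r r0; under eq_fun do rewrite mxE sub0r.
  by under [X in open_box _ X]eq_fun do rewrite mxE add0r; move=> <-; exact: ball_open.
case: d => [|n].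
  by rewrite (_ : open_box _ _ = setT); [exact: openT|apply/seteqP; split=> // v _ []].
rewrite (_ : open_box _ _ = set0); first exact: open0.
apply/seteqP; split=> // v /(_ ord0); rewrite /= in_itv/= => /andP[? ?].
by exfalso; lra.
Qed.

(** Open sets are stable under intersection and generate the Borel sets. The
   intersection with a cube keeps complements of finite measure. *)
Lemma shift_continuous_cube (r : R) (A : set (borel R d)) : measurable A ->
  shift_continuous (\1_(A `&` cube r) : 'rV[R]_d -> R).
Proof.
have oc := @open_cube r; have mc := @measurable_cube R d r.
have coo := @lebesgue_cube_lty R d r.
have le_cube (B : set (borel R d)) : measurable B -> (leb (B `&` cube r) < +oo)%E.
  move=> mB; apply: le_lt_trans coo; apply: le_measure; rewrite ?inE//.
  exact: measurableI.
have ci := rintegrable_indic mc coo.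
apply: (@dynkin_induction _ (borel R d) (@open 'rV[R]_d)
  (fun A => shift_continuous (\1_(A `&` cube r) : 'rV[R]_d -> R))) => //.
- by move=> U V oU oV; exact: openI.
- by rewrite setTI; exact: shift_continuous_open.
- move=> U oU; apply: shift_continuous_open; first exact: openI.
  by apply: le_cube; exact: measurable_open.
- move=> S mS PS.
  rewrite (_ : \1_(~` S `&` cube r) =
    (fun x : 'rV[R]_d => \1_(cube r) x + -1 * \1_(S `&` cube r) x)).
    apply: shift_continuous_add; first exact: shift_continuous_open.
    exact: shift_continuousZ.
  apply/funext => x; rewrite !indicE !in_setI in_setC.
  by case: (_ \in S); case: (_ \in cube r) => /=; ring.
- move=> F mF tF PF.
  pose G n := \big[setU/set0]_(k < n) F k.
  have mG n : measurable (G n) by exact: bigsetU_measurable.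
  have mU : measurable (\bigcup_k F k) by exact: bigcupT_measurable.
  have GE n x : \1_(G n `&` cube r) x = \sum_(k < n) \1_(F k `&` cube r) x :> R.
    rewrite /G; elim: n => [|n IH]; first by rewrite !big_ord0 set0I indicE in_set0.
    rewrite !big_ord_recr/= -IH !indicE !in_setI in_setU.
    set B := \big[setU/set0]_(k < n) F k.
    have : x \in B -> x \in F n -> False.
      rewrite !inE /B -bigcup_mkord => -[k /= kn Fkx] Fnx.
      have /trivIsetP/(_ k n I I) := tF; rewrite (ltn_eqF kn) => /(_ isT).
      by move/seteqP => [+ _] => /(_ x); exact.
    by case: (x \in B); case: (x \in F n) => H; try case: (H isT isT);
      case: (x \in cube r); rewrite /= ?addr0 ?add0r.
  apply: (@cvg_shift_continuous _ (fun n => \1_(G n `&` cube r)) (\1_(cube r))) => //.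
  + move=> n; rewrite (funext (GE n)); apply: shift_continuous_sum => k; exact: PF.
  + apply: rintegrable_indic; [exact: measurableI|exact: le_cube].
  + move=> n x; rewrite !indicE !in_setI.
    have : x \in G n -> x \in \bigcup_k F k.
      by rewrite !inE /G -bigcup_mkord => -[k _ Fk]; exists k.
    case: (x \in G n) => [/(_ isT)->|_]; rewrite /= ?subrr ?normr0//.
    by rewrite subr0 ger0_norm//; case: (_ \in _); case: (_ \in _).
  + move=> x; rewrite !indicE !in_setI; apply: cvg_near_cst.
    have [/[1!inE] -[k _ Fkx]|xU] := boolP (x \in \bigcup_k F k).
      exists k.+1 => // n /= kn; rewrite !indicE in_setI [x \in G n]mem_set//.
      by rewrite /G -bigcup_mkord; exists k.
    apply: nearW => n; rewrite indicE in_setI [x \in G n]memNset//.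
    rewrite /G -bigcup_mkord => -[k _ Fkx]; move/negP: xU; apply.
    by rewrite inE; exists k.
Qed.

Import HBNNSimple.

(** Simple functions with bounded support are dense in L^1, and
   [shift_continuous_cube] treats their level sets. *)
Lemma rintegrable_shift_continuous f : rintegrable f -> shift_continuous f.
Proof.
suff H g : rintegrable g -> (forall x, 0 <= g x) -> shift_continuous g.
  move=> fi; have nf := rintegrable_norm fi.
  (* difference of positive and negative parts *)
  have -> : f = fun x => 2^-1 * (`|f x| + f x) + (- 2^-1) * (`|f x| + -1 * f x).
    by apply/funext => x; field.
  apply: shift_continuous_add; apply: shift_continuousZ; apply: H.
  - exact: rintegrable_add.
  - by move=> x; rewrite addrC -lerBlDr sub0r lerNl -normrN ler_norm.
  - by apply: rintegrable_add => //; exact: rintegrableZ.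
  - by move=> x; rewrite mulN1r subr_ge0 ler_norm.
move=> gi g0; have mg := measurable_int _ gi.
pose F := nnsfun_approx measurableT mg.
pose fn n (x : borel R d) : R := F n x * \1_(cube n%:R) x.
have cF x : F n x @[n --> \oo] --> g x.
  have := @cvg_nnsfun_approx _ _ _ _ measurableT _ mg (fun x _ => g0 x) x I.
  by move=> /fine_cvgP[_].
have ndF x : nondecreasing_seq (F ^~ x).
  by move=> n m nm; have /lefP := nd_nnsfun_approx measurableT mg nm; exact.
have Fg n x : F n x <= g x.
  rewrite -(cvg_lim _ (cF x))//; apply: nondecreasing_cvgn_le; first exact: ndF.
  by apply/cvg_ex; exists (g x); exact: cF.
have fn0 n x : 0 <= fn n x by rewrite mulr_ge0.
have fng n x : fn n x <= g x.
  by rewrite (le_trans _ (Fg n x))// ler_piMr// indicE; case: (_ \in _).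
apply: (@cvg_shift_continuous _ fn g) => //.
- move=> n; rewrite /fn.
  under eq_fun do rewrite (fimfunEord (F n)) mulr_suml.
  apply: shift_continuous_sum => i.
  set y := nth _ _ _; rewrite (_ : (fun x => _) =
      (fun x : 'rV[R]_d => y * \1_(F n @^-1` [set y] `&` cube n%:R) x)).
    by apply: shift_continuousZ; exact: shift_continuous_cube.
  by apply/funext => x; rewrite indicI mulrA.
- move=> n x; rewrite ger0_norm ?subr_ge0//.
  by rewrite lerBlDr lerDl.
- move=> x; apply: cvg_trans (cF x); apply: near_eq_cvg.
  exists (Num.truncn `|x|).+1 => // n /= xn; rewrite /fn indicE mem_set ?mulr1//.
  apply/cubeP; first by rewrite ltr0n (leq_trans _ xn).
  by rewrite (lt_le_trans (truncnS_gt _))// ler_nat.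
Qed.

End translation_continuity.

(** * The Fourier transform *)

Section fourier_transform.
Variables (R : realType) (d : nat).
Local Notation leb := (lebesgue_rV R d).
Implicit Types (f g M : 'rV[R]_d -> R[i]) (xi x y : 'rV[R]_d).

Lemma fourier_charE xi x : fourier_char xi x = cis (- (2 * pi * dotr xi x)).
Proof. by []. Qed.

Lemma dotrNl xi x : dotr (- xi) x = - dotr xi x :> R.
Proof. by rewrite -scaleN1r dotrZ mulN1r. Qed.

Lemma fourier_charD xi eta x :
  fourier_char (xi + eta) x = fourier_char xi x * fourier_char eta x.
Proof. by rewrite !fourier_charE -cisD dotrD; congr cis; ring. Qed.

Lemma fourier_charC xi x : fourier_char xi x = fourier_char x xi.
Proof. by rewrite !fourier_charE dotrC. Qed.

Lemma fourier_char0 x : fourier_char 0 x = 1.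
Proof. by rewrite fourier_charE -(scale0r x) dotrZ mul0r mulr0 oppr0 cis0. Qed.

Lemma n1_fourier_char xi x : n1 (fourier_char xi x) <= 2.
Proof. exact: n1_cis. Qed.

Lemma ReIm_fourier_char xi x :
  (complex.Re (fourier_char xi x) = cos (2 * pi * dotr xi x)) /\
  (complex.Im (fourier_char xi x) = - sin (2 * pi * dotr xi x)).
Proof. by rewrite fourier_charE/= cosN sinN. Qed.

Definition ccontinuous f := continuous (fun x => complex.Re (f x)) /\
                            continuous (fun x => complex.Im (f x)).

Lemma ccontinuous_measurable f : ccontinuous f ->
  cmeasurable (f : borel R d -> R[i]).
Proof. by move=> [cr ci]; split; exact: measurable_continuous. Qed.

Lemma ccontinuous_fourier_char xi : ccontinuous (fourier_char xi).
Proof.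
have [c s] := continuous_trig_dotr xi; split.
  by under eq_fun do rewrite (ReIm_fourier_char _ _).1.
under eq_fun do rewrite (ReIm_fourier_char _ _).2.
by move=> x; apply: continuousN; exact: s.
Qed.

Definition FT f xi : R[i] := cint leb (fun x => f x * fourier_char xi x).

Definition IFT f x : R[i] := FT f (- x).

Lemma fourierE l (F : 'rV[R]_d -> 'rV[R[i]]_l) xi :
  fourier F xi = \row_j FT (fun x => F x 0 j) xi.
Proof. by []. Qed.

Definition lint f := cintegrable leb f.

Lemma lint_char f xi : lint f -> lint (fun x => f x * fourier_char xi x).
Proof.
move=> fi; rewrite /lint; under eq_fun do rewrite mulrC.
apply: (@cintegrable_mul _ _ _ leb (fourier_char xi) f 2) => //.
  exact/ccontinuous_measurable/ccontinuous_fourier_char.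
by move=> x; exact: n1_fourier_char.
Qed.

Lemma FTD f g xi : lint f -> lint g ->
  FT (fun x => f x + g x) xi = FT f xi + FT g xi.
Proof.
move=> fi gi; rewrite /FT -cintD; try exact: lint_char.
by apply: eq_cint => x; rewrite mulrDl.
Qed.

Lemma FTZ (c : R[i]) f xi : lint f -> FT (fun x => c * f x) xi = c * FT f xi.
Proof.
move=> fi; rewrite /FT -cintZ; last exact: lint_char.
by apply: eq_cint => x; rewrite mulrA.
Qed.

Lemma FT_sum (I : Type) (r : seq I) (F : I -> 'rV[R]_d -> R[i]) xi :
  (forall i, lint (F i)) ->
  FT (fun x => \sum_(i <- r) F i x) xi = \sum_(i <- r) FT (F i) xi.
Proof.
move=> fi; rewrite /FT -cint_sum; last by move=> i; exact: lint_char.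
by apply: eq_cint => x; rewrite mulr_suml.
Qed.

Lemma FT0 f : FT f 0 = cint leb f.
Proof. by apply: eq_cint => x; rewrite fourier_char0 mulr1. Qed.

Lemma Re_FT f xi : complex.Re (FT f xi) =
  trig (fun x => complex.Re (f x)) (fun x => complex.Im (f x)) xi.
Proof.
rewrite /trig/=; apply: eq_Rintegral => x _; rewrite ReM.
by have [-> ->] := ReIm_fourier_char xi x; ring.
Qed.

Lemma Im_FT f xi : complex.Im (FT f xi) =
  trig (fun x => complex.Im (f x)) (fun x => - complex.Re (f x)) xi.
Proof.
rewrite /trig/=; apply: eq_Rintegral => x _; rewrite ImM.
by have [-> ->] := ReIm_fourier_char xi x; ring.
Qed.

Lemma trigN (a b : 'rV[R]_d -> R) xi : trig a b (- xi) = trig a (fun x => - b x) xi.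
Proof.
apply: eq_Rintegral => x _; rewrite dotrNl mulrN cosN sinN; ring.
Qed.

Definition ctest f := test (fun x => complex.Re (f x)) /\
                      test (fun x => complex.Im (f x)).

Definition cbandlimited f := bandlimited (fun x => complex.Re (f x)) /\
                          bandlimited (fun x => complex.Im (f x)).

Lemma cbandlimited_IFT M : ctest M -> cbandlimited (IFT M).
Proof.
move=> [tr ti]; rewrite /IFT; split.
  under eq_fun do rewrite Re_FT trigN.
  by eexists; eexists; split; last by []; last exact: test_opp.
under eq_fun do rewrite Im_FT trigN.
by eexists; eexists; split; last by []; last exact/test_opp/test_opp.
Qed.

Lemma cbandlimited_FT M : ctest M -> cbandlimited (FT M).
Proof.
move=> [tr ti]; split.
  under eq_fun do rewrite Re_FT.
  by eexists; eexists; split; last by [].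
under eq_fun do rewrite Im_FT.
by eexists; eexists; split; last by []; last exact: test_opp.
Qed.

Lemma cbandlimited_lint g : cbandlimited g -> lint g.
Proof. by move=> [gr gi]; split; exact: bandlimited_integrable. Qed.

Lemma cbandlimited_continuous g : cbandlimited g -> ccontinuous g.
Proof. by move=> [gr gi]; split; apply: smooth_continuous; exact: bandlimited_smooth. Qed.

Lemma cbandlimited_bounded g : cbandlimited g -> exists C, forall x, n1 (g x) <= C.
Proof.
move=> [/bandlimited_bounded[A rA] /bandlimited_bounded[B iB]].
by exists (A + B) => x; exact: lerD.
Qed.

Lemma cbandlimited_add f g : cbandlimited f -> cbandlimited g -> cbandlimited (fun x => f x + g x).
Proof.
move=> [fr fi] [gr gi]; split.
  by under eq_fun do rewrite ReD; exact: bandlimited_add.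
by under eq_fun do rewrite ImD; exact: bandlimited_add.
Qed.

Lemma cbandlimitedZ (c : R[i]) g : cbandlimited g -> cbandlimited (fun x => c * g x).
Proof.
move=> [gr gi]; split.
  under eq_fun do rewrite ReM -mulNr.
  by apply: bandlimited_add; exact: bandlimited_scale.
under eq_fun do rewrite ImM.
by apply: bandlimited_add; exact: bandlimited_scale.
Qed.

Lemma ctest_mul (u : 'rV[R]_d -> R[i]) M :
  smooth_on setT (fun x => complex.Re (u x)) ->
  smooth_on setT (fun x => complex.Im (u x)) -> ctest M ->
  ctest (fun x => M x * u x).
Proof.
move=> ur ui [mr mi]; split.
  under eq_fun do rewrite ReM mulrC [X in _ - X]mulrC.
  by apply: test_add; [|apply: test_opp]; exact: test_mul.
under eq_fun do rewrite ImM mulrC [X in _ + X]mulrC.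
by apply: test_add; exact: test_mul.
Qed.

Lemma ctest_lint M : ctest M -> lint M.
Proof.
by move=> [mr mi]; split; [exact: (test_compact_integrable mr).1|
                           exact: (test_compact_integrable mi).1].
Qed.

Lemma ctest_continuous M : ctest M -> ccontinuous M.
Proof. by move=> [mr mi]; split; apply: smooth_continuous; [exact: mr.1|exact: mi.1]. Qed.

Lemma ctest_bounded M : ctest M -> exists C, forall x, n1 (M x) <= C.
Proof.
move=> tM; have [cr ci] := ctest_continuous tM; have [mr mi] := tM.
have [A _ rA] := compact_support_bounded cr mr.2.
have [B _ iB] := compact_support_bounded ci mi.2.
by exists (A + B) => x; exact: lerD.
Qed.

(** Differentiation under the integral sign only brings in coordinates, which are
   bounded on the support of f. *)
Lemma smooth_FT f : compact_integrable (fun x => complex.Re (f x)) ->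
  compact_integrable (fun x => complex.Im (f x)) ->
  smooth_on setT (fun xi => complex.Re (FT f xi)) /\
  smooth_on setT (fun xi => complex.Im (FT f xi)).
Proof.
move=> fr fi; split.
  by under eq_fun do rewrite Re_FT; exact: smooth_trig.
under eq_fun do rewrite Im_FT; apply: smooth_trig => //.
exact: compact_integrable_opp.
Qed.

Lemma cint_affine (a : R) (h : 'rV[R]_d) f : a != 0 -> lint f ->
  cint leb (fun x : borel R d => f (a *: (x : 'rV[R]_d) + h)) =
  (`|a|^-1 ^+ d)%:C * cint leb f.
Proof.
move=> a0 [fr fi]; apply: complex_ext; rewrite ?ReM ?ImM/= !mul0r ?subr0 ?addr0.
  have := integral_affine h a0 fr; rewrite /affine /Rintegral => ->.
  by rewrite fineM//; exact: integrable_fin_num.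
have := integral_affine h a0 fi; rewrite /affine /Rintegral => ->.
by rewrite fineM//; exact: integrable_fin_num.
Qed.

Lemma lint_affine (a : R) (h : 'rV[R]_d) f : a != 0 -> lint f ->
  lint (fun x => f (a *: x + h)).
Proof.
move=> a0 [fr fi]; split.
  exact: (integrable_affine h a0 fr).
exact: (integrable_affine h a0 fi).
Qed.

Lemma FT_scale (a : R) f xi : a != 0 -> lint f ->
  FT (fun x => f (a *: x)) xi = (`|a|^-1 ^+ d)%:C * FT f (a^-1 *: xi).
Proof.
move=> a0 fi; rewrite -(cint_affine 0 a0 (lint_char _ fi)).
apply: eq_cint => x; rewrite addr0; congr (_ * _).
rewrite !fourier_charE; congr (cis (- (_ * _))).
by rewrite dotrZ [in RHS]dotrC dotrZ mulKf// dotrC.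
Qed.

End fourier_transform.

(** * Smooth cutoffs *)

Section cutoff.
Variables (R : realType) (d : nat).
Implicit Types (x : 'rV[R]_d) (t a : R).

Definition step t : R := bump (2 - t) / (bump (2 - t) + bump (t - 1)).

Lemma step_den_gt0 t : 0 < bump (2 - t) + bump (t - 1).
Proof.
have [t2|t2] := ltP t 2; first by rewrite ltr_pwDl ?bump_ge0// bump_gt0 ?subr_gt0.
by rewrite ltr_wpDl ?bump_ge0// bump_gt0// subr_gt0 (lt_le_trans _ t2)// ltr1n.
Qed.

Lemma step1 t : t <= 1 -> step t = 1.
Proof.
move=> t1; rewrite /step (@bump_le0 _ (t - 1)) ?subr_le0// addr0 divff//.
by rewrite gt_eqF// bump_gt0// subr_gt0 (le_lt_trans t1)// ltr1n.
Qed.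

Lemma step0 t : 2 <= t -> step t = 0.
Proof. by move=> t2; rewrite /step bump_le0 ?mul0r// subr_le0. Qed.

Lemma step_ge0 t : 0 <= step t.
Proof. by rewrite divr_ge0 ?bump_ge0// ltW// step_den_gt0. Qed.

Lemma step_le1 t : step t <= 1.
Proof. by rewrite ler_pdivrMr ?step_den_gt0// mul1r lerDl bump_ge0. Qed.

Lemma Cn_step n (U : set 'rV[R]_d) f : open U -> Cn n U f ->
  Cn n U (fun x => step (f x)).
Proof.
move=> oU Cf.
have C1 : Cn n U (fun x => bump (2 - f x)).
  by apply: Cn_bump => //; apply: Cn_add => //; [exact: Cn_cst|exact: Cn_opp].
have C2 : Cn n U (fun x => bump (f x - 1)).
  by apply: Cn_bump => //; apply: Cn_add => //; exact: Cn_cst.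
apply: Cn_mul => //; apply: Cn_inv => //.
  by move=> x Ux; rewrite gt_eqF// step_den_gt0.
exact: Cn_add.
Qed.

Definition normsq x : R := dotr x x.

Lemma Cn_normsq n (U : set 'rV[R]_d) : open U -> Cn n U normsq.
Proof. by move=> oU; apply: Cn_sum => // i _; apply: Cn_mul => //; exact: Cn_coord. Qed.

Lemma normsq_ge x : `|x| ^+ 2 <= normsq x.
Proof.
have sq j : `|x 0 j| ^+ 2 <= normsq x.
  rewrite /normsq /dotr (bigD1 j)//= -expr2 -normrX ger0_norm ?sqr_ge0// lerDl.
  by apply: sumr_ge0 => i _; rewrite -expr2 sqr_ge0.
have n0 : 0 <= normsq x by apply: sumr_ge0 => i _; rewrite -expr2 sqr_ge0.
rewrite -[X in _ <= X](sqr_sqrtr n0) ler_sqr ?nnegrE ?sqrtr_ge0//.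
rewrite [leLHS]/Num.Def.normr/= mx_normrE; apply: bigmax_le => [|[i j] _ /=].
  exact: sqrtr_ge0.
by rewrite ord1 -[leLHS]sqrtr_sqr ler_sqrt// -real_normK ?num_real.
Qed.

Lemma normsqZ a x : normsq (a *: x) = a ^+ 2 * normsq x.
Proof. by rewrite /normsq dotrZ dotrC dotrZ mulrA -expr2. Qed.

(** Equal to 1 for |a x| <= 1 and to 0 for |a x|^2 >= 2, in the Euclidean norm. The
   square of the norm is smooth at the origin, unlike the norm. *)
Definition cutoff a x : R := step (a ^+ 2 * normsq x).

Lemma smooth_cutoff a : smooth_on setT (cutoff a).
Proof.
apply/smooth_onP => n; have oT := @openT 'rV[R]_d.
by apply: Cn_step => //; apply: Cn_mul => //; [exact: Cn_cst|exact: Cn_normsq].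
Qed.

Lemma cutoff_out a x : 2 <= a ^+ 2 * normsq x -> cutoff a x = 0.
Proof. exact: step0. Qed.

Lemma cutoff_in a x : a ^+ 2 * normsq x <= 1 -> cutoff a x = 1.
Proof. exact: step1. Qed.

Lemma test_cutoff a : a != 0 -> test (cutoff a).
Proof.
move=> a0; split; first exact: smooth_cutoff.
exists (2 / `|a|) => x; rewrite ltr_pdivrMr ?normr_gt0// => ax.
apply: cutoff_out; apply: (@le_trans _ _ (2 ^+ 2)); first by rewrite -natrX ler_nat.
apply: (@le_trans _ _ ((`|x| * `|a|) ^+ 2)); first by rewrite ler_sqr ?nnegrE ?mulr_ge0// ltW.
by rewrite exprMn mulrC -normrX (ger0_norm (sqr_ge0 a)) ler_wpM2l ?sqr_ge0// normsq_ge.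
Qed.

Lemma cutoff_ge0 a x : 0 <= cutoff a x. Proof. exact: step_ge0. Qed.
Lemma cutoff_le1 a x : cutoff a x <= 1. Proof. exact: step_le1. Qed.

Lemma cutoff0 a : cutoff a (0 : 'rV[R]_d) = 1.
Proof. by apply: cutoff_in; rewrite -(scale0r 0) normsqZ expr0n/= mul0r mulr0. Qed.

Lemma cutoffE a x : cutoff a x = cutoff 1 (a *: x).
Proof. by rewrite /cutoff expr1n mul1r normsqZ. Qed.

Definition ccutoff a x : R[i] := (cutoff a x)%:C.

Lemma ctest_ccutoff a : a != 0 -> ctest (ccutoff a).
Proof. by move=> a0; split=> /=; [exact: test_cutoff|exact: test0]. Qed.

Lemma n1_ccutoff a x : n1 (ccutoff a x) <= 1.
Proof. by rewrite n1_real ger0_norm ?cutoff_ge0// cutoff_le1. Qed.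

End cutoff.

Section sequential_continuity.
Variables (R : realType) (d : nat).

Lemma ccontinuous_ccvg (f : 'rV[R]_d -> R[i]) (u : nat -> 'rV[R]_d) (x : 'rV[R]_d) :
  ccontinuous f -> u n @[n --> \oo] --> x -> ccvg (fun n => f (u n)) (f x).
Proof.
move=> [fr fi] ux; apply/ccvgP; split.
  exact: (cvg_comp u (fun x => complex.Re (f x)) ux (fr x)).
exact: (cvg_comp u (fun x => complex.Im (f x)) ux (fi x)).
Qed.

Definition inv_seq n : R := n.+1%:R^-1.

Lemma inv_seq_gt0 n : 0 < inv_seq n. Proof. by rewrite invr_gt0. Qed.

Lemma inv_seq_neq0 n : inv_seq n != 0. Proof. by rewrite gt_eqF// inv_seq_gt0. Qed.

Lemma cvg_inv_seq : inv_seq n @[n --> \oo] --> (0 : R).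
Proof.
apply/cvgr0Pnorm_lt => e e0.
have [k _ ke] := near_infty_natSinv_lt (PosNum e0).
exists k => // n /= kn; rewrite ger0_norm ?ltW ?inv_seq_gt0//.
by have := ke n kn.
Qed.

Lemma cvg_inv_seqZ (x : 'rV[R]_d) : inv_seq n *: x @[n --> \oo] --> (0 : 'rV[R]_d).
Proof.
by rewrite -[X in _ --> X](scale0r x); apply: cvgZl; exact: cvg_inv_seq.
Qed.

Lemma cvg_inv_seqZD (x y : 'rV[R]_d) : x + inv_seq n *: y @[n --> \oo] --> x.
Proof.
rewrite -[X in _ --> X]addr0; apply: cvgD; first exact: cvg_cst.
exact: cvg_inv_seqZ.
Qed.

End sequential_continuity.

(** * Fourier inversion for test functions *)

Section fourier_inversion.
Variables (R : realType) (d : nat).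
Local Notation leb := (lebesgue_rV R d).
Implicit Types (f g M : 'rV[R]_d -> R[i]) (xi x y : 'rV[R]_d).

Lemma cmeasurable_fst f : cmeasurable (f : borel R d -> R[i]) ->
  cmeasurable (fun z : borel R d * borel R d => f z.1).
Proof.
by move=> [mr mi]; split; [exact: measurableT_comp mr measurable_fst|
                           exact: measurableT_comp mi measurable_fst].
Qed.

Lemma cmeasurable_snd f : cmeasurable (f : borel R d -> R[i]) ->
  cmeasurable (fun z : borel R d * borel R d => f z.2).
Proof.
by move=> [mr mi]; split; [exact: measurableT_comp mr measurable_snd|
                           exact: measurableT_comp mi measurable_snd].
Qed.

Lemma measurable_lincomb (a b : R) : measurable_fun setT
  (fun z : borel R d * borel R d => a *: (z.1 : 'rV[R]_d) + b *: (z.2 : 'rV[R]_d) : borel R d).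
Proof.
apply: measurable_coordP => j; under eq_fun do rewrite !mxE.
apply: measurable_funD; apply: measurable_funM => //.
  exact: measurableT_comp (measurable_coord_borel j) measurable_fst.
exact: measurableT_comp (measurable_coord_borel j) measurable_snd.
Qed.

Lemma cmeasurable_lincomb (a b : R) f : cmeasurable (f : borel R d -> R[i]) ->
  cmeasurable (fun z : borel R d * borel R d => f (a *: (z.1 : 'rV[R]_d) + b *: (z.2 : 'rV[R]_d))).
Proof.
move=> [mr mi]; have ml := measurable_lincomb a b.
by split; [exact: measurableT_comp mr ml|exact: measurableT_comp mi ml].
Qed.

Lemma cmeasurable_fourier_char2 :
  cmeasurable (fun z : borel R d * borel R d => fourier_char (z.1 : 'rV[R]_d) z.2).
Proof.
have mdot : measurable_fun setT
    (fun z : borel R d * borel R d => 2 * pi * dotr (z.1 : 'rV[R]_d) z.2).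
  apply: measurable_funM => //; apply: measurable_sum => j.
  apply: measurable_funM.
    exact: measurableT_comp (measurable_coord_borel j) measurable_fst.
  exact: measurableT_comp (measurable_coord_borel j) measurable_snd.
split.
  under eq_fun do rewrite (ReIm_fourier_char _ _).1.
  apply: (measurableT_comp (f := cos)) => //.
  by apply: continuous_measurable_fun; exact: continuous_cos.
under eq_fun do rewrite (ReIm_fourier_char _ _).2.
apply: measurable_funN; apply: (measurableT_comp (f := sin)) => //.
by apply: continuous_measurable_fun; exact: continuous_sin.
Qed.

Lemma cintegrable_prodM (f g : 'rV[R]_d -> R[i])
    (u : borel R d * borel R d -> R[i]) (C : R) :
  lint f -> lint g -> cmeasurable u -> (forall z, n1 (u z) <= C) ->
  cintegrable (leb \x leb)%E (fun z => f z.1 * g z.2 * u z).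
Proof.
move=> fi gi mu uC.
have mf := cmeasurable_fst (cintegrable_meas fi).
have mg := cmeasurable_snd (cintegrable_meas gi).
apply: (@le_cintegrable _ _ _ _ _
    (fun z : borel R d * borel R d => C * (n1 (f z.1) * n1 (g z.2)))).
- by apply: cmeasurable_mul => //; exact: cmeasurable_mul.
- move=> z; rewrite mulrC; apply: le_trans (n1M _ _) _.
  by apply: ler_pM; rewrite ?n1_ge0 ?n1M ?uC.
- under eq_fun do rewrite EFinM; apply: integrableZl => //.
  exact: (integrable_prodM (a := fun x : borel R d => n1 (f x))
    (b := fun x : borel R d => n1 (g x)) (cintegrable_n1 fi) (cintegrable_n1 gi)).
Qed.

(** Both sides integrate f(x) g(y) exp(-2 pi i <x, y>) over the product space;
   Fubini exchanges the two integrations. *)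
Lemma FT_exchange_spec f g : lint f -> lint g ->
  lint (fun x => f x * FT g x) /\
  cint leb (fun x => f x * FT g x) = cint leb (fun y => g y * FT f y).
Proof.
move=> fi gi.
pose F (z : borel R d * borel R d) := f z.1 * g z.2 * fourier_char (z.1 : 'rV[R]_d) z.2.
have FI : cintegrable (leb \x leb)%E F.
  apply: (cintegrable_prodM (C := 2)) => //; first exact: cmeasurable_fourier_char2.
  by move=> z; exact: n1_fourier_char.
have F2 x : lint (fun y => F (x, y)).
  rewrite /F/=; under eq_fun do rewrite -mulrA.
  by apply: cintegrableZ; exact: lint_char.
have F1 y : lint (fun x => F (x, y)).
  rewrite /F/=; under eq_fun do rewrite mulrAC mulrC fourier_charC.
  by apply: cintegrableZ; exact: lint_char.
have E x : f x * FT g x = cint leb (fun y => F (x, y)).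
  rewrite -cintZ; last exact: lint_char.
  by apply: eq_cint => y; rewrite /F/= mulrA.
have -> : (fun x => f x * FT g x) = (fun x => cint leb (fun y => F (x, y))).
  exact/funext.
split; first exact: (cintegrable_cint2 FI F2).
rewrite (cint_Fubini FI F2 F1); apply: eq_cint => y.
rewrite -cintZ; last exact: lint_char.
by apply: eq_cint => x; rewrite /F/= fourier_charC mulrAC mulrC mulrA.
Qed.

Lemma FT_exchange f g : lint f -> lint g ->
  cint leb (fun x => f x * FT g x) = cint leb (fun y => g y * FT f y).
Proof. by move=> fi gi; have [_ ->] := FT_exchange_spec fi gi. Qed.

Lemma lint_mul_FT f g : lint f -> lint g -> lint (fun x => f x * FT g x).
Proof. by move=> fi gi; have [] := FT_exchange_spec fi gi. Qed.

Lemma IFTE f x : lint f -> IFT f x = FT (fun y => f (- y)) x.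
Proof.
move=> fi; have n1n0 : -1 != 0 :> R by rewrite oppr_eq0 oner_neq0.
have := FT_scale x n1n0 fi.
under [in LHS]eq_fun do rewrite scaleN1r.
by move=> ->; rewrite normrN normr1 invr1 expr1n mul1r invrN invr1 scaleN1r.
Qed.

Lemma lint_opp f : lint f -> lint (fun x => f (- x)).
Proof.
move=> fi; have n1n0 : -1 != 0 :> R by rewrite oppr_eq0 oner_neq0.
have := lint_affine 0 n1n0 fi.
by under eq_fun do rewrite scaleN1r addr0.
Qed.

Lemma cint_opp f : lint f -> cint leb (fun x : borel R d => f (- (x : 'rV[R]_d))) = cint leb f.
Proof.
move=> fi; have n1n0 : -1 != 0 :> R by rewrite oppr_eq0 oner_neq0.
have := cint_affine 0 n1n0 fi; rewrite normrN normr1 invr1 expr1n mul1r => <-.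
by apply: eq_cint => x; rewrite scaleN1r addr0.
Qed.

Lemma lint_mul_bounded f g (C : R) : lint f -> cmeasurable (g : borel R d -> R[i]) ->
  (forall x, n1 (g x) <= C) -> lint (fun x => f x * g x).
Proof.
move=> fi mg gC; rewrite /lint; under eq_fun do rewrite mulrC.
exact: (cintegrable_mul mg gC fi).
Qed.

(** The multiplication formula [FT_exchange] after the reflection y |-> -y. *)
Lemma IFT_exchange f g : lint f -> lint g ->
  lint (fun y => g y * IFT f y) ->
  cint leb (fun x => f x * IFT g x) = cint leb (fun y => g y * IFT f y).
Proof.
move=> fi gi gFi.
transitivity (cint leb (fun x => f x * FT (fun y => g (- y)) x)).
  by apply: eq_cint => x; rewrite IFTE.
transitivity (cint leb (fun y => g (- y) * FT f y)).
  exact: FT_exchange fi (lint_opp gi).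
rewrite -(cint_opp gFi).
by apply: eq_cint => y; rewrite /IFT opprK.
Qed.

Local Notation theta := (@ccutoff R d 1).

Let ttheta : ctest theta. Proof. by apply: ctest_ccutoff; exact: oner_neq0. Qed.

(** The constant of the inversion formula, written before the formula is known; its
   value is theta(0) = 1. *)
Definition inv_cst : R[i] := cint leb (FT theta).

(** With the factor theta(a x) the iterated integral converges absolutely, so the
   multiplication formula applies; the transform of the factor is then rescaled by
   the substitution eta = xi - a u. *)
Lemma IFT_regularized M xi (a : R) : ctest M -> a != 0 ->
  cint leb (fun x => IFT M x * fourier_char xi x * ccutoff a x) =
  cint leb (fun u : borel R d => M (xi + - a *: (u : 'rV[R]_d)) * FT theta u).
Proof.
move=> tM a0; have Mi := ctest_lint tM.
have Pi := cbandlimited_lint (cbandlimited_FT ttheta).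
have ti : lint (@ccutoff R d a) by apply: ctest_lint; exact: ctest_ccutoff.
pose g x := fourier_char xi x * ccutoff a x.
have gi : lint g.
  by rewrite /g; under eq_fun do rewrite mulrC; exact: lint_char.
have gE eta : IFT g eta = FT (ccutoff a) (xi - eta).
  by apply: eq_cint => x; rewrite /g fourier_charD; ring.
have PE zeta : FT (ccutoff a) zeta = (`|a|^-1 ^+ d)%:C * FT theta (a^-1 *: zeta).
  rewrite -(FT_scale zeta a0 (ctest_lint ttheta)).
  have -> : ccutoff a = (fun x => theta (a *: x)).
    by apply/funext => x; rewrite /ccutoff [in LHS]cutoffE.
  by [].
have aN0 : - a != 0 by rewrite oppr_eq0.
have PMi : lint (fun eta => M eta * FT theta (a^-1 *: (xi - eta))).
  have [B PB] := cbandlimited_bounded (cbandlimited_FT ttheta).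
  apply: (@lint_mul_bounded _ _ B Mi _ (fun eta => PB _)).
  have ieN : - a^-1 != 0 by rewrite oppr_eq0 invr_eq0.
  have := cintegrable_meas (lint_affine (a^-1 *: xi) ieN Pi).
  by under eq_fun do rewrite scaleNr addrC -scalerBr.
have ME : (fun y => M y * IFT g y) = (fun eta => (`|a|^-1 ^+ d)%:C *
      (M eta * FT theta (a^-1 *: (xi - eta)))).
  by apply/funext => eta; rewrite gE PE mulrCA.
transitivity (cint leb (fun x => g x * IFT M x)).
  by apply: eq_cint => x; rewrite /g; ring.
rewrite (IFT_exchange gi Mi); last by rewrite ME; exact: cintegrableZ.
rewrite ME cintZ// -(normrN a) -(cint_affine xi aN0 PMi).
apply: eq_cint => u; rewrite [_ + xi]addrC; congr (_ * FT _ _).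
by rewrite opprD addNKr scaleNr opprK scalerA mulVf// scale1r.
Qed.

(** Both sides of [IFT_regularized] converge as a tends to 0: the left one to the
   transform of IFT M, the right one to M(xi) times the integral of FT theta. *)
Lemma FT_IFT M xi : ctest M -> FT (IFT M) xi = inv_cst * M xi.
Proof.
move=> tM; have Mi := ctest_lint tM; have Gi := cbandlimited_lint (cbandlimited_IFT tM).
have [C MC] := ctest_bounded tM.
have Pi := cbandlimited_lint (cbandlimited_FT ttheta).
pose e n : R := inv_seq R n.
pose I n := cint leb (fun x => IFT M x * fourier_char xi x * ccutoff (e n) x).
have cutoff_cvg x : ccvg (fun n => ccutoff (e n) x) 1.
  have := ccontinuous_ccvg (ctest_continuous ttheta) (cvg_inv_seqZ x).
  by rewrite [X in ccvg _ X]/ccutoff cutoff0; under eq_fun do rewrite /ccutoff -cutoffE.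
have I1 : ccvg I (FT (IFT M) xi).
  apply: (@cint_dominated _ _ _ leb _ _ (fun x => n1 (IFT M x * fourier_char xi x))).
  - move=> n; apply: cmeasurable_mul; first exact: cintegrable_meas (lint_char xi Gi).
    apply: ccontinuous_measurable; apply: ctest_continuous.
    by apply: ctest_ccutoff; exact: inv_seq_neq0.
  - move=> x; rewrite -[X in ccvg _ X]mulr1; apply: ccvgM; [exact: ccvg_cst|exact: cutoff_cvg].
  - by apply: cintegrable_n1; exact: lint_char.
  - move=> n x; apply: le_trans (n1M _ _) _.
    by rewrite ler_piMr ?n1_ge0// n1_ccutoff.
have I2 : ccvg I (inv_cst * M xi).
  rewrite (_ : I = fun n => cint leb (fun u => M (xi + - e n *: u) * FT theta u)); last first.
    by apply/funext => n; apply: IFT_regularized => //; exact: inv_seq_neq0.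
  rewrite mulrC -cintZ//.
  apply: (@cint_dominated _ _ _ leb _ _ (fun u => C * n1 (FT theta u))).
  - move=> n; apply: cmeasurable_mul; last exact: cintegrable_meas Pi.
    have := (cintegrable_meas (lint_affine xi (a := - e n) _ Mi)).
    under eq_fun do rewrite addrC.
    by apply; rewrite oppr_eq0 inv_seq_neq0.
  - move=> u; apply: ccvgM; last exact: ccvg_cst.
    have := ccontinuous_ccvg (ctest_continuous tM) (@cvg_inv_seqZD R d xi (- u)).
    by under eq_fun do rewrite scalerN -scaleNr.
  - by under eq_fun do rewrite EFinM; apply: integrableZl => //; exact: cintegrable_n1.
  - by move=> n u; apply: le_trans (n1M _ _) _; rewrite ler_wpM2r ?n1_ge0.
exact: ccvg_unique I1 I2.
Qed.

(** If g(x) > 0 then g exceeds g(x)/2 on a nonempty open set, which has positive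
   measure. *)
Lemma continuous_integral0 (g : 'rV[R]_d -> R) : continuous g ->
  (forall x, 0 <= g x) -> rintegrable g -> (\int[leb]_x g x)%R = 0 ->
  forall x, g x = 0.
Proof.
move=> cg g0 gi ig0 x; apply/eqP; rewrite eq_le g0 andbT leNgt; apply/negP => gx.
pose U := [set y | g x / 2 < g y].
have oU : open U.
  rewrite (_ : U = g @^-1` [set t | g x / 2 < t])//.
  by apply: open_comp => [y _|]; [exact: cg|exact: open_gt].
have U0 : U !=set0.
  by exists x; rewrite /U/= ltr_pdivrMr// ltr_pMr// ltr1n.
have mU := measurable_open oU.
have := lebesgue_open_gt0 oU U0; apply/negP; rewrite -leNgt.
have gx2 : (0 < (g x / 2)%:E)%E by rewrite lte_fin divr_gt0.
rewrite -(pmule_rle0 (leb U) gx2) -integral_cst//.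
have mg := integrable_measurable gi.
apply: (@le_trans _ _ (\int[leb]_(y in U) (g y)%:E)%E).
  apply: ge0_le_integral => //.
  - by move=> y _; rewrite lee_fin divr_ge0.
  - exact/measurable_EFinP/measurable_funTS.
  - by move=> y Uy; rewrite lee_fin ltW.
apply: (@le_trans _ _ (\int[leb]_y (g y)%:E)%E).
  apply: ge0_subset_integral => //; first exact/measurable_EFinP.
  by move=> y _; rewrite lee_fin.
by rewrite -(fineK (integrable_fin_num measurableT gi)) -/(Rintegral _ _ _) ig0.
Qed.

(** As theta is real, IFT theta is the conjugate of FT theta, so that by the
   multiplication formula int |FT theta|^2 = int theta FT(IFT theta), which is
   [inv_cst] times int theta^2. If [inv_cst] were 0, the continuous function
   FT theta would vanish; but its value at 0 is int theta > 0. *)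
Lemma inv_cst_neq0 : inv_cst != 0.
Proof.
apply/negP => /eqP c0.
have ti := ctest_lint ttheta; have Pi := cbandlimited_lint (cbandlimited_FT ttheta).
have Gi := cbandlimited_lint (cbandlimited_IFT ttheta).
pose p x := complex.Re (FT theta x); pose q x := complex.Im (FT theta x).
have GE x : IFT theta x * FT theta x = (p x * p x + q x * q x)%:C.
  have rG : complex.Re (IFT theta x) = p x.
    rewrite /IFT /p !Re_FT trigN; congr trig; apply/funext => y.
    by rewrite /ccutoff/= oppr0.
  have iG : complex.Im (IFT theta x) = - q x.
    rewrite /IFT /q !Im_FT trigN /trig/= -mulN1r -RintegralZl//.
      by apply: eq_Rintegral => y _; rewrite !mul0r; ring.
    apply: integrable_trig; first exact: ti.2.
    by have [] := cintegrable_opp ti; under eq_fun do rewrite ReN.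
  move: rG iG; rewrite /p /q; case: (IFT theta x) => a b; case: (FT theta x) => c e.
  by move=> /= -> ->; apply: complex_ext => /=; ring.
have GPi : lint (fun x => IFT theta x * FT theta x).
  have [B PB] := cbandlimited_bounded (cbandlimited_FT ttheta).
  exact: (lint_mul_bounded Gi (cintegrable_meas Pi) PB).
have pc := cbandlimited_continuous (cbandlimited_FT ttheta).
have int0 : (\int[leb]_x (p x * p x + q x * q x))%R = 0.
  transitivity (complex.Re (cint leb (fun x => IFT theta x * FT theta x))).
    by apply: eq_Rintegral => x _; rewrite GE.
  rewrite (FT_exchange Gi ti) (_ : (fun y => _) = (fun=> 0)).
    by rewrite /= Rintegral_cst// mul0r.
  by apply/funext => y; rewrite FT_IFT// c0 mul0r mulr0.
have pq0 : p 0 * p 0 + q 0 * q 0 = 0.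
  apply: (@continuous_integral0 (fun x => p x * p x + q x * q x)) => //.
  - move=> x; exact: (continuousD (continuousM (pc.1 x) (pc.1 x))
                                 (continuousM (pc.2 x) (pc.2 x))).
  - by move=> x; rewrite addr_ge0// -expr2 sqr_ge0.
  - by have := GPi.1; under eq_fun do rewrite GE.
have p0 : (\int[leb]_x (cutoff 1 x : R))%R = 0.
  have : p 0 ^+ 2 = 0.
    by move/eqP: pq0; rewrite -!expr2 paddr_eq0 ?sqr_ge0// => /andP[/eqP].
  by move/eqP; rewrite sqrf_eq0 /p FT0 => /eqP.
have := @continuous_integral0 (cutoff 1) (ctest_continuous ttheta).1
  (cutoff_ge0 1) ti.1 p0 0.
by rewrite cutoff0 => /eqP; rewrite oner_eq0.
Qed.

(** The convolution kernel of the Fourier multiplier M. *)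
Definition multiplier_kernel M x : R[i] := inv_cst^-1 * IFT M x.

Lemma cbandlimited_multiplier_kernel M : ctest M -> cbandlimited (multiplier_kernel M).
Proof. by move=> tM; apply: cbandlimitedZ; exact: cbandlimited_IFT. Qed.

Lemma FT_multiplier_kernel M xi : ctest M -> FT (multiplier_kernel M) xi = M xi.
Proof.
move=> tM; rewrite FTZ; last exact/cbandlimited_lint/cbandlimited_IFT.
by rewrite FT_IFT// mulKf// inv_cst_neq0.
Qed.

(** Approximate identity of integral 1, concentrated at scale a by [kernelE]. *)
Definition kernel (a : R) : 'rV[R]_d -> R[i] := multiplier_kernel (ccutoff a).

Lemma cbandlimited_kernel a : a != 0 -> cbandlimited (kernel a).
Proof. by move=> a0; exact: (cbandlimited_multiplier_kernel (@ctest_ccutoff R d a a0)). Qed.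

Lemma FT_kernel a xi : a != 0 -> FT (kernel a) xi = ccutoff a xi.
Proof. by move=> a0; exact: (FT_multiplier_kernel xi (@ctest_ccutoff R d a a0)). Qed.

Lemma IFT_scale (a : R) M x : a != 0 -> lint M ->
  IFT (fun y => M (a *: y)) x = (`|a|^-1 ^+ d)%:C * IFT M (a^-1 *: x).
Proof. by move=> a0 Mi; rewrite /IFT FT_scale// scalerN. Qed.

Lemma kernelE a x : a != 0 ->
  kernel a x = (`|a|^-1 ^+ d)%:C * kernel 1 (a^-1 *: x).
Proof.
move=> a0; rewrite /kernel /multiplier_kernel mulrCA -(IFT_scale x a0 (ctest_lint ttheta)).
have -> : ccutoff a = (fun x => theta (a *: x)).
  by apply/funext => y; rewrite /ccutoff [in LHS]cutoffE.
by [].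
Qed.

(** Up to a character the kernel IFT M (x - y) is the transform in y of M, so the
   multiplication formula moves the transform to f. *)
Lemma convolution_multiplier M f x : ctest M -> lint f ->
  cint leb (fun y => IFT M (x - y) * f y) = IFT (fun eta => M eta * FT f eta) x.
Proof.
move=> tM fi; have Mi := ctest_lint tM.
pose N eta := M eta * fourier_char (- x) eta.
have Ni : lint N by exact: lint_char.
transitivity (cint leb (fun y => f y * FT N y)).
  apply: eq_cint => y; rewrite mulrC; congr (_ * _); rewrite /IFT opprB.
  by apply: eq_cint => eta; rewrite /N fourier_charD; ring.
rewrite (FT_exchange fi Ni); apply: eq_cint => eta.
by rewrite /N mulrAC.
Qed.

End fourier_inversion.

(** * Approximate identities *)

Section minkowski.
Context d1 d2 (T1 : measurableType d1) (T2 : measurableType d2) (R : realType).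
Variable m1 : {sigma_finite_measure set T1 -> \bar R}.
Variable m2 : {sigma_finite_measure set T2 -> \bar R}.

(** The criterion of Tonelli, with a bound h for the inner integral. *)
Lemma cintegrable_section (F : T1 * T2 -> R[i]) (h : T2 -> R) : cmeasurable F ->
  (forall y, cintegrable m1 (fun x => F (x, y))) ->
  m2.-integrable setT (fun y => (h y)%:E) ->
  (forall y, (\int[m1]_x n1 (F (x, y)))%R <= h y) ->
  cintegrable (m1 \x m2)%E F.
Proof.
move=> mF F1 hi Fh; have mn := measurable_n1 mF.
suff H : (m1 \x m2)%E.-integrable setT (fun z => (n1 (F z))%:E).
  by apply: (le_cintegrable mF _ H) => z.
apply/integrable21ltyP; first exact/measurable_EFinP.
apply: (@le_lt_trans _ _ (\int[m2]_y `|(h y)%:E|)%E); last first.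
  by have /integrableP[] := hi.
have mh := integrable_measurable hi.
apply: ge0_le_integral => //.
- by move=> y _; apply: integral_ge0.
- apply: (@measurable_fun_fubini_tonelli_G _ _ _ _ _ m1 (fun z => `|(n1 (F z))%:E|%E)) => //.
  by apply: measurableT_comp => //; exact/measurable_EFinP.
- by apply: measurableT_comp => //; exact/measurable_EFinP.
move=> y _; under eq_integral do rewrite gee0_abs ?lee_fin ?n1_ge0//.
have Fi := cintegrable_n1 (F1 y).
rewrite -(fineK (integrable_fin_num measurableT Fi)) lee_fin.
by apply: le_trans (Fh y) _; exact: ler_norm.
Qed.

(** The L^1 case of the integral inequality of Minkowski: Fubini after the triangle
   inequality. *)
Lemma minkowski (F : T1 * T2 -> R[i]) (h : T2 -> R) : cmeasurable F ->
  (forall x, cintegrable m2 (fun y => F (x, y))) ->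
  (forall y, cintegrable m1 (fun x => F (x, y))) ->
  m2.-integrable setT (fun y => (h y)%:E) ->
  (forall y, (\int[m1]_x n1 (F (x, y)))%R <= h y) ->
  (\int[m1]_x n1 (cint m2 (fun y => F (x, y))))%R <= (\int[m2]_y h y)%R.
Proof.
move=> mF F2 F1 hi Fh.
have FI := cintegrable_section mF F1 hi Fh.
have nI := cintegrable_n1 FI.
have n2 x := cintegrable_n1 (F2 x); have n1' y := cintegrable_n1 (F1 y).
apply: (@le_trans _ _ (\int[m1]_x (\int[m2]_y n1 (F (x, y))))%R).
  apply: le_Rintegral => //.
  - exact/cintegrable_n1/cintegrable_cint2.
  - exact: (integrable_Rintegral2 nI n2).
  - by move=> x _; exact: n1_cint_le.
rewrite (Rintegral_Fubini nI n2 n1'); apply: le_Rintegral => //.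
have G0 y : 0 <= (\int[m1]_x n1 (F (x, y)))%R.
  by apply: Rintegral_ge0 => x _; exact: n1_ge0.
apply: (le_integrable measurableT _ _ hi).
  apply/measurable_EFinP; apply: (measurableT_comp (fine_measurable measurableT)).
  apply: (@measurable_fun_fubini_tonelli_G _ _ _ _ _ m1 (fun z => (n1 (F z))%:E)).
    exact/measurable_EFinP/measurable_n1.
  by move=> z; rewrite lee_fin n1_ge0.
by move=> y _ /=; rewrite lee_fin ger0_norm//; apply: le_trans (Fh y) (ler_norm _).
Qed.

End minkowski.

Section approximate_identity.
Variables (R : realType) (d : nat).
Local Notation leb := (lebesgue_rV R d).
Implicit Types (f g K : 'rV[R]_d -> R[i]) (x y h : 'rV[R]_d).

Definition cL1 f : R := (\int[leb]_x n1 (f x))%R.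

Definition cmodulus f h : R := cL1 (fun x => f (x + h) - f x).

Lemma cL1_ge0 f : 0 <= cL1 f.
Proof. by apply: Rintegral_ge0 => x _; exact: n1_ge0. Qed.

Lemma cmodulus_ge0 f h : 0 <= cmodulus f h. Proof. exact: cL1_ge0. Qed.

Lemma cL1D f g : lint f -> lint g -> cL1 (fun x => f x + g x) <= cL1 f + cL1 g.
Proof.
move=> fi gi; have nf := cintegrable_n1 fi; have ng := cintegrable_n1 gi.
rewrite /cL1 -RintegralD//; apply: le_Rintegral => //.
- exact/cintegrable_n1/cintegrable_add.
- by under [X in integrable _ _ X]eq_fun do rewrite EFinD; exact: integrableD.
- by move=> x _; exact: n1D.
Qed.

Lemma cL1N f : cL1 (fun x => - f x) = cL1 f.
Proof. by apply: eq_Rintegral => x _; rewrite n1N. Qed.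

Lemma cL1B f g : lint f -> lint g -> cL1 (fun x => f x - g x) <= cL1 f + cL1 g.
Proof.
by move=> fi gi; rewrite -(cL1N g); apply: cL1D => //; exact: cintegrable_opp.
Qed.

Lemma cL1_sum (I : Type) (r : seq I) (F : I -> 'rV[R]_d -> R[i]) :
  (forall i, lint (F i)) ->
  cL1 (fun x => \sum_(i <- r) F i x) <= \sum_(i <- r) cL1 (F i).
Proof.
move=> Fi; elim: r => [|i r IH].
  rewrite big_nil /cL1; under eq_Rintegral do rewrite big_nil n1_0.
  by rewrite Rintegral_cst// mul0r.
rewrite big_cons /cL1; under eq_Rintegral do rewrite big_cons.
by apply: le_trans (cL1D (Fi i) (cintegrable_sum r Fi)) _; rewrite lerD2l.
Qed.

Lemma lint_shift f h : lint f -> lint (fun x => f (x + h)).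
Proof.
move=> fi; have := lint_affine h (oner_neq0 _) fi.
by under eq_fun do rewrite scale1r.
Qed.

Lemma lint_translate_sub f h : lint f -> lint (fun x => f (x + h) - f x).
Proof. by move=> fi; exact: (cintegrable_sub (lint_shift h fi) fi). Qed.

Lemma Rintegral_affine (a : R) h (g : 'rV[R]_d -> R) : a != 0 -> rintegrable g ->
  (\int[leb]_x g (a *: (x : 'rV[R]_d) + h))%R = `|a|^-1 ^+ d * (\int[leb]_x g x)%R.
Proof.
move=> a0 gi; have := integral_affine h a0 gi; rewrite /affine /Rintegral => ->.
by rewrite fineM//; exact: integrable_fin_num.
Qed.

Lemma cL1_shift f h : lint f -> cL1 (fun x => f (x + h)) = cL1 f.
Proof. by move=> fi; exact: (integral_shift h (cintegrable_n1 fi)). Qed.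

Lemma cmodulus_le f h : lint f -> cmodulus f h <= 2 * cL1 f.
Proof.
move=> fi; apply: le_trans (cL1B (lint_shift h fi) fi) _.
by rewrite cL1_shift// mulr_natl mulr2n.
Qed.

Lemma cmodulus_cvg f (hn : nat -> 'rV[R]_d) : lint f ->
  hn n @[n --> \oo] --> (0 : 'rV[R]_d) -> cmodulus f (hn n) @[n --> \oo] --> (0 : R).
Proof.
move=> [fr fi] h0.
have [_ cr] := rintegrable_shift_continuous fr.
have [_ ci] := rintegrable_shift_continuous fi.
have E n : cmodulus f (hn n) = modulus (fun x => complex.Re (f x)) (hn n) +
                               modulus (fun x => complex.Im (f x)) (hn n).
  rewrite /modulus -RintegralD//; [|exact: rintegrable_modulus..].
  by apply: eq_Rintegral => x _; rewrite /n1 ReD ImD ReN ImN.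
under eq_fun do rewrite E.
by rewrite -[0 : R]addr0; apply: cvgD; [exact: cr|exact: ci].
Qed.

(** An average of the L^1 modulus of continuity of g; such averages bound the errors
   of the approximate identity in [convol_kernel_near] and [convol_kernel_far]. *)
Definition smear f g (b : R) : R := (\int[leb]_u (n1 (f u) * cmodulus g (b *: u)))%R.

Lemma measurable_cmodulus g (b : R) : lint g ->
  measurable_fun setT (fun u : borel R d => cmodulus g (b *: (u : 'rV[R]_d))).
Proof.
move=> gi; have mg := cintegrable_meas gi.
pose F (z : borel R d * borel R d) :=
  `|(n1 (g (1 *: (z.1 : 'rV[R]_d) + b *: (z.2 : 'rV[R]_d)) - g z.1))%:E|%E.
have mF : measurable_fun setT F.
  apply: measurableT_comp => //; apply/measurable_EFinP; apply: measurable_n1.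
  apply: cmeasurable_add; first exact: cmeasurable_lincomb.
  exact/cmeasurable_opp/cmeasurable_fst.
have mG := @measurable_fun_fubini_tonelli_G _ _ _ _ _ leb _ mF (fun z => abse_ge0 _).
have -> : (fun u : borel R d => cmodulus g (b *: (u : 'rV[R]_d))) =
    fine \o fubini_G leb F.
  apply/funext => u; rewrite /cmodulus /cL1 /Rintegral /fubini_G/=; congr fine.
  by apply: eq_integral => x _; rewrite /F/= scale1r ger0_norm ?n1_ge0.
by apply: measurableT_comp.
Qed.

Lemma rintegrable_smear f g (b : R) : lint f -> lint g ->
  rintegrable (fun u => n1 (f u) * cmodulus g (b *: u)).
Proof.
move=> fi gi.
apply: (@le_integrable _ _ _ _ _ measurableT _
  (fun u : borel R d => (2 * cL1 g)%:E * (n1 (f u))%:E)%E).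
- apply/measurable_EFinP; apply: measurable_funM; last exact: measurable_cmodulus.
  exact: measurable_n1 (cintegrable_meas fi).
- move=> u _ /=; rewrite lee_fin !ger0_norm ?mulr_ge0 ?n1_ge0 ?cL1_ge0 ?cmodulus_ge0//.
  by rewrite mulrC ler_wpM2r ?n1_ge0// cmodulus_le.
- by apply: integrableZl => //; exact: cintegrable_n1.
Qed.

(** The modulus of continuity tends to 0 and is bounded by twice the L^1 norm. *)
Lemma smear_cvg f g (bn : nat -> R) : lint f -> lint g ->
  bn n @[n --> \oo] --> (0 : R) -> smear f g (bn n) @[n --> \oo] --> (0 : R).
Proof.
move=> fi gi b0.
have -> : (0 : R) = (\int[leb]_u (cst 0 u : R))%R by rewrite Rintegral_cst// mul0r.
apply: (@dominated_cvgR _ _ _ leb (fun n u => n1 (f u) * cmodulus g (bn n *: u))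
  (cst 0) (fun u => 2 * cL1 g * n1 (f u))).
- move=> n; exact: integrable_measurable (rintegrable_smear (bn n) fi gi).
- move=> u; rewrite /cst -(mulr0 (n1 (f u))); apply: cvgMr.
  apply: cmodulus_cvg => //; rewrite -[X in _ --> X](scale0r (u : 'rV[R]_d)).
  by apply: cvgZl.
- by apply: rintegrableZ; exact: cintegrable_n1.
- move=> n u; rewrite ger0_norm ?mulr_ge0 ?n1_ge0 ?cmodulus_ge0//.
  by rewrite mulrC ler_wpM2r ?n1_ge0// cmodulus_le.
Qed.

Lemma cmeasurable_sub_conv K f : ccontinuous K -> lint f ->
  cmeasurable (fun z : borel R d * borel R d => K ((z.1 : 'rV[R]_d) - z.2) * f z.2).
Proof.
move=> cK fi; apply: cmeasurable_mul; last exact: (cmeasurable_snd (cintegrable_meas fi)).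
have := cmeasurable_lincomb 1 (-1) (ccontinuous_measurable cK).
by under eq_fun do rewrite scale1r scaleN1r.
Qed.

Lemma lint_reflect K x : lint K -> lint (fun y => K (x - y)).
Proof.
move=> Ki; have n1n0 : -1 != 0 :> R by rewrite oppr_eq0 oner_neq0.
have := lint_affine x n1n0 Ki.
by under eq_fun do rewrite scaleN1r addrC.
Qed.

Definition convol K f x : R[i] := cint leb (fun y => K (x - y) * f y).

Lemma lint_convol_section K f x : cbandlimited K -> lint f -> lint (fun y => K (x - y) * f y).
Proof.
move=> sK fi; have [B KB] := cbandlimited_bounded sK.
have := cintegrable_meas (lint_reflect x (cbandlimited_lint sK)) => mK.
exact: (cintegrable_mul mK (fun y => KB _) fi).
Qed.

Lemma lint_convol_section2 K f y : lint K -> lint (fun x => K (x - y) * f y).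
Proof.
move=> Ki; under eq_fun do rewrite mulrC; apply: cintegrableZ.
exact: lint_shift.
Qed.

Lemma convol_sectionE K f y : lint K ->
  (\int[leb]_x n1 (K ((x : 'rV[R]_d) - y) * f y))%R <= cL1 K * n1 (f y).
Proof.
move=> Ki; rewrite -(cL1_shift (- y) Ki) -RintegralZr//; last first.
  exact/cintegrable_n1/lint_shift.
apply: le_Rintegral => //; first exact/cintegrable_n1/lint_convol_section2.
  under [X in integrable _ _ X]eq_fun do rewrite mulrC EFinM.
  by apply: integrableZl => //; exact/cintegrable_n1/lint_shift.
by move=> x _; exact: n1M.
Qed.

Lemma cL1_convol K f : cbandlimited K -> lint f -> cL1 (convol K f) <= cL1 K * cL1 f.
Proof.
move=> sK fi; have Ki := cbandlimited_lint sK.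
rewrite /cL1 -RintegralZl//; last exact: cintegrable_n1.
apply: (minkowski (F := fun z : borel R d * borel R d => K ((z.1 : 'rV[R]_d) - z.2) * f z.2)).
- exact: (cmeasurable_sub_conv (cbandlimited_continuous sK) fi).
- by move=> x; exact: lint_convol_section.
- by move=> y; exact: lint_convol_section2.
- by apply: rintegrableZ; exact: cintegrable_n1.
- by move=> y; exact: convol_sectionE.
Qed.

Lemma lint_convol K f : cbandlimited K -> lint f -> lint (convol K f).
Proof.
move=> sK fi; have Ki := cbandlimited_lint sK.
apply: (cintegrable_cint2 (m1 := leb) (m2 := leb)
  (f := fun z : borel R d * borel R d => K ((z.1 : 'rV[R]_d) - z.2) * f z.2)).
  apply: (cintegrable_section (m1 := leb) (m2 := leb)
    (F := fun z : borel R d * borel R d => K ((z.1 : 'rV[R]_d) - z.2) * f z.2)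
    (h := fun y : borel R d => cL1 K * n1 (f y))).
  - exact: (cmeasurable_sub_conv (cbandlimited_continuous sK) fi).
  - by move=> y; exact: lint_convol_section2.
  - by apply: rintegrableZ; exact: cintegrable_n1.
  - by move=> y; exact: convol_sectionE.
by move=> x; exact: lint_convol_section.
Qed.

Local Notation kern := (@kernel R d).

Lemma cint_kernel (a : R) : a != 0 -> cint leb (kern a) = 1.
Proof. by move=> a0; rewrite -FT0 FT_kernel// /ccutoff cutoff0. Qed.

(** The substitution y = x - a u. *)
Lemma convol_kernelE (a : R) f x : a != 0 -> lint f ->
  convol (kern a) f x = cint leb (fun u => kern 1 u * f (x - a *: u)).
Proof.
move=> a0 fi; have aN0 : - a != 0 by rewrite oppr_eq0.
have s1 := @cbandlimited_kernel R d 1 (oner_neq0 _).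
have [B KB] := cbandlimited_bounded s1.
have aVN0 : - a^-1 != 0 by rewrite oppr_eq0 invr_eq0.
have mK := cintegrable_meas (lint_affine (a^-1 *: x) aVN0 (cbandlimited_lint s1)).
have gi := cintegrable_mul mK (fun y => KB _) fi.
transitivity ((`|a|^-1 ^+ d)%:C *
    cint leb (fun y => kern 1 (- a^-1 *: y + a^-1 *: x) * f y)).
  rewrite -cintZ//; apply: eq_cint => y; rewrite (kernelE _ a0) mulrA.
  by rewrite scalerBr scaleNr [- _ + _]addrC.
rewrite -(normrN a) -(cint_affine x aN0 gi); apply: eq_cint => u.
congr (kern 1 _ * f _); last by rewrite scaleNr addrC.
by rewrite scalerDr scalerA mulNr mulrN opprK mulVf// scale1r scaleNr addrNK.
Qed.

(** Since the kernel has integral 1, the difference is the average of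
   f(x - a u) - f(x) with weight [kernel 1 u]. *)
Lemma convol_kernel_near (a : R) f : a != 0 -> lint f ->
  cL1 (fun x => convol (kern a) f x - f x) <= smear (kern 1) f (- a).
Proof.
move=> a0 fi; have s1 := @cbandlimited_kernel R d 1 (oner_neq0 _).
have Ki := cbandlimited_lint s1; have [B KB] := cbandlimited_bounded s1.
have aN0 : - a != 0 by rewrite oppr_eq0.
pose F (z : borel R d * borel R d) :=
  kern 1 z.2 * (f (1 *: (z.1 : 'rV[R]_d) + - a *: (z.2 : 'rV[R]_d)) - f z.1).
have fs x : lint (fun u => f (1 *: x + - a *: u)).
  by have := lint_affine x aN0 fi; under eq_fun do rewrite addrC -[in x + _](scale1r x).
have F2 x : lint (fun u => F (x, u)).
  rewrite /F/=; under eq_fun do rewrite mulrBr.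
  apply: cintegrable_sub; first exact: (cintegrable_mul (cintegrable_meas Ki) KB (fs x)).
  by under eq_fun do rewrite mulrC; exact: cintegrableZ.
have F1 u : lint (fun x => F (x, u)).
  rewrite /F/=; under eq_fun do rewrite scale1r.
  exact: (cintegrableZ _ (lint_translate_sub _ fi)).
rewrite /cL1 (_ : (fun x => _) = (fun x => n1 (cint leb (fun u => F (x, u))))).
  apply: (minkowski (F := F)) => //.
  - apply: cmeasurable_mul; first exact: (cmeasurable_snd (cintegrable_meas Ki)).
    apply: cmeasurable_add; first exact: (cmeasurable_lincomb 1 (- a) (cintegrable_meas fi)).
    exact: (cmeasurable_opp (cmeasurable_fst (cintegrable_meas fi))).
  - exact: rintegrable_smear.
  - move=> u; rewrite /cmodulus /cL1 -RintegralZl//; last first.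
      exact: (cintegrable_n1 (lint_translate_sub _ fi)).
    apply: le_Rintegral => //; first exact: (cintegrable_n1 (F1 u)).
      exact: (rintegrableZ _ (cintegrable_n1 (lint_translate_sub _ fi))).
    by move=> x _; rewrite /F/= scale1r; exact: n1M.
apply/funext => x; rewrite convol_kernelE//; congr n1.
rewrite -[X in _ - X]mul1r -(cint_kernel (oner_neq0 R)) mulrC -cintZ// -cintB//.
- by apply: eq_cint => u; rewrite /F/= scale1r scaleNr; ring.
- have := cintegrable_mul (cintegrable_meas Ki) KB (fs x).
  by under eq_fun do rewrite scale1r scaleNr.
- exact: cintegrableZ.
Qed.

(** Dilation invariance of the L^1 norm of a kernel. *)
Lemma cmodulus_kernel (a : R) h : a != 0 ->
  cmodulus (kern a) h = cmodulus (kern 1) (a^-1 *: h).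
Proof.
move=> a0; have s1 := @cbandlimited_kernel R d 1 (oner_neq0 _).
have Ki := cbandlimited_lint s1.
have aV0 : a^-1 != 0 by rewrite invr_eq0.
have gi : rintegrable (fun x => n1 (kern 1 (x + a^-1 *: h) - kern 1 x)).
  exact: (cintegrable_n1 (lint_translate_sub _ Ki)).
have := Rintegral_affine 0 aV0 gi.
rewrite normfV invrK => H.
rewrite /cmodulus /cL1 -[RHS](mulKf (x := `|a| ^+ d)) ?expf_neq0 ?normr_eq0// -H.
rewrite -RintegralZl//; last first.
  exact: (integrable_affine 0 aV0 gi).
apply: eq_Rintegral => x _; rewrite !(kernelE _ a0) -mulrBr addr0 scalerDr.
case: (kern 1 _ - kern 1 _) => u v; rewrite /n1/= !mul0r subr0 addr0.
have ad : 0 <= `|a|^-1 ^+ d by rewrite exprn_ge0 ?invr_ge0.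
rewrite !normrM (ger0_norm ad).
by rewrite -exprVn mulrDr.
Qed.

(** Since f has integral 0, the kernel at x - y may be replaced by its difference
   with the kernel at x; at the large scale a this difference is small in L^1. *)
Lemma convol_kernel_far (a : R) f : a != 0 -> lint f -> cint leb f = 0 ->
  cL1 (convol (kern a) f) <= smear f (kern 1) (- a^-1).
Proof.
move=> a0 fi f0; have sa := cbandlimited_kernel d a0; have Ki := cbandlimited_lint sa.
have K1 := cbandlimited_lint (@cbandlimited_kernel R d 1 (oner_neq0 _)).
pose F (z : borel R d * borel R d) :=
  (kern a ((z.1 : 'rV[R]_d) - z.2) - kern a z.1) * f z.2.
have F2 x : lint (fun y => F (x, y)).
  rewrite /F/=; under eq_fun do rewrite mulrBl.
  by apply: cintegrable_sub; [exact: lint_convol_section|exact: cintegrableZ].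
have F1 y : lint (fun x => F (x, y)).
  rewrite /F/=; under eq_fun do rewrite mulrC.
  exact: (cintegrableZ _ (lint_translate_sub _ Ki)).
rewrite /cL1 (_ : (fun x => _) = (fun x => n1 (cint leb (fun u => F (x, u))))).
  apply: (minkowski (F := F)) => //.
  - rewrite /F; under eq_fun do rewrite mulrBl.
    apply: cmeasurable_add; first exact: (cmeasurable_sub_conv (cbandlimited_continuous sa) fi).
    apply: cmeasurable_opp; apply: cmeasurable_mul.
      exact: (cmeasurable_fst (cintegrable_meas Ki)).
    exact: (cmeasurable_snd (cintegrable_meas fi)).
  - exact: (rintegrable_smear (- a^-1) fi K1).
  - move=> y; rewrite scaleNr -scalerN -cmodulus_kernel// /cmodulus /cL1 mulrC.
    rewrite -RintegralZr//; last first.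
      exact: (cintegrable_n1 (lint_translate_sub _ Ki)).
    apply: le_Rintegral => //; first exact: (cintegrable_n1 (F1 y)).
      under [X in integrable _ _ X]eq_fun do rewrite mulrC.
      exact: (rintegrableZ _ (cintegrable_n1 (lint_translate_sub _ Ki))).
    by move=> x _; rewrite /F/=; exact: n1M.
apply/funext => x; congr n1.
rewrite /convol -[LHS]subr0 -(mulr0 (kern a x)) -f0 -cintZ// -cintB//.
- by apply: eq_cint => y; rewrite /F/= mulrBl.
- exact: lint_convol_section.
- exact: cintegrableZ.
Qed.

End approximate_identity.

(** * Smooth projections onto the fibers *)

Lemma compact_union (T : ptopologicalType) (K : set T) (P : set T -> Prop) :
  compact K -> P set0 -> (forall A B, P A -> P B -> P (A `|` B)) ->
  (forall x, K x -> exists E, [/\ open E, E x & P E]) ->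
  exists2 E, K `<=` E & P E.
Proof.
rewrite compact_cover => cK P0 PU locP.
pose f x := if pselect (K x) is left Kx then sval (cid (locP x Kx)) else set0.
have fK x : K x -> [/\ open (f x), f x x & P (f x)].
  by move=> Kx; rewrite /f; case: pselect => // Kx'; case: cid.
have [x /fK[]//|x Kx|D DK KD] := cK T K f.
  by exists x => //; have [] := fK _ Kx.
have Pf (s : seq T) : (forall x, x \in s -> K x) -> P (\bigcup_(x in [set` s]) f x).
  elim: s => [_|x s IH sK].
    by rewrite (_ : [set` [::]] = set0) ?bigcup_set0// -subset0 => y.
  have -> : [set` x :: s] = x |` [set` s].
    by apply/seteqP; split=> y /=; rewrite in_cons => /predU1P.
  rewrite bigcup_setU1; apply: PU.
    by have [] := fK _ (sK _ (mem_head _ _)).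
  by apply: IH => y ys; apply: sK; rewrite in_cons ys orbT.
by exists (\bigcup_(x in [set` D]) f x) => //; apply: Pf => x /DK /set_mem.
Qed.

Section smooth_extension.
Variables (R : realType) (d : nat).
Implicit Types (x z : 'rV[R]_d) (U K : set 'rV[R]_d).

(** At the points of U both factors are smooth; on the complement of K, which is
   open, the product vanishes. *)
Lemma Cn_extend n U K (psi f : 'rV[R]_d -> R) : open U -> closed K -> K `<=` U ->
  (forall x, ~ K x -> psi x = 0) -> Cn n setT psi -> Cn n U f ->
  Cn n setT (fun x => psi x * f x).
Proof.
move=> oU cK KU psi0 Cpsi Cf; have oT := @openT 'rV[R]_d.
apply: Cn_local => x _; have [Kx|Kx] := pselect (K x).
  exists U; first exact: KU.
  by apply: Cn_mul => //; exact: Cn_subset Cpsi.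
have oK : open (~` K) by rewrite openC.
exists (~` K) => //.
by apply: (eq_Cn oK _ (Cn_cst n 0 oK)) => y Ky; rewrite psi0// mul0r.
Qed.

Lemma Cn_normsq_sub n z : Cn n setT (fun x => normsq (x - z)).
Proof.
have oT := @openT 'rV[R]_d; rewrite /normsq /dotr.
apply: Cn_sum => // i _; apply: Cn_mul => //;
  apply: (eq_Cn oT _ (Cn_add oT (Cn_coord n i oT) (Cn_cst n (- z 0 i) oT))) => x _;
  by rewrite !mxE.
Qed.

Lemma continuous_normsq_sub z : continuous (fun x => normsq (x - z)).
Proof. by move=> x; exact: (Cn_continuous (Cn_normsq_sub 0 z)). Qed.

Lemma normsq_ge0 x : 0 <= normsq x.
Proof. exact: le_trans (sqr_ge0 _) (normsq_ge x). Qed.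

Lemma enorm_eq1 x : (enorm x == 1) = (normsq x == 1).
Proof.
by rewrite -(eqrXn2 (n := 2)) ?sqrtr_ge0// expr1n sqr_sqrtr// normsq_ge0.
Qed.

Lemma normsq_eq0 x : (normsq x == 0) = (x == 0).
Proof. by rewrite -enorm_eq0 /enorm sqrtr_eq0 -/(normsq x) eq_le normsq_ge0 andbT. Qed.

Lemma normsq_gt0 x : x != 0 -> 0 < normsq x.
Proof. by rewrite lt_def normsq_ge0 normsq_eq0 andbT. Qed.

Lemma sphere_compact : compact [set x : 'rV[R]_d | enorm x == 1].
Proof.
apply: bounded_closed_compact.
  exists 1; split; first exact: num_real.
  move=> M M1 x /=; rewrite enorm_eq1 => /eqP x1; apply: le_trans (ltW M1).
  by rewrite -(ler_pXn2r (n := 2)) ?nnegrE// expr1n -x1 normsq_ge.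
rewrite (_ : mkset _ = (fun x => normsq (x - 0)) @^-1` [set 1]).
  apply: preimage_closed; last exact: closed_eq.
  by move=> x _; exact: continuous_normsq_sub.
by apply/seteqP; split=> x /=; rewrite subr0 enorm_eq1 => /eqP.
Qed.

Lemma open_neq0 : open [set x : 'rV[R]_d | x != 0].
Proof.
rewrite (_ : mkset _ = (fun x => normsq (x - 0)) @^-1` [set t | 0 < t]).
  by apply: open_comp => [x _|]; [exact: continuous_normsq_sub|exact: open_gt].
by apply/seteqP; split=> x /=; rewrite subr0 lt_def normsq_ge0 normsq_eq0 andbT.
Qed.

Definition radial x : 'rV[R]_d := (enorm x)^-1 *: x.

Lemma Cn_radial n j : Cn n [set x | x != 0] (fun x => radial x 0 j).
Proof.
have o0 := open_neq0.
apply: (eq_Cn o0 _ (Cn_mul o0 (Cn_rsqrt o0 _ (Cn_normsq n o0)) (Cn_coord n j o0))).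
  by move=> x _; rewrite mxE.
by move=> x; exact: normsq_gt0.
Qed.

End smooth_extension.

Section csmooth.
Variables (R : realType) (d : nat) (U : set 'rV[R]_d).
Hypothesis oU : open U.
Implicit Types f g : 'rV[R]_d -> R[i].

Lemma csmoothP f : csmooth_on U f <-> forall n,
  Cn n U (fun x => complex.Re (f x)) /\ Cn n U (fun x => complex.Im (f x)).
Proof.
split=> [[/smooth_onP r /smooth_onP i] n //|H].
by split; apply/smooth_onP => n; have [] := H n.
Qed.

Lemma csmooth_cst c : csmooth_on U (fun=> c).
Proof. by apply/csmoothP => n; split; exact: Cn_cst. Qed.

Lemma csmooth_add f g : csmooth_on U f -> csmooth_on U g ->
  csmooth_on U (fun x => f x + g x).
Proof.
move=> /csmoothP Cf /csmoothP Cg; apply/csmoothP => n.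
have [fr fi] := Cf n; have [gr gi] := Cg n; split.
  by under eq_fun do rewrite ReD; exact: Cn_add.
by under eq_fun do rewrite ImD; exact: Cn_add.
Qed.

Lemma csmooth_mul f g : csmooth_on U f -> csmooth_on U g ->
  csmooth_on U (fun x => f x * g x).
Proof.
move=> /csmoothP Cf /csmoothP Cg; apply/csmoothP => n.
have [fr fi] := Cf n; have [gr gi] := Cg n; split.
  under eq_fun do rewrite ReM; apply: Cn_add => //; first exact: Cn_mul.
  by apply: Cn_opp => //; exact: Cn_mul.
by under eq_fun do rewrite ImM; apply: Cn_add => //; exact: Cn_mul.
Qed.

Lemma csmooth_sum (I : Type) (r : seq I) (F : I -> 'rV[R]_d -> R[i]) :
  (forall i, csmooth_on U (F i)) -> csmooth_on U (fun x => \sum_(i <- r) F i x).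
Proof.
move=> CF; elim: r => [|i r IH].
  by under eq_fun do rewrite big_nil; exact: csmooth_cst.
by under eq_fun do rewrite big_cons; exact: csmooth_add.
Qed.

End csmooth.

Section fiber_projection.
Variables (R : realType) (d l k : nat) (Om : sphere R d -> grassmannian R l k).

(** Data of a smooth matrix M that maps C^l into the fibers and is the scalar Psi on
   them, with Psi positive on E. Dividing by Psi gives projections; keeping Psi
   makes such data add up, which replaces a normalized partition of unity. *)
Definition fiber_projection (E : set 'rV[R]_d) (Psi : 'rV[R]_d -> R)
    (M : 'rV[R]_d -> 'M[R[i]]_l) :=
  [/\ smooth_on setT Psi, forall i j, csmooth_on setT (fun x => M x i j),
      forall x, 0 <= Psi x, forall x, E x -> 0 < Psi x &
      forall (z : sphere R d) v, v *m M (sval z) \in sval (Om z) /\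
        (v \in sval (Om z) -> v *m M (sval z) = (Psi (sval z))%:C *: v)].

Lemma fiber_projection0 : fiber_projection set0 (fun=> 0) (fun=> 0).
Proof.
split=> //; first exact: smooth_cst.
- move=> i j; under eq_fun do rewrite mxE.
  by apply: csmooth_cst; exact: openT.
- by move=> z v; rewrite mulmx0 scale0r; split=> //; exact: mem0v.
Qed.

Lemma fiber_projectionU E1 E2 P1 P2 M1 M2 :
  fiber_projection E1 P1 M1 -> fiber_projection E2 P2 M2 ->
  fiber_projection (E1 `|` E2) (fun x => P1 x + P2 x) (fun x => M1 x + M2 x).
Proof.
move=> [/smooth_onP sP1 sM1 P1ge P1gt H1].
move=> [/smooth_onP sP2 sM2 P2ge P2gt H2].
have oT := @openT 'rV[R]_d; split.
- by apply/smooth_onP => n; exact: Cn_add.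
- by move=> i j; under eq_fun do rewrite mxE; exact: csmooth_add.
- by move=> x; exact: addr_ge0.
- by move=> x [/P1gt|/P2gt] ?; [exact: ltr_pwDl|exact: ltr_wpDl].
- move=> z v; have [m1 e1] := H1 z v; have [m2 e2] := H2 z v.
  rewrite mulmxDr; split; first exact: memvD.
  by move=> vz; rewrite e1// e2// -scalerDl -rmorphD.
Qed.

Hypothesis Om_smooth : smooth_map Om.

(** In the chart at z0 the projection is v |-> v_I A; it is multiplied by a bump
   function supported in the domain of the chart. *)
Lemma fiber_projection_local (z0 : sphere R d) : exists E,
  [/\ open E, E (sval z0) & exists Psi M, fiber_projection E Psi M].
Proof.
have [I [U [A [oU Uz0 sA hA]]]] := Om_smooth z0; have oT := @openT 'rV[R]_d.
have [e /= e0 eU] : exists2 e : R, 0 < e & ball (sval z0) e `<=` U.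
  exact/nbhs_ballP/open_nbhs_nbhs.
pose r := e / 2; have r0 : 0 < r by rewrite divr_gt0.
have cN := @continuous_normsq_sub R d (sval z0).
(* the closed Euclidean ball K lies in the chart since the sup norm is smaller *)
pose K := [set x : 'rV[R]_d | normsq (x - sval z0) <= r ^+ 2].
have cK : closed K by exact: (preimage_closed (fun x _ => cN x) (@closed_le _ (r ^+ 2))).
have KU : K `<=` U.
  move=> x Kx; apply: eU; rewrite -ball_normE/= distrC.
  apply: (@le_lt_trans _ _ r); last by rewrite /r ltr_pdivrMr// ltr_pMr// ltr1n.
  rewrite -(ler_pXn2r (n := 2)) ?nnegrE//; last exact: ltW.
  exact: le_trans (normsq_ge _) Kx.
pose psi x := bump (r ^+ 2 - normsq (x - sval z0)).
have psi0 x : ~ K x -> psi x = 0.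
  by move=> /negP; rewrite -ltNge => xr; rewrite /psi bump_le0// subr_le0 ltW.
have Cpsi n : Cn n setT psi.
  apply: Cn_bump => //; apply: Cn_add => //; first exact: Cn_cst.
  by apply: Cn_opp => //; exact: Cn_normsq_sub.
pose P x : 'M[R[i]]_l := colsub I 1%:M *m A x.
have sP i j : csmooth_on U (fun x => P x i j).
  under eq_fun do rewrite mxE.
  by apply: csmooth_sum => // a; apply: csmooth_mul => //; exact: csmooth_cst.
exists [set x | normsq (x - sval z0) < r ^+ 2]; split.
- by have := open_comp (fun x _ => cN x) (@open_lt R (r ^+ 2)).
- by rewrite /= subrr /normsq /dotr big1 ?exprn_gt0// => i _; rewrite mxE mul0r.
exists psi, (fun x => (psi x)%:C *: P x); split.
- exact/smooth_onP.
- move=> i j; apply/csmoothP => n; have /csmoothP/(_ n)[Pr Pi] := sP i j; split.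
    under eq_fun do rewrite mxE ReM/= mul0r subr0.
    exact: (Cn_extend oU cK KU psi0).
  under eq_fun do rewrite mxE ImM/= mul0r addr0.
  exact: (Cn_extend oU cK KU psi0).
- by move=> x; exact: bump_ge0.
- by move=> x /= xr; apply: bump_gt0; rewrite subr_gt0.
- move=> z v; have [Kz|/psi0 z0'] := pselect (K (sval z)); last first.
    by rewrite z0' !scale0r mulmx0; split=> //; exact: mem0v.
  have [A1 AV] := hA _ (KU _ Kz); rewrite -scalemxAr; split.
    by apply: memvZ; rewrite AV mulmxA; exact: submxMl.
  rewrite AV => /submxP[u ->]; congr (_ *: _); rewrite /P !mulmxA; congr (_ *m _).
  rewrite -[RHS]mulmx1 -A1 -!mulmxA; congr (_ *m _).
  by rewrite mulmx_colsub mulmx1.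
Qed.

Lemma fiber_projection_sphere : exists Psi M,
  fiber_projection [set x | enorm x == 1] Psi M.
Proof.
pose P E := exists Psi M, fiber_projection E Psi M.
have [|||E SE [Psi [M [sPsi sM Psige Psigt H]]]] := @compact_union _ _ P (@sphere_compact R d).
- by exists (fun=> 0), (fun=> 0); exact: fiber_projection0.
- move=> A B [P1 [M1 H1]] [P2 [M2 H2]].
  by exists (fun x => P1 x + P2 x), (fun x => M1 x + M2 x); exact: fiber_projectionU.
- by move=> x /= x1; exact: (fiber_projection_local (exist _ x x1)).
by exists Psi, M; split=> // x /SE; exact: Psigt.
Qed.

(** The projections on the sphere are extended to be constant along rays, normalized
   by Psi, and multiplied by a difference chi of two cutoffs. As chi vanishes near
   the origin, where the radial projection is singular, the result is smooth. The
   formula for w is the product of the row v with the matrix m xi. *)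
Lemma multiplier_exists (a b : R) : a != 0 -> b != 0 ->
  exists2 m : 'I_l -> 'I_l -> 'rV[R]_d -> R[i],
    forall i j, ctest (m i j) &
    forall xi (xi0 : xi != 0) (v : 'rV[R[i]]_l),
      let w := \row_j \sum_i m i j xi * v 0 i in
      w \in sval (Om (normalize xi0)) /\
      (v \in sval (Om (normalize xi0)) ->
       w = (ccutoff a xi - ccutoff b xi) *: v).
Proof.
move=> a0 b0; have [Psi [M [/smooth_onP sPsi sM Psige Psigt H]]] := fiber_projection_sphere.
have oT := @openT 'rV[R]_d.
pose chi (x : 'rV[R]_d) := cutoff a x - cutoff b x.
have tchi : test chi.
  by rewrite /chi; apply: test_add; [exact: test_cutoff|apply: test_opp; exact: test_cutoff].
pose V := [set x : 'rV[R]_d | x != 0].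
have oV : open V by exact: open_neq0.
(* both cutoffs equal 1 where c |x|^2 <= 1, so that chi vanishes off K *)
pose c := a ^+ 2 + b ^+ 2.
have c0 : 0 < c by rewrite ltr_wpDr ?sqr_ge0// exprn_even_gt0.
pose K := [set x : 'rV[R]_d | c^-1 <= normsq x].
have cN : continuous (@normsq R d).
  by move=> x; exact: (Cn_continuous (Cn_normsq 0 oT)).
have cK : closed K by exact: (preimage_closed (fun x _ => cN x) (@closed_ge _ c^-1)).
have KV : K `<=` V.
  move=> x; apply: contraPN => /eqP ->; rewrite /K/= /normsq /dotr big1.
    by rewrite leNgt invr_gt0 c0.
  by move=> i _; rewrite mxE mul0r.
have chi0 x : ~ K x -> chi x = 0.
  move=> /negP; rewrite -ltNge => xc; have cx : c * normsq x <= 1.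
    by rewrite mulrC -ler_pdivlMr// mul1r ltW.
  rewrite /chi !cutoff_in ?subrr//; apply: le_trans cx; apply: ler_wpM2r;
    by rewrite ?normsq_ge0// /c ?lerDr ?lerDl sqr_ge0.
pose Q i j x : R[i] := ((Psi (radial x))^-1)%:C * M (radial x) i j.
have radial1 x : V x -> enorm (radial x) == 1 by exact: normalize_subproof.
have Crad n f : Cn n setT f -> Cn n V (fun x => f (radial x)).
  by move=> Cf; apply: (Cn_comp oT oV _ _ Cf) => // j; exact: Cn_radial.
have sQ i j : csmooth_on V (Q i j).
  apply: csmooth_mul => //; apply/csmoothP => n; last first.
    have /csmoothP/(_ n)[r im] := sM i j.
    by split; [exact: (Crad _ _ r)|exact: (Crad _ _ im)].
  split; last exact: Cn_cst.
  apply: Cn_inv => //; last exact: (Crad _ _ (sPsi n)).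
  by move=> x Vx; rewrite gt_eqF// Psigt//=; exact: radial1.
exists (fun i j x => (chi x)%:C * Q i j x).
  move=> i j; have [/smooth_onP schi [N chiN]] := tchi.
  have /csmoothP CQ := sQ i j; split; split.
  - apply/smooth_onP => n; under eq_fun do rewrite ReM/= mul0r subr0.
    exact: (Cn_extend oV cK KV chi0 (schi n) (CQ n).1).
  - by exists N => x /chiN cx; rewrite cx mul0r.
  - apply/smooth_onP => n; under eq_fun do rewrite ImM/= mul0r addr0.
    exact: (Cn_extend oV cK KV chi0 (schi n) (CQ n).2).
  - by exists N => x /chiN cx; rewrite cx mul0r.
move=> xi xi0 v /=.
have -> : \row_j (\sum_i (chi xi)%:C * Q i j xi * v 0 i) =
    ((chi xi)%:C * ((Psi (radial xi))^-1)%:C) *: (v *m M (radial xi)).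
  apply/rowP => j; rewrite !mxE mulr_sumr; apply: eq_bigr => i _.
  by rewrite /Q; ring.
have [wV we] := H (normalize xi0) v; split; first exact: memvZ.
move=> /we; rewrite /= -/(radial xi) => ->; rewrite scalerA -mulrA -rmorphM mulVf.
  by rewrite mulr1 /chi rmorphB.
by rewrite gt_eqF// Psigt//=; exact: radial1.
Qed.

End fiber_projection.

(** * Density in the L^1 norm *)

Lemma ccvg_sum (R : realType) (I : Type) (r : seq I) (u : I -> nat -> R[i]) (v : I -> R[i]) :
  (forall i, ccvg (u i) (v i)) ->
  ccvg (fun n => \sum_(i <- r) u i n) (\sum_(i <- r) v i).
Proof.
move=> uv; elim: r => [|i r IH].
  rewrite big_nil (_ : (fun n => _) = fun=> 0); first exact: ccvg_cst.
  by apply/funext => n; rewrite big_nil.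
rewrite big_cons (_ : (fun n => _) = fun n => u i n + \sum_(j <- r) u j n).
  exact: ccvgD.
by apply/funext => n; rewrite big_cons.
Qed.

Section multiplier_convolution.
Variables (R : realType) (d : nat).
Local Notation leb := (lebesgue_rV R d).
Implicit Types (f g K M : 'rV[R]_d -> R[i]) (x xi : 'rV[R]_d).

Lemma FTN f xi : lint f -> FT (fun x => - f x) xi = - FT f xi.
Proof.
move=> fi; rewrite -mulN1r -FTZ//; congr (FT _ xi).
by apply/funext => x; rewrite mulN1r.
Qed.

Lemma FTB f g xi : lint f -> lint g -> FT (fun x => f x - g x) xi = FT f xi - FT g xi.
Proof.
by move=> fi gi; rewrite -(FTN _ gi); apply: FTD => //; exact: cintegrable_opp.
Qed.

Lemma convol_multiplier_kernel M f : ctest M -> lint f ->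
  convol (multiplier_kernel M) f = multiplier_kernel (fun xi => M xi * FT f xi).
Proof.
move=> tM fi; apply/funext => x; rewrite /multiplier_kernel -convolution_multiplier//.
rewrite -cintZ; first by apply: eq_cint => y; rewrite mulrA.
exact: (lint_convol_section x (cbandlimited_IFT tM) fi).
Qed.

Lemma convol_kernelM (a : R) f : a != 0 -> lint f ->
  convol (@kernel R d a) f = multiplier_kernel (fun xi => ccutoff a xi * FT f xi).
Proof.
move=> a0 fi; rewrite -(convol_multiplier_kernel (@ctest_ccutoff R d a a0) fi).
by congr convol.
Qed.

Lemma convol_kernel_sub (a b : R) f x : a != 0 -> b != 0 -> lint f ->
  convol (@kernel R d a) f x - convol (@kernel R d b) f x =
  multiplier_kernel (fun xi => (ccutoff a xi - ccutoff b xi) * FT f xi) x.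
Proof.
move=> a0 b0 fi.
have Ea := congr1 (fun h => h x) (convol_kernelM a0 fi).
have Eb := congr1 (fun h => h x) (convol_kernelM b0 fi).
apply: etrans (f_equal2 (fun u v => u - v) Ea Eb) _.
have ta := ctest_lint (@ctest_ccutoff R d a a0); have tb := ctest_lint (@ctest_ccutoff R d b b0).
rewrite /multiplier_kernel -mulrBr; congr (_ * _).
rewrite /IFT -(FTB _ (lint_mul_FT ta fi) (lint_mul_FT tb fi)).
congr (FT _ (- x)); apply/funext => xi; exact/esym/mulrBl.
Qed.

Lemma convolB K f g x : cbandlimited K -> lint f -> lint g ->
  convol K (fun y => f y - g y) x = convol K f x - convol K g x.
Proof.
move=> sK fi gi.
rewrite /convol -(cintB (lint_convol_section x sK fi) (lint_convol_section x sK gi)).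
by apply: eq_cint => y; rewrite mulrBr.
Qed.

Definition truncate f (n : nat) x : R[i] := (\1_(@cube R d n.+1%:R) x : R)%:C * f x.

Lemma lint_truncate f n : lint f -> lint (truncate f n).
Proof.
move=> fi; apply: (@cintegrable_mul _ _ _ leb _ f 1) => //.
  split; last exact: measurable_cst.
  by apply: measurable_indic; exact: measurable_cube.
by move=> x; rewrite n1_real ger0_norm ?indic_ge0// indicE lern1 leq_b1.
Qed.

Lemma truncate_compact_integrable f n : lint f ->
  compact_integrable (fun x => complex.Re (truncate f n x)) /\
  compact_integrable (fun x => complex.Im (truncate f n x)).
Proof.
move=> /(lint_truncate n)[ir ii].
have t0 x : n.+1%:R < `|x| -> truncate f n x = 0.
  move=> nx; rewrite /truncate indicE memNset ?mul0r//.
  by move=> /cubeP; rewrite ltr0n => /(_ isT); apply/negP; rewrite -leNgt ltW.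
by split; split=> //; exists n.+1%:R => x /t0 ->.
Qed.

Lemma truncate_cvg f : lint f ->
  cL1 (fun x => truncate f n x - f x) @[n --> \oo] --> (0 : R).
Proof.
move=> fi.
have -> : (0 : R) = (\int[leb]_u (cst 0 u : R))%R by rewrite Rintegral_cst// mul0r.
apply: (@dominated_cvgR _ _ _ leb (fun n x => n1 (truncate f n x - f x)) (cst 0)
  (fun x => n1 (f x))).
- move=> n; apply: measurable_n1.
  exact: (cintegrable_meas (cintegrable_sub (lint_truncate n fi) fi)).
- move=> x; apply/cvgrPdist_lt => e e0.
  exists (Num.truncn `|x : 'rV[R]_d|) => // n /= xn; rewrite /cst sub0r normrN.
  rewrite /truncate indicE mem_set ?mul1r ?subrr ?n1_0 ?normr0//.
  apply/cubeP; rewrite ?ltr0n//; apply: lt_le_trans (truncnS_gt _) _.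
  by rewrite ler_nat.
- exact: cintegrable_n1.
- move=> n x; rewrite ger0_norm ?n1_ge0// /truncate indicE.
  by case: (_ \in _); rewrite ?mul1r ?subrr ?n1_0 ?n1_ge0// mul0r sub0r n1N.
Qed.

Lemma FT_cvg f (u : nat -> 'rV[R]_d) xi : lint f -> u n @[n --> \oo] --> xi ->
  ccvg (fun n => FT f (u n)) (FT f xi).
Proof.
move=> fi uxi; apply: (@cint_dominated _ _ _ leb _ _ (fun x => 2 * n1 (f x))).
- by move=> n; exact/cintegrable_meas/lint_char.
- move=> x; apply: ccvgM; first exact: ccvg_cst.
  rewrite fourier_charC; under [X in ccvg X _]eq_fun do rewrite fourier_charC.
  exact: (ccontinuous_ccvg (ccontinuous_fourier_char x) uxi).
- by apply: rintegrableZ; exact: cintegrable_n1.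
- move=> n x; apply: le_trans (n1M _ _) _; rewrite mulrC ler_wpM2r ?n1_ge0//.
  exact: n1_fourier_char.
Qed.

End multiplier_convolution.

Section density.
Variables (R : realType) (d l k : nat) (Om : sphere R d -> grassmannian R l k).
Hypothesis Om_smooth : smooth_map Om.
Local Notation leb := (lebesgue_rV R d).
Local Notation kern := (@kernel R d).

(** In the chart at z, membership of v in the fiber is the linear equation
   v = v_I A, which passes to the limit. *)
Lemma fiber_closed (z : sphere R d) (u : nat -> 'rV[R[i]]_l) (v : 'rV[R[i]]_l) :
  (forall n, u n \in sval (Om z)) -> (forall j, ccvg (fun n => u n 0 j) (v 0 j)) ->
  v \in sval (Om z).
Proof.
move=> uz uv; have [I [U [A [oU Uz _ hA]]]] := Om_smooth z.
have [A1 AV] := hA _ Uz.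
have E w : w \in sval (Om z) -> w = colsub I w *m A (sval z).
  by rewrite AV => /submxP[c ->]; rewrite -mulmx_colsub A1 mulmx1.
rewrite AV; suff -> : v = colsub I v *m A (sval z) by exact: submxMl.
apply/rowP => j; apply: (ccvg_unique (uv j)).
under [X in ccvg X _]eq_fun => n do rewrite (E _ (uz n)) mxE.
rewrite mxE; apply: ccvg_sum => i; apply: ccvgM; last exact: ccvg_cst.
have := uv (I i); congr (ccvg _ _); last by rewrite mxE.
by apply/funext => n; rewrite mxE.
Qed.

(** The values of the transform at the points z/(n+1) belong to the fiber over z and
   tend to the value at 0. *)
Lemma fourier0_fiber f (z : sphere R d) : W1 Om f -> fourier f 0 \in sval (Om z).
Proof.
move=> [fi fOm].
have z0 : sval z != 0.
  by rewrite -enorm_eq0 (eqP (svalP z)) oner_neq0.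
have xi0 n : inv_seq R n *: sval z != 0.
  by rewrite scaler_eq0 negb_or inv_seq_neq0.
have zE n : normalize (xi0 n) = z.
  apply/val_inj; rewrite /= enormZ (eqP (svalP z)) mulr1 scalerA.
  by rewrite ger0_norm ?ltW ?inv_seq_gt0// mulVf ?inv_seq_neq0// scale1r.
apply: (@fiber_closed z (fun n => fourier f (inv_seq R n *: sval z))).
  by move=> n; have := fOm _ (xi0 n); rewrite zE.
move=> j; rewrite fourierE mxE.
under [X in ccvg X _]eq_fun do rewrite fourierE mxE.
exact: (FT_cvg (fi j) (cvg_inv_seqZ _)).
Qed.

(** The approximation is the sum over i of the convolutions of the kernel of m_ij
   with a truncation of f_i. Without truncation these convolutions add up to
   f_j * K_a - f_j * K_(1/a). *)
Lemma mean_zero_density (f : 'I_l -> 'rV[R]_d -> R[i]) (e : R) :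
  (forall j, lint (f j)) -> (forall j, cint leb (f j) = 0) ->
  (forall xi (xi0 : xi != 0), \row_j FT (f j) xi \in sval (Om (normalize xi0))) ->
  0 < e -> exists g : 'I_l -> 'rV[R]_d -> R[i],
    [/\ forall j, cbandlimited (g j),
        forall xi (xi0 : xi != 0), \row_j FT (g j) xi \in sval (Om (normalize xi0)) &
        \sum_j cL1 (fun x => g j x - f j x) < e].
Proof.
move=> fi f0 fOm e0.
have K1 := cbandlimited_lint (@cbandlimited_kernel R d 1 (oner_neq0 _)).
pose err a := \sum_j (smear (kern 1) (f j) (- a) + smear (f j) (kern 1) (- a)).
have err0 : err (inv_seq R n) @[n --> \oo] --> (0 : R).
  have -> : (0 : R) = \sum_(j < l) (0 + 0) by rewrite big1// => j _; rewrite addr0.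
  apply: cvg_sumr => j _.
  have s0 : - inv_seq R n @[n --> \oo] --> (0 : R).
    by rewrite -oppr0; apply: cvgN; exact: cvg_inv_seq.
  by apply: cvgD; exact: smear_cvg.
(* the scale a is fixed first: the truncation error depends on the kernels K *)
have [a a0 erra] : exists2 a, a != 0 & err a < e / 2.
  have /cvgrPdist_lt/(_ (e / 2)) := err0; rewrite divr_gt0// => /(_ isT)[n _ /(_ n (leqnn n))].
  rewrite /= sub0r normrN => /(le_lt_trans (ler_norm _)) en.
  by exists (inv_seq R n) => //; exact: inv_seq_neq0.
have b0 : a^-1 != 0 by rewrite invr_eq0.
have [m tm mOm] := multiplier_exists Om_smooth a0 b0.
pose K i j := multiplier_kernel (m i j).
have sK i j : cbandlimited (K i j) by exact: cbandlimited_multiplier_kernel.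
pose h N i x := truncate (f i) N x - f i x.
have hi N i : lint (h N i) by exact: (cintegrable_sub (lint_truncate N (fi i)) (fi i)).
pose err' N := \sum_j \sum_i cL1 (K i j) * cL1 (h N i).
have err'0 : err' N @[N --> \oo] --> (0 : R).
  have -> : (0 : R) = \sum_(j < l) \sum_(i < l) cL1 (K i j) * 0.
    by rewrite big1// => j _; rewrite big1// => i _; rewrite mulr0.
  apply: cvg_sumr => j _; apply: cvg_sumr => i _; apply: cvgMr.
  exact: (truncate_cvg (fi i)).
have [N errN] : exists N, err' N < e / 2.
  have /cvgrPdist_lt/(_ (e / 2)) := err'0; rewrite divr_gt0// => /(_ isT)[N _ /(_ N (leqnn N))].
  by rewrite /= sub0r normrN => /(le_lt_trans (ler_norm _)); exists N.
pose t i := truncate (f i) N; have ti i : lint (t i) by exact: lint_truncate.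
pose g j x := \sum_i convol (K i j) (t i) x.
have mt i j : ctest (fun xi => m i j xi * FT (t i) xi).
  have [cr ci] := truncate_compact_integrable N (fi i).
  by have [sr si] := smooth_FT cr ci; exact: (ctest_mul sr si (tm i j)).
have cKt i j := convol_multiplier_kernel (tm i j) (ti i).
have sKt i j : cbandlimited (convol (K i j) (t i)).
  by rewrite /K cKt; exact: (cbandlimited_multiplier_kernel (mt i j)).
have sg j : cbandlimited (g j).
  rewrite /g; elim: (index_enum _) => [|i r IH].
    under eq_fun do rewrite big_nil.
    have := cbandlimitedZ 0 (sKt j j); by under eq_fun do rewrite mul0r.
  by under eq_fun do rewrite big_cons; exact: cbandlimited_add.
exists g; split=> // [xi xi0|].
  suff -> : \row_j FT (g j) xi =
      \row_j \sum_i m i j xi * (\row_i FT (t i) xi : 'rV_l) 0 i.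
    exact: (mOm xi xi0 _).1.
  apply/rowP => j; rewrite !mxE FT_sum; last by move=> i; exact: cbandlimited_lint.
  apply: eq_bigr => i _; rewrite mxE /K cKt.
  by rewrite (FT_multiplier_kernel xi (mt i j)).
(* both transforms agree: by the choice of m off the origin, and at the origin
   because f has integral 0 *)
have Kf j x : \sum_i convol (K i j) (f i) x =
    convol (kern a) (f j) x - convol (kern a^-1) (f j) x.
  have ta := @ctest_ccutoff R d a a0; have tb := @ctest_ccutoff R d a^-1 b0.
  rewrite convol_kernel_sub//.
  rewrite (eq_bigr (fun i => multiplier_kernel (fun xi => m i j xi * FT (f i) xi) x)); last first.
    by move=> i _; rewrite /K (convol_multiplier_kernel (tm i j) (fi i)).
  rewrite /multiplier_kernel /IFT -mulr_sumr; congr (_ * _).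
  rewrite -FT_sum; last by move=> i; exact: (lint_mul_FT (ctest_lint (tm i j)) (fi i)).
  congr (FT _ (- x)); apply/funext => xi; have [->|xi0] := eqVneq xi 0.
    by rewrite !FT0 f0 !mulr0 big1// => i _; rewrite FT0 f0 mulr0.
  have [_ /(_ (fOm xi xi0))] := mOm xi xi0 (\row_i FT (f i) xi).
  move=> /rowP/(_ j); rewrite !mxE => <-.
  by apply: eq_bigr => i _; rewrite mxE.
have gE j : (fun x => g j x - f j x) = (fun x => (\sum_i convol (K i j) (h N i) x) +
   ((convol (kern a) (f j) x - f j x) - convol (kern a^-1) (f j) x)).
  apply/funext => x; rewrite addrAC -Kf addrA -big_split/=; congr (_ - _).
  apply: eq_bigr => i _; rewrite [convol _ (h N i) x](convolB x (sK i j) (ti i) (fi i)).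
  exact/esym/subrK.
have sa := @cbandlimited_kernel R d a a0; have sb := @cbandlimited_kernel R d a^-1 b0.
have step j : cL1 (fun x => g j x - f j x) <= (\sum_i cL1 (K i j) * cL1 (h N i)) +
    (smear (kern 1) (f j) (- a) + smear (f j) (kern 1) (- a)).
  have ca := lint_convol sa (fi j); have cb := lint_convol sb (fi j).
  have cK i : lint (convol (K i j) (h N i)) by exact: lint_convol.
  rewrite gE.
  apply: le_trans (cL1D (cintegrable_sum _ cK)
    (cintegrable_sub (cintegrable_sub ca (fi j)) cb)) _.
  apply: lerD.
    apply: le_trans (cL1_sum _ cK) _; apply: ler_sum => i _; exact: cL1_convol.
  apply: le_trans (cL1B (cintegrable_sub ca (fi j)) cb) _; apply: lerD.
    exact: (convol_kernel_near a0 (fi j)).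
  by have := convol_kernel_far b0 (fi j) (f0 j); rewrite invrK.
apply: (le_lt_trans (ler_sum _ (fun j _ => step j))).
rewrite big_split/= (splitr e); exact: ltrD.
Qed.

Lemma cvnorm_le (v : 'rV[R[i]]_l) : cvnorm v <= \sum_j n1 (v 0 j).
Proof.
have s0 : 0 <= \sum_j n1 (v 0 j) by apply: sumr_ge0 => j _; exact: n1_ge0.
rewrite /cvnorm -[leRHS](ger0_norm s0) -sqrtr_sqr ler_sqrt ?sqr_ge0//.
apply: (@proj2 (0 <= \sum_j n1 (v 0 j))).
elim/big_ind2 : _ => [|x y x' y' [y0 xy] [y0' xy']|j _].
- by rewrite expr0n.
- split; first exact: addr_ge0.
  have := mulr_ge0 y0 y0'; nra.
split; first exact: n1_ge0.
case: (v 0 j) => a b; rewrite /n1 /Normc.normc/= sqr_sqrtr ?addr_ge0 ?sqr_ge0//.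
rewrite sqrrD !real_normK ?num_real// addrAC lerDl.
by rewrite mulrn_wge0// mulr_ge0.
Qed.

Lemma cbandlimited_schwartz (g : 'rV[R]_d -> 'rV[R[i]]_l) :
  (forall j, cbandlimited (fun x => g x 0 j)) -> schwartz g.
Proof.
by move=> sg j; have [sr si] := sg j; split; exact: bandlimited_schwartz.
Qed.

(** The value v of the transform at 0 is in every fiber, and v times [kernel 1] is
   a Schwartz function of W_1 with the same integral as f: subtracting it reduces
   to [mean_zero_density]. *)
Lemma W1_density f (e : R) : W1 Om f -> 0 < e ->
  exists2 g, (@schwartz R d l `&` W1 Om) g &
    \sum_j cL1 (fun x => g x 0 j - f x 0 j) < e.
Proof.
move=> Wf e0; have [fi fOm] := Wf.
have [v vE vOm] : exists2 v : 'rV[R[i]]_l, forall j, v 0 j = FT (fun x => f x 0 j) 0 &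
    forall z, v \in sval (Om z).
  exists (fourier f 0) => [j|z]; [by rewrite fourierE mxE|exact: fourier0_fiber].
have s1 := @cbandlimited_kernel R d 1 (oner_neq0 _); have Ki := cbandlimited_lint s1.
have vK j : lint (fun x => v 0 j * kern 1 x) by exact: cintegrableZ.
pose f0 j x := f x 0 j - v 0 j * kern 1 x.
have f0i j : lint (f0 j) by exact: (cintegrable_sub (fi j) (vK j)).
have FK xi j : FT (fun x => v 0 j * kern 1 x) xi = v 0 j * ccutoff 1 xi.
  by rewrite (FTZ _ _ Ki) FT_kernel// oner_neq0.
have Ff0 xi j : FT (f0 j) xi = FT (fun x => f x 0 j) xi - ccutoff 1 xi * v 0 j.
  by rewrite (FTB xi (fi j) (vK j)) FK mulrC.
have [||g0 [sg0 g0Om g0f]] := mean_zero_density f0i _ _ e0.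
- move=> j; rewrite -FT0 Ff0 vE /ccutoff cutoff0 mul1r.
  exact: subrr.
- move=> xi xi0; rewrite (_ : \row_j _ = fourier f xi - ccutoff 1 xi *: v).
    by apply: memvB; [exact: fOm|exact/memvZ/vOm].
  by apply/rowP => j; rewrite fourierE !mxE Ff0.
pose g x : 'rV[R[i]]_l := \row_j (g0 j x + v 0 j * kern 1 x).
have gE j : (fun x => g x 0 j) = (fun x => g0 j x + v 0 j * kern 1 x).
  by apply/funext => x; rewrite mxE.
have sg j : cbandlimited (fun x => g x 0 j).
  by rewrite gE; exact: (cbandlimited_add (sg0 j) (cbandlimitedZ _ s1)).
exists g.
  split; first exact: cbandlimited_schwartz.
  split; first by move=> j; exact: (cbandlimited_lint (sg j)).
  move=> xi xi0; rewrite (_ : fourier g xi = \row_j FT (g0 j) xi + ccutoff 1 xi *: v).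
    by apply: memvD; [exact: g0Om|exact/memvZ/vOm].
  apply/rowP => j; rewrite fourierE !mxE gE (FTD xi (cbandlimited_lint (sg0 j)) (vK j)) FK.
  by rewrite [ccutoff _ _ * _]mulrC.
rewrite (eq_bigr (fun j => cL1 (fun x => g0 j x - f0 j x)))// => j _.
congr cL1; apply/funext => x; rewrite mxE /f0 opprB addrA.
by rewrite -addrA [X in _ + X]addrC.
Qed.

Lemma W1_L1_dense : L1_dense_in (@schwartz R d l `&` W1 Om) (W1 Om).
Proof.
split=> [f []//|f Wf e e0]; have [g [sg Wg] gf] := W1_density Wf e0.
exists g => //.
have di j : lint (fun x => f x 0 j - g x 0 j) by exact: (cintegrable_sub (Wf.1 j) (Wg.1 j)).
have dn j := cintegrable_n1 (di j).
apply: (@le_lt_trans _ _ (\int[leb]_x (\sum_j n1 (f x 0 j - g x 0 j))%:E)%E).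
  apply: ge0_le_integral => //.
  - by move=> x _; rewrite lee_fin sqrtr_ge0.
  - apply/measurable_EFinP; rewrite /cvnorm.
    apply: (measurableT_comp (f := @Num.sqrt R)).
      exact: continuous_measurable_fun (@sqrt_continuous R).
    apply: measurable_sum => j; apply: measurable_funX.
    have -> : (fun x : borel R d => Normc.normc ((f x - g x) 0 j)) =
       (fun x => Num.sqrt (complex.Re (f x 0 j - g x 0 j) ^+ 2 +
                           complex.Im (f x 0 j - g x 0 j) ^+ 2)).
      by apply/funext => x; rewrite !mxE; case: (f x 0 j - g x 0 j).
    have [mr mi] := cintegrable_meas (di j).
    apply: (measurableT_comp (f := @Num.sqrt R)).
      exact: continuous_measurable_fun (@sqrt_continuous R).
    by apply: measurable_funD; exact: measurable_funX.
  - apply/measurable_EFinP; apply: measurable_sum => j.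
    exact: (integrable_measurable (dn j)).
  - move=> x _; rewrite lee_fin; apply: le_trans (cvnorm_le _) _.
    by apply: ler_sum => j _; rewrite !mxE.
under eq_integral do rewrite -sumEFin.
rewrite (integral_sum measurableT dn).
rewrite (eq_bigr (fun j => (cL1 (fun x => g x 0 j - f x 0 j))%:E)).
  by rewrite sumEFin lte_fin.
move=> j _; rewrite -cL1N /cL1 /Rintegral fineK; last first.
  by have := integrable_fin_num measurableT
    (cintegrable_n1 (cintegrable_opp (cintegrable_sub (Wg.1 j) (Wf.1 j)))).
by apply: eq_integral => x _; rewrite opprB.
Qed.

End density.

(** * Charges with a density *)

Section charge_density.
Variables (R : realType) (d : nat).
Local Notation leb := (lebesgue_rV R d).
Local Notation fmeasure := {finite_measure set (borel R d) -> \bar R}.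
Implicit Types (m : fmeasure) (h r : 'rV[R]_d -> R).

Definition bounded_measurable h :=
  measurable_fun setT (h : borel R d -> R) /\ exists B, forall x, `|h x| <= B.

Lemma bounded_integrable m h : bounded_measurable h ->
  m.-integrable setT (fun x : borel R d => (h x)%:E).
Proof.
move=> [mh [B hB]].
apply: (le_integrable measurableT _ _ (finite_measure_integrable_cst m B measurableT)).
  exact/measurable_EFinP.
by move=> x _ /=; rewrite lee_fin (le_trans (hB x))// ler_norm.
Qed.

Lemma bounded_mul_integrable h r : bounded_measurable h -> rintegrable r ->
  rintegrable (fun x => h x * r x).
Proof.
move=> [mh [B hB]] ri.
apply: (@le_integrable _ _ _ _ _ measurableT _ (fun x : borel R d => B%:E * (`|r x|)%:E)%E).
- apply/measurable_EFinP; apply: measurable_funM => //.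
  exact: integrable_measurable ri.
- move=> x _ /=; rewrite lee_fin normrM.
  apply: le_trans (ler_norm _); exact: ler_wpM2r.
- by apply: integrableZl => //; exact: rintegrable_norm.
Qed.

Lemma bounded_measurable_add h h' : bounded_measurable h -> bounded_measurable h' ->
  bounded_measurable (fun x => h x + h' x).
Proof.
move=> [mh [B hB]] [mh' [B' hB']]; split; first exact: measurable_funD.
by exists (B + B') => x; apply: le_trans (ler_normD _ _) _; exact: lerD.
Qed.

Lemma bounded_measurableZ (c : R) h : bounded_measurable h ->
  bounded_measurable (fun x => c * h x).
Proof.
move=> [mh [B hB]]; split; first exact: measurable_funM.
by exists (`|c| * B) => x; rewrite normrM ler_wpM2l.
Qed.

Lemma bounded_measurable_indic (A : set (borel R d)) : measurable A ->
  bounded_measurable (\1_A : 'rV[R]_d -> R).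
Proof.
move=> mA; split; first exact: measurable_indic.
by exists 1 => x; rewrite indicE; case: (_ \in _); rewrite ?normr1 ?normr0.
Qed.

Section difference.
Variables (P N : fmeasure) (r : 'rV[R]_d -> R).
Hypothesis ri : rintegrable r.
Hypothesis PNr : forall A, measurable A ->
  fine (P A) - fine (N A) = fine (\int[leb]_(x in A) (r x)%:E)%E.

Let represented h := bounded_measurable h /\
  (\int[P]_x h x - \int[N]_x h x)%R = (\int[leb]_x (h x * r x))%R.

Let represented_add h h' : represented h -> represented h' ->
  represented (fun x => h x + h' x).
Proof.
move=> [bh Eh] [bh' Eh']; split; first exact: bounded_measurable_add.
have ih m := bounded_integrable m bh; have ih' m := bounded_integrable m bh'.
rewrite (RintegralD measurableT (ih P) (ih' P)) (RintegralD measurableT (ih N) (ih' N)).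
under [in RHS]eq_Rintegral do rewrite mulrDl.
rewrite (RintegralD measurableT (bounded_mul_integrable bh ri) (bounded_mul_integrable bh' ri)).
by rewrite -Eh -Eh' opprD addrACA.
Qed.

Let representedZ (c : R) h : represented h -> represented (fun x => c * h x).
Proof.
move=> [bh Eh]; split; first exact: bounded_measurableZ.
have ih m := bounded_integrable m bh.
under [in RHS]eq_Rintegral do rewrite -mulrA.
rewrite (RintegralZl c measurableT (ih P)) (RintegralZl c measurableT (ih N)).
by rewrite (RintegralZl c measurableT (bounded_mul_integrable bh ri)) -Eh mulrBr.
Qed.

Let represented_indic (A : set (borel R d)) : measurable A ->
  represented (\1_A : 'rV[R]_d -> R).
Proof.
move=> mA; split; first exact: bounded_measurable_indic.
have E m : (\int[m]_x (\1_A x : R))%R = fine (m A).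
  by rewrite /Rintegral integral_indic// setIT.
rewrite !E PNr// [in LHS]integral_mkcond /Rintegral; congr fine.
apply: eq_integral => x _; rewrite /patch indicE.
by case: (x \in A); rewrite ?mul1r ?mul0r.
Qed.

Let represented_sum (I : Type) (s : seq I) (F : I -> 'rV[R]_d -> R) :
  (forall i, represented (F i)) -> represented (fun x => \sum_(i <- s) F i x).
Proof.
move=> rF; elim: s => [|i s IH].
  under eq_fun do rewrite big_nil; have := representedZ 0 (represented_indic measurable0).
  by under eq_fun do rewrite mul0r.
by under eq_fun do rewrite big_cons; exact: represented_add.
Qed.

Let represented_lim (hn : nat -> 'rV[R]_d -> R) h (B : R) :
  (forall n, represented (hn n)) -> bounded_measurable h ->
  (forall n x, `|hn n x| <= B) -> (forall x, hn n x @[n --> \oo] --> h x) ->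
  represented h.
Proof.
move=> rn bh hB hl; split=> //.
have mn n : measurable_fun setT (hn n : borel R d -> R) by exact: (rn n).1.1.
have C (m : fmeasure) : (\int[m]_x hn n x)%R @[n --> \oo] --> (\int[m]_x h x)%R.
  apply: (@dominated_cvgR _ _ _ m hn h (cst B)) => //.
  exact: (finite_measure_integrable_cst m B measurableT).
have Cr : (\int[leb]_x (hn n x * r x))%R @[n --> \oo] --> (\int[leb]_x (h x * r x))%R.
  apply: (@dominated_cvgR _ _ _ leb (fun n x => hn n x * r x) (fun x => h x * r x)
    (fun x => B * `|r x|)) => //.
  - move=> n; exact: (integrable_measurable (bounded_mul_integrable (rn n).1 ri)).
  - by move=> x; exact: cvgMl.
  - by apply: rintegrableZ; exact: rintegrable_norm.
  - by move=> n x; rewrite normrM ler_wpM2r.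
have PN n : (\int[P]_x hn n x - \int[N]_x hn n x)%R = (\int[leb]_x (hn n x * r x))%R.
  exact: (rn n).2.
have H : (\int[P]_x hn n x - \int[N]_x hn n x)%R @[n --> \oo] -->
    (\int[P]_x h x - \int[N]_x h x)%R by apply: cvgB; exact: C.
by move: H; under eq_fun do rewrite PN; move=> H; apply: (cvg_unique _ H Cr).
Qed.

Import HBNNSimple.

(** The functions h for which the formula holds contain the indicators of measurable
   sets and are stable under linear combinations and bounded pointwise limits,
   hence they contain all bounded measurable functions. *)
Lemma difference_density h : bounded_measurable h ->
  (\int[P]_x h x - \int[N]_x h x)%R = (\int[leb]_x (h x * r x))%R.
Proof.
suff H g : bounded_measurable g -> (forall x, 0 <= g x) -> represented g.
  move=> bh; have [mh [B hB]] := bh.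
  have bT := bounded_measurable_indic (@measurableT _ (borel R d)).
  have B0 : 0 <= B by apply: le_trans (hB 0).
  suff [_ //] : represented h.
  have -> : h = (fun x => - B * \1_setT x + (h x + B * \1_setT x)).
    by apply/funext => x; ring.
  apply: represented_add; first by apply: representedZ; exact: represented_indic.
  apply: H; first by apply: bounded_measurable_add => //; exact: bounded_measurableZ.
  move=> x; rewrite indicT mulr1; have := hB x; rewrite ler_norml => /andP[+ _].
  by rewrite -subr_ge0 opprK.
move=> bg g0; have [mg [B gB]] := bg.
have mg' : measurable_fun setT (fun x : borel R d => (g x)%:E) by exact/measurable_EFinP.
pose F := nnsfun_approx measurableT mg'.
have cF x : F n x @[n --> \oo] --> g x.
  have := @cvg_nnsfun_approx _ _ _ _ measurableT _ mg' (fun x _ => g0 x) x I.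
  by move=> /fine_cvgP[_].
have ndF x : nondecreasing_seq (F ^~ x).
  by move=> n m nm; have /lefP := nd_nnsfun_approx measurableT mg' nm; exact.
have Fg n x : F n x <= g x.
  rewrite -(cvg_lim _ (cF x))//; apply: nondecreasing_cvgn_le; first exact: ndF.
  by apply/cvg_ex; exists (g x); exact: cF.
apply: (@represented_lim (fun n x => F n x) g B) => //; last first.
  by move=> n x; rewrite ger0_norm// (le_trans (Fg n x))// (le_trans _ (gB x))// ler_norm.
move=> n; under eq_fun do rewrite (fimfunEord (F n)).
apply: represented_sum => i; apply: representedZ; exact: represented_indic.
Qed.

End difference.

End charge_density.

Section vector_charges.
Variables (R : realType) (d l : nat).
Local Notation leb := (lebesgue_rV R d).
Local Notation fmeasure := {finite_measure set (borel R d) -> \bar R}.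
Implicit Types (nu : {charge set (borel R d) -> \bar R}) (mu : vcharge R d l).

Definition charge_pos nu : fmeasure :=
  jordan_pos (svalP (cid (svalP (cid (Hahn_decomposition nu))))).

Definition charge_neg nu : fmeasure :=
  jordan_neg (svalP (cid (svalP (cid (Hahn_decomposition nu))))).

Lemma charge_integralE nu h : charge_integral nu h =
  (\int[charge_pos nu]_x h x - \int[charge_neg nu]_x h x)%R.
Proof. by []. Qed.

Lemma charge_posB nu A : measurable A ->
  fine (charge_pos nu A) - fine (charge_neg nu A) = fine (nu A).
Proof.
move=> mA; rewrite (jordan_decomp (svalP (cid (svalP (cid (Hahn_decomposition nu))))) mA).
rewrite /cadd/= /cscale mulN1e -/(charge_pos nu) -/(charge_neg nu).
by rewrite fineB// fin_num_measure.
Qed.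

Lemma charge_integral_density nu (r h : 'rV[R]_d -> R) : rintegrable r ->
  (forall A, measurable A -> nu A = \int[leb]_(x in A) (r x)%:E)%E ->
  bounded_measurable h -> charge_integral nu h = (\int[leb]_x (h x * r x))%R.
Proof.
move=> ri nur bh; rewrite charge_integralE; apply: (difference_density ri) => // A mA.
by rewrite charge_posB// nur.
Qed.

Lemma cbounded_measurable (h : 'rV[R]_d -> R[i]) B : cmeasurable (h : borel R d -> R[i]) ->
  (forall x, n1 (h x) <= B) -> bounded_measurable (fun x => complex.Re (h x)) /\
  bounded_measurable (fun x => complex.Im (h x)).
Proof.
move=> [mr mi] hB; split; split=> //; exists B => x.
  exact: le_trans (norm_Re_le _) (hB x).
exact: le_trans (norm_Im_le _) (hB x).
Qed.

(** The Jordan decomposition enters only through its values on measurable sets, by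
   [difference_density]. *)
Lemma vcharge_integral_density mu (g : 'rV[R]_d -> 'rV[R[i]]_l) j (h : 'rV[R]_d -> R[i]) B :
  (forall j, lint (fun x => g x 0 j)) -> has_density mu g ->
  cmeasurable (h : borel R d -> R[i]) -> (forall x, n1 (h x) <= B) ->
  vcharge_integral mu j h = cint leb (fun x => h x * g x 0 j).
Proof.
move=> gi dg mh hB; have [br bi] := cbounded_measurable mh hB.
have [gr gim] := gi j.
have [Er Ei] : (forall A, measurable A -> re_charge mu j A =
      \int[leb]_(x in A) (complex.Re (g x 0 j))%:E)%E /\
    (forall A, measurable A -> im_charge mu j A =
      \int[leb]_(x in A) (complex.Im (g x 0 j))%:E)%E.
  have H A (mA : measurable A) := congr1 (fun v : 'rV[R[i]]_l => v 0 j) (dg A mA).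
  split=> A mA; have := H A mA; rewrite !mxE /cintegral => -[e1 e2].
    rewrite -[LHS]fineK ?fin_num_measure// e1 /Rintegral fineK//.
    by apply: integrable_fin_num => //; apply: integrableS gr.
  rewrite -[LHS]fineK ?fin_num_measure// e2 /Rintegral fineK//.
  by apply: integrable_fin_num => //; apply: integrableS gim.
rewrite /vcharge_integral /charge_cintegral.
rewrite !(charge_integral_density gr Er)// !(charge_integral_density gim Ei)//.
apply: complex_ext; rewrite ?ReD ?ImD ?ReM ?ImM/= ?mul0r ?mul1r ?sub0r ?add0r.
  rewrite -RintegralB//; [|exact: bounded_mul_integrable..].
  by apply: eq_Rintegral => x _; rewrite ReM.
rewrite addrC -RintegralD//; [|exact: bounded_mul_integrable..].
by apply: eq_Rintegral => x _; rewrite ImM.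
Qed.

Lemma has_density_exists (g : 'rV[R]_d -> 'rV[R[i]]_l) :
  (forall j, lint (fun x => g x 0 j)) -> exists mu : vcharge R d l, has_density mu g.
Proof.
move=> gi; exists (VCharge (fun j => induced_charge (gi j).1) (fun j => induced_charge (gi j).2)).
by move=> A mA; apply/rowP => j; rewrite !mxE.
Qed.

(** A component of a vector charge is a combination of finite measures with the
   coefficients 1, -1, i, -i; what is linear in the charge reduces to finite measures. *)
Definition measure_parts mu j : seq (R[i] * fmeasure) :=
  [:: (1, charge_pos (re_charge mu j)); (-1, charge_neg (re_charge mu j));
      (0 +i* 1, charge_pos (im_charge mu j)); (- (0 +i* 1), charge_neg (im_charge mu j))].

Lemma vcharge_integralE mu j h :
  vcharge_integral mu j h = \sum_(p <- measure_parts mu j) p.1 * cint p.2 h.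
Proof.
rewrite !big_cons big_nil /vcharge_integral /charge_cintegral !charge_integralE addr0.
by apply: complex_ext; rewrite !(ReD, ImD, ReM, ImM, ReN, ImN)/=; ring.
Qed.

End vector_charges.

(** * Smoothing of finite measures *)

Section smoothing.
Variables (R : realType) (d : nat).
Local Notation leb := (lebesgue_rV R d).
Local Notation fmeasure := {finite_measure set (borel R d) -> \bar R}.
Local Notation kern := (@kernel R d).
Implicit Types (m : fmeasure) (psi : 'rV[R]_d -> R[i]) (a : R).

Lemma bounded_cintegrable m psi B : cmeasurable (psi : borel R d -> R[i]) ->
  (forall x, n1 (psi x) <= B) -> cintegrable m (psi : borel R d -> R[i]).
Proof.
move=> mpsi pB.
exact: (le_cintegrable mpsi pB (finite_measure_integrable_cst m B measurableT)).
Qed.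

(** The convolution of m with the approximate identity. *)
Definition smoothing m a (x : 'rV[R]_d) : R[i] :=
  cint m (fun y : borel R d => kern a (x - (y : 'rV[R]_d))).

Lemma ccontinuous_affine psi a (x : 'rV[R]_d) : ccontinuous psi ->
  ccontinuous (fun y => psi (a *: y + x)).
Proof.
have ca : continuous (fun y : 'rV[R]_d => a *: y + x).
  by move=> y; apply: continuousD; [exact: scaler_continuous|exact: cst_continuous].
move=> [cr ci]; split=> y.
  exact: (continuous_comp (ca y) (cr _)).
exact: (continuous_comp (ca y) (ci _)).
Qed.

Section fixed_scale.
Variables (m : fmeasure) (a : R).
Hypothesis a0 : a != 0.

Let Ki : lint (kern a) := cbandlimited_lint (cbandlimited_kernel d a0).

Let F (z : borel R d * borel R d) := kern a ((z.1 : 'rV[R]_d) - z.2).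

Let F1 y : lint (fun x => F (x, y)).
Proof. exact: (lint_shift (- (y : 'rV[R]_d)) Ki). Qed.

Let F2 x : cintegrable m (fun y => F (x, y)).
Proof.
have [B KB] := cbandlimited_bounded (cbandlimited_kernel d a0).
exact: (bounded_cintegrable m (cintegrable_meas (lint_reflect x Ki)) (fun y => KB _)).
Qed.

Let FI : cintegrable (leb \x m)%E F.
Proof.
apply: (cintegrable_section (m1 := leb) (m2 := m) (F := F) (h := fun=> cL1 (kern a)) _ F1).
- have := cmeasurable_lincomb 1 (-1) (cintegrable_meas Ki).
  by under eq_fun do rewrite scale1r scaleN1r.
- exact: (finite_measure_integrable_cst m (cL1 (kern a)) measurableT).
- by move=> y; rewrite -[leRHS](cL1_shift (- (y : 'rV[R]_d)) Ki).
Qed.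

Lemma lint_smoothing : lint (smoothing m a).
Proof. exact: (cintegrable_cint2 FI F2). Qed.

Lemma cint_kernel_translate psi B (y : 'rV[R]_d) : ccontinuous psi ->
  (forall x, n1 (psi x) <= B) ->
  cint leb (fun x => psi x * kern a (x - y)) =
  cint leb (fun u => kern 1 u * psi (a *: u + y)).
Proof.
move=> cpsi pB.
have fi : lint (fun x => psi x * kern a (x - y)).
  exact: (cintegrable_mul (ccontinuous_measurable cpsi) pB (F1 y)).
have c0 : (`|a|^-1 ^+ d)%:C != 0 :> R[i].
  by rewrite (inj_eq (@complexI R)) expf_neq0// invr_eq0 normr_eq0.
have [B' psi1] : exists B' : R, forall x, n1 (psi x) <= B' by exists B.
have gi : lint (fun u => kern 1 u * psi (a *: u + y)).
  under eq_fun do rewrite mulrC.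
  exact: (cintegrable_mul (ccontinuous_measurable (ccontinuous_affine a y cpsi))
    (fun u => pB _) (cbandlimited_lint (cbandlimited_kernel d (oner_neq0 R)))).
apply: (mulfI c0); rewrite -(cint_affine y a0 fi) -cintZ//; apply: eq_cint => u.
rewrite addrK (kernelE _ a0) scalerA mulVf// scale1r.
by rewrite [RHS]mulrA [RHS]mulrC.
Qed.

(** Fubini, then the substitution x = a u + y in the inner integral. *)
Lemma cint_mul_smoothing psi B : ccontinuous psi -> (forall x, n1 (psi x) <= B) ->
  cint leb (fun x => psi x * smoothing m a x) =
  cint m (fun y : borel R d => cint leb (fun u => kern 1 u * psi (a *: u + (y : 'rV[R]_d)))).
Proof.
move=> cpsi pB.
pose G (z : borel R d * borel R d) := psi z.1 * F z.
have GI : cintegrable (leb \x m)%E G.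
  exact: (cintegrable_mul (cmeasurable_fst (ccontinuous_measurable cpsi)) (fun z => pB _) FI).
have G1 y : lint (fun x => G (x, y)).
  exact: (cintegrable_mul (ccontinuous_measurable cpsi) pB (F1 y)).
have G2 x : cintegrable m (fun y => G (x, y)) by exact: (cintegrableZ (psi x) (F2 x)).
transitivity (cint leb (fun x => cint m (fun y => G (x, y)))).
  by apply: eq_cint => x; rewrite -(cintZ (psi x) (F2 x)).
rewrite (cint_Fubini GI G2 G1); apply: eq_cint => y.
exact: (cint_kernel_translate y cpsi pB).
Qed.

(** [cint_mul_smoothing] for a character, which factors out of the inner integral. *)
Lemma FT_smoothing xi :
  FT (smoothing m a) xi = ccutoff a xi * cint m (fourier_char xi).
Proof.
have cc := @ccontinuous_fourier_char R d xi.
have nc := @n1_fourier_char R d xi.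
rewrite /FT; under eq_cint do rewrite mulrC.
rewrite (cint_mul_smoothing cc nc) -cintZ; last first.
  exact: (bounded_cintegrable m (ccontinuous_measurable cc) nc).
apply: eq_cint => y.
have s1 := cbandlimited_lint (@cbandlimited_kernel R d 1 (oner_neq0 _)).
transitivity (cint leb (fun u =>
    fourier_char xi (y : 'rV[R]_d) * (kern 1 u * fourier_char (a *: xi) u))).
  apply: eq_cint => u; rewrite fourier_charC fourier_charD ![fourier_char _ xi]fourier_charC.
  by rewrite !fourier_charE dotrC dotrZ dotrZ [dotr xi u]dotrC; ring.
rewrite cintZ; last exact: lint_char.
have := @FT_kernel R d 1 (a *: xi) (oner_neq0 _); rewrite /FT => ->.
by rewrite mulrC /ccutoff (cutoffE a).
Qed.

End fixed_scale.

(** In [cint_mul_smoothing] the inner integral tends to psi(y) as a tends to 0, and it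
   is bounded uniformly in y; dominated convergence applies twice. *)
Lemma smoothing_cvg m psi B : ccontinuous psi -> (forall x, n1 (psi x) <= B) ->
  ccvg (fun n => cint leb (fun x => psi x * smoothing m (inv_seq R n) x)) (cint m psi).
Proof.
move=> cpsi pB.
have s1 := cbandlimited_lint (@cbandlimited_kernel R d 1 (oner_neq0 _)).
pose G a (y : 'rV[R]_d) := cint leb (fun u => kern 1 u * psi (a *: u + y)).
have gi a y : lint (fun u => kern 1 u * psi (a *: u + y)).
  under eq_fun do rewrite mulrC.
  exact: (cintegrable_mul (ccontinuous_measurable (ccontinuous_affine a y cpsi))
    (fun u => pB _) s1).
have B0 : 0 <= B by apply: le_trans (n1_ge0 _) (pB 0).
have ki : rintegrable (fun u => B * n1 (kern 1 u)) by apply: rintegrableZ; exact: cintegrable_n1.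
have GB a y : n1 (G a y) <= B * cL1 (kern 1).
  apply: le_trans (n1_cint_le (gi a y)) _.
  rewrite /cL1 -(RintegralZl B measurableT (cintegrable_n1 s1)); apply: le_Rintegral => //.
    exact: (cintegrable_n1 (gi a y)).
  by move=> u _; apply: le_trans (n1M _ _) _; rewrite mulrC ler_wpM2r ?n1_ge0.
have mG a : cintegrable m (G a : borel R d -> R[i]).
  pose H (z : borel R d * borel R d) := kern 1 z.2 * psi (a *: (z.2 : 'rV[R]_d) + (z.1 : 'rV[R]_d)).
  have mH : cmeasurable H.
    apply: cmeasurable_mul; first exact: (cmeasurable_snd (cintegrable_meas s1)).
    have := cmeasurable_lincomb 1 a (ccontinuous_measurable cpsi).
    by congr cmeasurable; apply/funext => z; rewrite scale1r addrC.
  have HI : cintegrable (m \x leb)%E H.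
    apply: (le_cintegrable mH _ (integrable_prodM (m1 := m) (m2 := leb)
      (finite_measure_integrable_cst m 1 measurableT) ki)) => z.
    by rewrite /= mul1r; apply: le_trans (n1M _ _) _; rewrite mulrC ler_wpM2r ?n1_ge0.
  exact: (cintegrable_cint2 HI (gi a)).
have E a : a != 0 -> cint leb (fun x => psi x * smoothing m a x) = cint m (G a).
  by move=> a0; exact: (cint_mul_smoothing m a0 cpsi pB).
rewrite (_ : (fun n => _) = (fun n => cint m (G (inv_seq R n)))); last first.
  by apply/funext => n; exact/E/inv_seq_neq0.
apply: (@cint_dominated _ _ _ m (fun n => G (inv_seq R n)) psi (cst (B * cL1 (kern 1)))).
- by move=> n; exact: (cintegrable_meas (mG _)).
- move=> y; have -> : psi y = cint leb (fun u => kern 1 u * psi y).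
    under eq_cint do rewrite mulrC.
    by rewrite cintZ// cint_kernel ?oner_neq0// mulr1.
  apply: (@cint_dominated _ _ _ leb _ _ (fun u => B * n1 (kern 1 u))) => //.
  + by move=> n; exact: (cintegrable_meas (gi _ _)).
  + move=> u; apply: ccvgM; first exact: ccvg_cst.
    apply: (ccontinuous_ccvg cpsi); have := @cvg_inv_seqZD R d y u.
    by under eq_fun do rewrite addrC.
  + by move=> n u; apply: le_trans (n1M _ _) _; rewrite mulrC ler_wpM2r ?n1_ge0.
- exact: (finite_measure_integrable_cst m _ measurableT).
- by move=> n y; exact: GB.
Qed.

End smoothing.

(** * Density in the weak-* topology *)

Section complex_norm.
Variable R : realType.
Implicit Types z : R[i].

Lemma Re_le_sqrt z : `|complex.Re z| <= Num.sqrt (complex.Re z ^+ 2 + complex.Im z ^+ 2).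
Proof. by rewrite -sqrtr_sqr ler_sqrt ?addr_ge0 ?sqr_ge0// lerDl sqr_ge0. Qed.

Lemma Im_le_sqrt z : `|complex.Im z| <= Num.sqrt (complex.Re z ^+ 2 + complex.Im z ^+ 2).
Proof. by rewrite -sqrtr_sqr ler_sqrt ?addr_ge0 ?sqr_ge0// lerDr sqr_ge0. Qed.

Lemma sqrt_le_n1 z : Num.sqrt (complex.Re z ^+ 2 + complex.Im z ^+ 2) <= n1 z.
Proof.
rewrite -[leRHS](ger0_norm (n1_ge0 z)) -sqrtr_sqr ler_sqrt ?sqr_ge0//.
by rewrite /n1 sqrrD !real_normK ?num_real// addrAC lerDl mulrn_wge0// mulr_ge0.
Qed.

Lemma ccvg_cvg (u : nat -> R[i]) (z : R[i]) : ccvg u z ->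
  u n @[n --> \oo] --> (z : R[i]^o).
Proof.
move=> uz; apply: (iffRL (@cvgrPdist_lt R[i] R[i]^o _ _ _ _ _)) => -[e e'] /=.
rewrite ltcE/= => /andP[/eqP -> e0].
move/cvgrPdist_lt : uz => /(_ e e0); apply: filterS => n.
rewrite sub0r normrN (ger0_norm (n1_ge0 _)) => ue.
rewrite distrC normc_def ltcR; exact: le_lt_trans (sqrt_le_n1 _) ue.
Qed.

Lemma continuous_ccontinuous d (f : 'rV[R]_d -> R[i]) :
  continuous (f : 'rV[R]_d -> R[i]^o) -> ccontinuous f.
Proof.
move=> cf.
have H x (e : R) : 0 < e -> \forall y \near x,
    Num.sqrt (complex.Re (f x - f y) ^+ 2 + complex.Im (f x - f y) ^+ 2) < e.
  move=> e0; have := iffLR (@cvgrPdist_lt R[i] R[i]^o _ _ (nbhs_filter x) _ _) (cf x) e%:C.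
  rewrite ltcR => /(_ e0); apply: filterS => y.
  by rewrite normc_def ltcR.
split=> x; apply: (iffRL (@cvgrPdist_lt R _ _ _ (nbhs_filter x) _ _)) => e /(H x);
  apply: filterS => y /(le_lt_trans _); apply.
  by have := Re_le_sqrt (f x - f y); rewrite ReD ReN.
by have := Im_le_sqrt (f x - f y); rewrite ImD ImN.
Qed.

Lemma n1_le_cvnorm l (v : 'rV[R[i]]_l) j : n1 (v 0 j) <= 2 * cvnorm v.
Proof.
have H : Num.sqrt (complex.Re (v 0 j) ^+ 2 + complex.Im (v 0 j) ^+ 2) <= cvnorm v.
  have -> : Num.sqrt (complex.Re (v 0 j) ^+ 2 + complex.Im (v 0 j) ^+ 2) =
      Normc.normc (v 0 j) by case: (v 0 j).
  have n0 : 0 <= Normc.normc (v 0 j) by case: (v 0 j) => a b; exact: sqrtr_ge0.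
  rewrite -[leLHS](ger0_norm n0) -sqrtr_sqr ler_sqrt; last first.
    by apply: sumr_ge0 => i _; exact: sqr_ge0.
  by rewrite (bigD1 j)//= lerDl; apply: sumr_ge0 => i _; exact: sqr_ge0.
rewrite mulr_natl mulr2n; apply: lerD; apply: le_trans H; [exact: Re_le_sqrt|exact: Im_le_sqrt].
Qed.

End complex_norm.

Section weak_star_density.
Variables (R : realType) (d l k : nat) (Om : sphere R d -> grassmannian R l k).
Hypothesis Om_smooth : smooth_map Om.
Local Notation leb := (lebesgue_rV R d).
Local Notation "'C0'" := (C0 R d l).
Implicit Types (phi : C0) (mu : vcharge R d l) (a : R).

Lemma C0_ccontinuous phi j : ccontinuous (fun x => sval phi x 0 j).
Proof. by apply: continuous_ccontinuous; exact: (svalP phi).1. Qed.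

(** By compactness on a ball, and by the decay at infinity outside of it. *)
Lemma C0_bounded phi : exists2 B, 0 <= B & forall x j, n1 (sval phi x 0 j) <= B.
Proof.
have [r rphi] := (svalP phi).2 1 ltr01.
have bj j : exists B, forall x, n1 (sval phi x 0 j) <= B.
  have [cr ci] := C0_ccontinuous phi j.
  have [Cr Cr0 rC] := continuous_bounded_ball r cr.
  have [Ci Ci0 iC] := continuous_bounded_ball r ci.
  exists (Cr + Ci + 2) => x; have [xr|rx] := leP `|x| r.
    by rewrite -[leLHS]addr0; apply: lerD => //; apply: lerD; [exact: rC|exact: iC].
  apply: le_trans (n1_le_cvnorm _ _) _.
  have /rphi/ltW v1 : r < enorm x.
    apply: lt_le_trans rx _; rewrite -[leLHS]ger0_norm// -sqrtr_sqr ler_sqrt ?normsq_ge0//.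
    exact: normsq_ge.
  by rewrite -[leLHS]add0r; apply: lerD; [exact: addr_ge0|rewrite -[leRHS]mulr1 ler_wpM2l].
have [B hB] := choice bj.
exists (\sum_j `|B j|) => [|x j]; first by apply: sumr_ge0.
apply: le_trans (hB j x) _.
by rewrite (bigD1 j)//=; apply: le_trans (ler_norm _) _; rewrite lerDl sumr_ge0.
Qed.

(** The weak-* topology is that of pointwise convergence on C_0. *)
Lemma weak_star_cvg (s : nat -> vcharge R d l) mu :
  (forall phi, ccvg (fun n => pairing (s n) phi) (pairing mu phi)) ->
  s n @[n --> \oo] --> (mu : weak_star R d l).
Proof.
move=> H A /= [_ [[B oB <-] Bmu BA]].
have : (fun phi => pairing (s n) phi) @[n --> \oo] -->
    ((fun phi => pairing mu phi) : {ptws C0 -> R[i]^o}).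
  apply/cvg_sup => phi; rewrite cvg_image; last first.
    by rewrite eqEsubset; split=> v // _; exists (cst v).
  move=> W Wm; have /ccvg_cvg/(_ W Wm) := H phi.
  rewrite /nbhs/= => sW; exists ((fun f : C0 -> R[i] => f phi) @^-1` W) => //.
  by rewrite eqEsubset; split=> [z [f Wf <-]//|z Wz]; exists (fun=> z).
move=> /(_ B); have nB : nbhs ((fun phi => pairing mu phi) : {ptws C0 -> R[i]^o}) B.
  by apply: open_nbhs_nbhs; split.
by move=> /(_ nB)[N _ NB]; exists N => // n /NB; exact: BA.
Qed.

Definition vsmoothing mu a : 'rV[R]_d -> 'rV[R[i]]_l :=
  fun x => \row_j \sum_(p <- measure_parts mu j) p.1 * smoothing p.2 a x.

Lemma vsmoothingE mu a j : (fun x => vsmoothing mu a x 0 j) =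
  (fun x => \sum_(p <- measure_parts mu j) p.1 * smoothing p.2 a x).
Proof. by apply/funext => x; rewrite mxE. Qed.

Lemma lint_vsmoothing mu a j : a != 0 -> lint (fun x => vsmoothing mu a x 0 j).
Proof.
move=> a0; rewrite vsmoothingE; apply: cintegrable_sum => p.
exact: (cintegrableZ _ (lint_smoothing p.2 a0)).
Qed.

(** The transform of the smoothed charge is the one of mu times a scalar cutoff. *)
Lemma vsmoothing_W1 mu a : a != 0 -> BV Om mu -> W1 Om (vsmoothing mu a).
Proof.
move=> a0 bv; split=> [j|xi xi0]; first exact: lint_vsmoothing.
rewrite (_ : fourier _ xi = ccutoff a xi *: vcharge_fourier mu xi).
  exact/memvZ/bv.
apply/rowP => j; rewrite fourierE mxE vsmoothingE FT_sum; last first.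
  by move=> p; exact: (cintegrableZ _ (lint_smoothing p.2 a0)).
rewrite !mxE vcharge_integralE mulr_sumr; apply: eq_bigr => p _.
rewrite (FTZ _ _ (lint_smoothing p.2 a0)) (FT_smoothing p.2 a0); ring.
Qed.

Lemma vsmoothing_cvg mu phi :
  ccvg (fun n => \sum_j cint leb (fun x => sval phi x 0 j * vsmoothing mu (inv_seq R n) x 0 j))
       (pairing mu phi).
Proof.
have [B B0 phiB] := C0_bounded phi; apply: ccvg_sum => j.
rewrite vcharge_integralE.
have E a : a != 0 -> cint leb (fun x => sval phi x 0 j * vsmoothing mu a x 0 j) =
    \sum_(p <- measure_parts mu j) p.1 * cint leb (fun x => sval phi x 0 j * smoothing p.2 a x).
  move=> a0.
  have Hi p : lint (fun x => sval phi x 0 j * smoothing p a x).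
    exact: (cintegrable_mul (ccontinuous_measurable (C0_ccontinuous phi j))
      (phiB^~ j) (lint_smoothing p a0)).
  under eq_bigr => p do rewrite -(cintZ p.1 (Hi p.2)).
  rewrite -cint_sum; last by move=> p; exact: (cintegrableZ p.1 (Hi p.2)).
  by apply: eq_cint => x; rewrite mxE mulr_sumr; apply: eq_bigr => p _; rewrite mulrCA.
rewrite (_ : (fun n => _) = (fun n => \sum_(p <- measure_parts mu j) p.1 *
    cint leb (fun x => sval phi x 0 j * smoothing p.2 (inv_seq R n) x))); last first.
  by apply/funext => n; exact/E/inv_seq_neq0.
apply: ccvg_sum => p; apply: ccvgM; first exact: ccvg_cst.
exact: (smoothing_cvg p.2 (C0_ccontinuous phi j) (phiB^~ j)).
Qed.

Lemma pairing_density mu (g : 'rV[R]_d -> 'rV[R[i]]_l) phi :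
  (forall j, lint (fun x => g x 0 j)) -> has_density mu g ->
  pairing mu phi = \sum_j cint leb (fun x => sval phi x 0 j * g x 0 j).
Proof.
move=> gi dg; have [B B0 phiB] := C0_bounded phi; apply: eq_bigr => j _.
exact: (vcharge_integral_density j gi dg
  (ccontinuous_measurable (C0_ccontinuous phi j)) (phiB^~ j)).
Qed.

Lemma density_BV mu (g : 'rV[R]_d -> 'rV[R[i]]_l) : W1 Om g -> has_density mu g -> BV Om mu.
Proof.
move=> [gi gOm] dg xi xi0; rewrite (_ : vcharge_fourier mu xi = fourier g xi)//.
apply/rowP => j; rewrite fourierE !mxE.
rewrite (vcharge_integral_density j gi dg
  (ccontinuous_measurable (ccontinuous_fourier_char xi)) (n1_fourier_char xi)).
by apply: eq_cint => x; rewrite mulrC.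
Qed.

(** The smoothings of mu at the scales 1/(n+1) are in W_1 and tend to mu. Each is
   replaced by a Schwartz function of W_1 at L^1 distance less than 1/(n+1), which
   changes the pairing with phi by at most a bound of phi divided by n+1. *)
Lemma BV_weak_star_dense : weak_star_dense_in
  [set mu | exists2 f, (@schwartz R d l `&` W1 Om) f & has_density mu f] (BV Om).
Proof.
split=> [mu [f [_ Wf] df]|mu bv]; first exact: density_BV Wf df.
pose S := [set mu : vcharge R d l | exists2 f, (@schwartz R d l `&` W1 Om) f & has_density mu f].
pose f n := vsmoothing mu (inv_seq R n).
have fi n j : lint (fun x => f n x 0 j) by apply: lint_vsmoothing; exact: inv_seq_neq0.
have /choice[s sP] : forall n, exists nu, S nu /\ forall phi B, 0 <= B ->
    (forall x j, n1 (sval phi x 0 j) <= B) ->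
    n1 (pairing nu phi - \sum_j cint leb (fun x => sval phi x 0 j * f n x 0 j)) <= B * inv_seq R n.
  move=> n; have Wf : W1 Om (f n) by apply: vsmoothing_W1 => //; exact: inv_seq_neq0.
  have [g [sg Wg] gf] := W1_density Om_smooth Wf (inv_seq_gt0 R n).
  have [nu dnu] := has_density_exists Wg.1.
  exists nu; split=> [|phi B B0 phiB]; first by exists g.
  have mphi j := ccontinuous_measurable (C0_ccontinuous phi j).
  have gi j : lint (fun x => sval phi x 0 j * g x 0 j).
    exact: (cintegrable_mul (mphi j) (phiB^~ j) (Wg.1 j)).
  have fi' j : lint (fun x => sval phi x 0 j * f n x 0 j).
    exact: (cintegrable_mul (mphi j) (phiB^~ j) (fi n j)).
  have di j : lint (fun x => g x 0 j - f n x 0 j) by exact: (cintegrable_sub (Wg.1 j) (fi n j)).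
  have pdi j : lint (fun x => sval phi x 0 j * (g x 0 j - f n x 0 j)).
    exact: (cintegrable_mul (mphi j) (phiB^~ j) (di j)).
  rewrite (pairing_density phi Wg.1 dnu) -sumrB.
  apply: le_trans (n1_sum _ _ _) _.
  have H j : n1 (cint leb (fun x => sval phi x 0 j * g x 0 j) -
      cint leb (fun x => sval phi x 0 j * f n x 0 j)) <=
      B * cL1 (fun x => g x 0 j - f n x 0 j).
    rewrite -(cintB (gi j) (fi' j)).
    rewrite (_ : cint leb _ =
      cint leb (fun x => sval phi x 0 j * (g x 0 j - f n x 0 j))); last first.
      by apply: eq_cint => x; rewrite mulrBr.
    apply: le_trans (n1_cint_le (pdi j)) _.
    rewrite /cL1 -(RintegralZl B measurableT (cintegrable_n1 (di j))).
    apply: le_Rintegral => //; first exact: (cintegrable_n1 (pdi j)).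
      exact: (rintegrableZ _ (cintegrable_n1 (di j))).
    by move=> x _; apply: le_trans (n1M _ _) _; rewrite ler_wpM2r ?n1_ge0.
  apply: le_trans (ler_sum _ (fun j _ => H j)) _; rewrite -mulr_sumr.
  by apply: ler_wpM2l => //; exact: ltW.
have cs phi : ccvg (fun n => pairing (s n) phi) (pairing mu phi).
  have [B B0 phiB] := C0_bounded phi.
  have c1 : ccvg (fun n => pairing (s n) phi -
      \sum_j cint leb (fun x => sval phi x 0 j * f n x 0 j)) 0.
    apply: (@ccvg_le _ _ _ (fun n => B * inv_seq R n)).
      by move=> n; rewrite subr0; exact: (sP n).2.
    by rewrite -(mulr0 B); apply: cvgMr; exact: cvg_inv_seq.
  have := ccvgD c1 (vsmoothing_cvg mu phi); rewrite add0r.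
  by congr (ccvg _ _); apply/funext => n; rewrite subrK.
move=> A /(weak_star_cvg cs)[N _ /(_ N (leqnn N)) AN].
by exists (s N); split=> //; exact: (sP N).1.
Qed.

End weak_star_density.

Theorem proposition1p11 (R : realType) (d l k : nat)
    (d_ge1 : (1 <= d)%N) (k_ge1 : (1 <= k)%N) (k_le_l : (k <= l)%N)
    (Om : sphere R d -> grassmannian R l k) (Om_smooth : smooth_map Om) :
  L1_dense_in (@schwartz R d l `&` W1 Om) (W1 Om) /\
  weak_star_dense_in
    [set mu | exists2 f, (@schwartz R d l `&` W1 Om) f & has_density mu f]
    (BV Om).
Proof. by split; [exact: W1_L1_dense|exact: BV_weak_star_dense]. Qed.
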